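(* Assume that, as $N\to\infty$, $M\to\infty$, one has $n\to\infty$, $m\to\infty$, $p=n/N\to0$, $q=m/M\to0$, and that $$\frac{\log(p^{-1})}m+\frac{\log(q^{-1})}n\to0 .$$ Upper bounds. If $a=a_{NM}>0$ is such that one of the following conditions holds: $$\text{(i)}\quad A'(s^0+a)\sqrt{nmpq}\to\infty\qquad\text{or}\qquad\text{(ii)}\quad\liminf\frac{A'(s^0+a)\sqrt{nm}}{\sqrt{2\left(n\log(p^{-1})+m\log(q^{-1})\right)}}>1,$$ then the test $\psi^*=\max\{\mathbf 1_{\{t_{\mathrm{lin}}>H\}},\mathbf 1_{\{t_{\max}>T_{nm,\delta}\}}\}$, where $\delta>0$ is a constant chosen small enough and $H=H_{NM}\to\infty$ is such that moreover $H\le c\,A'(s^0+a)\sqrt{nmpq}$ for some constant $0<c<1$ when (i) holds, satisfies $\gamma_{nm,a}(\psi^* )\to0$. Lower bounds. Assume, moreover, that $$\frac{\log\log(p^{-1})}{\log(q^{-1})}\to0,\qquad\frac{\log\log(q^{-1})}{\log(p^{-1})}\to0,\qquad n\log(p^{-1})\asymp m\log(q^{-1}).$$ If $a=a_{NM}>0$ is such that $$a^2nmpq\to0\qquad\text{and}\qquad\limsup\frac{a^2nm}{2\left(n\log(p^{-1})+m\log(q^{-1})\right)}<1,$$ then $\gamma_{nm,a}\to1$ and $\beta_{nm,a,\alpha}\to1-\alpha$ for any $\alpha\in(0,1)$.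
   Context: Exponential family setting. Let $X_{ij}$, $1\le i\le N$, $1\le j\le M$, be independent, $X_{ij}$ having density $g_{\theta_{ij}}$ with respect to a dominating measure $\mu$, where $g_\theta(x)=e^{\eta(\theta)T(x)-C(\theta)}h(x)$, $\theta\in\Theta\subset\mathbb R$, and $\eta$ is twice continuously differentiable with $\eta'>0$ on $\Theta$. Let $\theta^0$ be an interior point of $\Theta$, $m^0=E_{\theta^0}T(X)$, $\sigma^0=\sqrt{\mathrm{Var}_{\theta^0}(T(X))}$, and rescale the observations: $Y_{ij}=(T(X_{ij})-m^0)/\sigma^0$. In terms of $s=\eta(\theta)\sigma^0$, the density of $Y_{ij}$ (with respect to a suitable dominating measure) has the form $f_s(y)=e^{sy-A(s)}\tilde h(y)$, where $A(s)=B(s/\sigma^0)-s\,m^0/\sigma^0$ and $B(\eta(\theta))=C(\theta)$. Put $s^0=\eta(\theta^0)\sigma^0$. Then $A'(s^0)=0$, $A''(s^0)=1$, and, as $a\to0$, $A(s^0+a)-A(s^0)\sim a^2/2$, $A'(s^0+a)\sim a$. $E_S$ denotes expectation when the $Y_{ij}$ are independent with densities $f_{s_{ij}}$, $S=\{s_{ij}\}$; the null hypothesis is $s_{ij}=s^0$ for all $i,j$, with expectation $E_{s^0}$. $\mathcal C_{nm}$ is the collection of all sets $C=A_1\times B_1$ with $A_1\subset\{1,\dots,N\}$, $\#A_1=n$, $B_1\subset\{1,\dots,M\}$, $\#B_1=m$. The alternative set $\mathcal S_{nm,a}$ consists of the parameter matrices $S$ (with entries in the parameter set of the family $f_s$)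 for which there is $C\in\mathcal C_{nm}$ with $s_{ij}=s^0$ for $(i,j)\notin C$ and $s_{ij}-s^0\ge a$ for $(i,j)\in C$. The integers $n=n_{NM}\le N$, $m=m_{NM}\le M$ and $a=a_{NM}$ depend on $N,M$; limits are as $N\to\infty$, $M\to\infty$; $p=n/N$, $q=m/M$; $u\asymp v$ means $0<\liminf u/v\le\limsup u/v<\infty$. The family is fixed (does not depend on $N,M$). A test is a measurable $\psi=\psi(\mathbf Y)\in[0,1]$; $\alpha(\psi)=E_{s^0}\psi$, $\beta_{nm,a}(\psi)=\sup_{S\in\mathcal S_{nm,a}}E_S(1-\psi)$, $\gamma_{nm,a}(\psi)=\alpha(\psi)+\beta_{nm,a}(\psi)$, $\gamma_{nm,a}=\inf_\psi\gamma_{nm,a}(\psi)$, $\beta_{nm,a,\alpha}=\inf_{\psi:\alpha(\psi)\le\alpha}\beta_{nm,a}(\psi)$. Statistics: $t_{\mathrm{lin}}=\frac1{\sqrt{NM}}\sum_{i,j}Y_{ij}$, $t_{\max}=\max_{C\in\mathcal C_{nm}}\frac1{\sqrt{nm}}\sum_{(i,j)\in C}Y_{ij}$, $T_{nm,\delta}=\sqrt{(2+\delta)\log\left(\binom Nn\binom Mm\right)}$. *)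

(* Defs.v *)
From HB Require Import structures.
From mathcomp Require Import all_boot all_order all_algebra.
From mathcomp Require Import all_classical all_reals all_analysis.
From mathcomp Require Import measurable_realfun ring.

Set Implicit Arguments.
Unset Strict Implicit.
Unset Printing Implicit Defensive.

Import Order.TTheory GRing.Theory Num.Theory.
Import numFieldNormedType.Exports.

Local Open Scope classical_set_scope.
Local Open Scope ring_scope.

(* Finite products of probability measures.  [n.-tuple T] carries the
   sigma-algebra generated by the coordinates; [prod_prob P] is the law of a
   tuple of independent variables with marginals [P i], see [prod_probE]. *)
Section prod_prob.
Context d (T : measurableType d) (R : realType).

Definition tuple_cons n (x : T * n.-tuple T) : n.+1.-tuple T :=
  [the n.+1.-tuple T of x.1 :: x.2].

Lemma measurable_tuple_cons n : measurable_fun [set: T * n.-tuple T] (@tuple_cons n).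
Proof. by apply: measurable_cons; [exact: measurable_fst|exact: measurable_snd]. Qed.

HB.instance Definition _ n :=
  isMeasurableFun.Build _ _ _ _ (@tuple_cons n) (@measurable_tuple_cons n).

Fixpoint prod_prob n : ('I_n -> probability T R) -> probability (n.-tuple T) R :=
  match n with
  | 0 => fun _ => \d_([tuple] : 0.-tuple T)
  | n'.+1 => fun P =>
      distribution (P ord0 \x prod_prob (fun i => P (lift ord0 i)))%E
        (@tuple_cons n')
  end.

Lemma prod_probE n (P : 'I_n -> probability T R) (D : 'I_n -> set T) :
  (forall i, measurable (D i)) ->
  prod_prob P [set t | forall i, D i (tnth t i)] = (\prod_(i < n) P i (D i))%E.
Proof.
elim: n P D => [|n IH] P D mD.
  rewrite big_ord0 /= diracE mem_set//=; by case.
have mbox : measurable [set t : n.-tuple T | forall i, D (lift ord0 i) (tnth t i)].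
  rewrite [X in measurable X](_ : _ =
    \bigcap_(i in [set: 'I_n]) ((@tnth n T ^~ i) @^-1` D (lift ord0 i))).
    apply: fin_bigcap_measurable => // i _; rewrite -[X in measurable X]setTI.
    exact: measurable_tnth.
  by apply/seteqP; split => t /= H i; [move=> _; exact: H|exact: (H i)].
rewrite big_ord_recl -(IH _ (fun i => D (lift ord0 i)))//.
rewrite /= /distribution /pushforward.
rewrite -product_measure1E//; congr (_ _).
apply/seteqP; split => -[x t] /= H.
  split; first by have := H ord0; rewrite tnth0.
  by move=> i; have := H (lift ord0 i); rewrite tnthS.
move=> i; have [H1 H2] := H.
by case: (unliftP ord0 i) => [j|] ->; [rewrite tnthS; exact: H2|rewrite tnth0].
Qed.

End prod_prob.

Definition expdensity (X : Type) (R : realType) (eta C : R -> R)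
    (T h : X -> R) (t : R) (x : X) : R :=
  expR (eta t * T x - C t) * h x.

(* [ef_eta] is a total function, only its values on [ef_Theta] matter: at a point
   of [ef_Theta] that is not interior, [ef_eta_C2] asks for a C^2 extension. *)
Record expFamily d (X : measurableType d) (R : realType) := ExpFamily {
  ef_mu : {measure set X -> \bar R} ;
  ef_Theta : set R ;
  ef_eta : R -> R ;
  ef_C : R -> R ;
  ef_T : {mfun X >-> R} ;
  ef_h : X -> R ;
  ef_h_measurable : measurable_fun [set: X] ef_h ;
  ef_h_ge0 : forall x, 0 <= ef_h x ;
  ef_law : R -> probability X R ;
  ef_lawE : forall t D, ef_Theta t -> measurable D ->
    ef_law t D =
    (\int[ef_mu]_(x in D) (expdensity ef_eta ef_C ef_T ef_h t x)%:E)%E ;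
  ef_eta_C2 : forall t, ef_Theta t ->
    (\forall u \near t, derivable ef_eta u 1 /\ derivable (derive1 ef_eta) u 1) /\
    {for t, continuous (derive1n 2 ef_eta)} ;
  ef_eta_gt0 : forall t, ef_Theta t -> 0 < derive1 ef_eta t
}.

Lemma ef_C_eta d (X : measurableType d) (R : realType) (E : expFamily X R) t u :
  ef_Theta E t -> ef_Theta E u -> ef_eta E t = ef_eta E u -> ef_C E t = ef_C E u.
Proof.
move=> Tt Tu tu; apply/eqP; rewrite eq_sym -subr_eq0; apply/eqP/expR_inj.
rewrite expR0; apply: EFin_inj; rewrite -(probability_setT (ef_law E t)).
rewrite (ef_lawE Tt)// /expdensity.
have mu_ : measurable_fun [set: X]
    (expdensity (ef_eta E) (ef_C E) (ef_T E) (ef_h E) u : X -> R).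
  apply: measurable_funM; last exact: ef_h_measurable.
  apply: measurableT_comp => //; apply: measurable_funB => //.
  exact: measurable_funM.
transitivity ((expR (ef_C E u - ef_C E t))%:E * ef_law E u setT)%E.
  by rewrite probability_setT mule1.
rewrite (ef_lawE Tu)// -ge0_integralZl ?lee_fin ?expR_ge0//; last 2 first.
  - exact/measurable_EFinP.
  - by move=> x _; rewrite lee_fin mulr_ge0 ?expR_ge0 ?ef_h_ge0.
  apply: eq_integral => x _; rewrite -EFinM /expdensity tu mulrA -expRD.
  by congr (expR _ * _)%:E; ring.
Qed.

Section rescaling.
Context d (X : measurableType d) (R : realType) (E : expFamily X R) (t0 : R).

Definition m0 : R := fine ('E_(ef_law E t0)[ef_T E])%E.

Definition sigma0 : R := Num.sqrt (fine ('V_(ef_law E t0)[ef_T E])%E).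

Definition Ystd (x : X) : R := (ef_T E x - m0) / sigma0.

Lemma measurable_Ystd : measurable_fun [set: X] Ystd.
Proof. by apply: measurable_funM => //; exact: measurable_funB. Qed.

HB.instance Definition _ := isMeasurableFun.Build _ _ _ _ Ystd measurable_Ystd.

Definition s0 : R := ef_eta E t0 * sigma0.

Definition sset : set R := [set ef_eta E t * sigma0 | t in ef_Theta E].

(* The law of [Ystd] under any [t] in [ef_Theta E] with [ef_eta E t * sigma0 = s],
   see [ylawE]; for [s] outside [sset] the value is irrelevant. *)
Definition ylaw (s : R) : probability R R :=
  distribution
    (ef_law E (xget t0 [set t | ef_Theta E t /\ ef_eta E t * sigma0 = s])) Ystd.

Definition Afun (B : R -> R) (s : R) : R := B (s / sigma0) - s * m0 / sigma0.

Lemma ylawE (t : R) (D : set R) :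
  0 < sigma0 -> ef_Theta E t -> measurable D ->
  ylaw (ef_eta E t * sigma0) D = ef_law E t (Ystd @^-1` D).
Proof.
move=> sg Tt mD; rewrite /ylaw /distribution /pushforward.
case: xgetP => [u _ [Tu /(mulIf (lt0r_neq0 sg)) tu]|/(_ t)]; last by case.
have mY : measurable (Ystd @^-1` D).
  by rewrite -[X in measurable X]setTI; exact: measurable_Ystd.
transitivity (ef_law E u (Ystd @^-1` D)); first by [].
by rewrite (ef_lawE Tu mY) (ef_lawE Tt mY) /expdensity tu (ef_C_eta Tu Tt tu).
Qed.

Lemma expdensity_Ystd (B : R -> R) (t : R) (x : X) :
  0 < sigma0 -> ef_Theta E t -> B (ef_eta E t) = ef_C E t ->
  let s := ef_eta E t * sigma0 in
  expdensity (ef_eta E) (ef_C E) (ef_T E) (ef_h E) t x =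
  expR (s * Ystd x - Afun B s) * ef_h E x.
Proof.
move=> sg Tt BC s; have sg0 := lt0r_neq0 sg.
rewrite /expdensity /Afun /Ystd /s mulfK// BC.
by congr (expR _ * _); field.
Qed.

End rescaling.

Section testing.
Context d (X : measurableType d) (R : realType) (E : expFamily X R) (t0 : R).
Variables N M : nat.

Definition obs := N.-tuple (M.-tuple R).

Definition entry (y : obs) (i : 'I_N) (j : 'I_M) : R := tnth (tnth y i) j.

Definition model (S : 'M[R]_(N, M)) : probability (N.-tuple (M.-tuple R)) R :=
  prod_prob (fun i => prod_prob (fun j => ylaw E t0 (S i j))).

(* A pair [C] stands for the rectangle [C.1 x C.2]. *)
Definition rect_of_size (n m : nat) (C : {set 'I_N} * {set 'I_M}) : bool :=
  (#|C.1| == n) && (#|C.2| == m).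

Definition in_rect (C : {set 'I_N} * {set 'I_M}) (i : 'I_N) (j : 'I_M) : bool :=
  (i \in C.1) && (j \in C.2).

Definition alternatives (n m : nat) (a : R) : set 'M[R]_(N, M) :=
  [set S | (forall i j, sset E t0 (S i j)) /\
    exists C : {set 'I_N} * {set 'I_M}, [/\ rect_of_size n m C,
      forall i j, ~~ in_rect C i j -> S i j = s0 E t0 &
      forall i j, in_rect C i j -> a <= S i j - s0 E t0]].

Definition is_test (psi : obs -> R) : Prop :=
  measurable_fun [set: N.-tuple (M.-tuple R)] psi /\ forall y, 0 <= psi y <= 1.

Definition type1 (psi : obs -> R) : \bar R :=
  ('E_(model (const_mx (s0 E t0)))[psi])%E.

Definition type2 (n m : nat) (a : R) (psi : obs -> R) : \bar R :=
  ereal_sup [set ('E_(model S)[fun y => (1 - psi y)%R])%E | S in alternatives n m a].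

Definition risk (n m : nat) (a : R) (psi : obs -> R) : \bar R :=
  (type1 psi + type2 n m a psi)%E.

Definition minimax_risk (n m : nat) (a : R) : \bar R :=
  ereal_inf [set risk n m a psi | psi in [set psi | is_test psi]].

Definition minimax_type2 (n m : nat) (a alpha : R) : \bar R :=
  ereal_inf [set type2 n m a psi |
    psi in [set psi | is_test psi /\ (type1 psi <= alpha%:E)%E]].

Definition tlin (y : obs) : R :=
  (Num.sqrt (N * M)%:R)^-1 * \sum_(i < N) \sum_(j < M) entry y i j.

Definition tmax (n m : nat) (y : obs) : \bar R :=
  \big[Order.max/-oo%E]_(C : {set 'I_N} * {set 'I_M} | rect_of_size n m C)
    ((Num.sqrt (n * m)%:R)^-1 *
       \sum_(i in C.1) \sum_(j in C.2) entry y i j)%:E.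

Definition threshold (n m : nat) (delta : R) : R :=
  Num.sqrt ((2 + delta) * ln ('C(N, n) * 'C(M, m))%:R).

Definition psistar (n m : nat) (delta H : R) (y : obs) : R :=
  Num.max (H < tlin y)%R%:R ((threshold n m delta)%:E < tmax n m y)%E%:R.

End testing.

Definition asymp_equiv (R : realType) (u v : nat -> R) : Prop :=
  (0 < limn_einf (fun k => (u k / v k)%:E))%E /\
  (limn_esup (fun k => (u k / v k)%:E) < +oo)%E.

(* Main.v *)
Require Import Defs.
From HB Require Import structures.
From mathcomp Require Import all_boot all_order all_algebra.
From mathcomp Require Import all_classical all_reals all_analysis.
From mathcomp Require Import measurable_realfun.
From mathcomp Require Import ring lra.

Set Implicit Arguments.
Unset Strict Implicit.
Unset Printing Implicit Defensive.

Import Order.TTheory GRing.Theory Num.Theory.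
Import numFieldNormedType.Exports.

Local Open Scope classical_set_scope.
Local Open Scope ring_scope.

(* Write [phi u = A (s0 + u) - A s0]; it is the cumulant generating function of the standardized
   null law, so [phi u ~ u^2 / 2], and exponential moments of linear statistics are explicit.

   Upper bound: Chernoff bounds.  Under the null, each rectangle sum is controlled by an
   exponential moment and a union bound over the [C(N, n) C(M, m)] rectangles, whose logarithm is
   [n log (1/p) + m log (1/q)] up to lower order terms.  Under an alternative, Chebyshev's
   association inequality reduces an entry with [s - s0 >= a] to one with [s - s0 = a].

   Lower bound: second moment of the truncated likelihood ratio, averaged over a uniformly chosen
   rectangle.  The likelihood of a rectangle is cut off as soon as the sum over one of its large
   [k x l] subrectangles exceeds [sqrt (2 k l (k log (1/p) + l log (1/q)))], a level which is almost
   never exceeded by a subrectangle of the planted one.  Without truncation an overlap of size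
   [k x l] contributes [expR (a^2 k l)]; the overlap sizes being dominated by Poisson-like
   exponential moments, the sum is [1 + o(1)] for small overlaps because [a^2 n m p q -> 0], and for
   large ones thanks to the truncation. *)

(** * Densities and product laws *)

(** The upper bound does not assume that [a] tends to 0, and the entries of an alternative are
    bounded only from below. Expansions around [s0] hold in a fixed window only, so [a <= eps] and
    [a >= eps] are treated separately; in the second case one Chernoff bound for the scan statistic,
    at a fixed tilt per entry, is enough. In the lower bound the convergence of [a] to 0 is a
    consequence of the rate condition. Truncation is restricted to subrectangles whose sides exceed
    a fraction [rho] of [n] and [m]: there the critical level per entry stays inside the window, and
    the tail exponent is of the order of the rate, so that it beats the [2 ^ (n + m)] terms of a
    crude union bound. Thinner overlaps are handled by the balance of [n log (1/p)] and
    [m log (1/q)], which bounds [a^2 n] by a multiple of [log (1/q)] and [a^2 m] by a multiple of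
    [log (1/p)]; [rho] is chosen to make these multiples small. The conditions on the iterated
    logarithms serve the overlaps with few columns. *)

Section density.
Context d (T : measurableType d) (R : realType).
Local Open Scope ereal_scope.

(** Tested on nonnegative functions and not on sets: this is the form in which changes of measure
    are used, and the one that passes through an induction on coordinates. *)
Definition has_density (nu mu : {measure set T -> \bar R}) (w : T -> R) :=
  forall f : T -> \bar R, measurable_fun [set: T] f -> (forall x, 0 <= f x) ->
    \int[nu]_x f x = \int[mu]_x (f x * (w x)%:E).

Import HBNNSimple.

Lemma has_densityP (nu mu : {measure set T -> \bar R}) (w : T -> R) :
  measurable_fun [set: T] w -> (forall x, 0 <= w x)%R ->
  (forall D, measurable D -> nu D = \int[mu]_(x in D) (w x)%:E) ->
  has_density nu mu w.
Proof.
move=> mw w0 nuE f mf f0.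
pose g := nnsfun_approx measurableT mf.
have gf x : (fun n => (g n x)%:E) @ \oo --> f x.
  by apply: (cvg_nnsfun_approx measurableT mf).
have step n : \int[nu]_x (g n x)%:E = \int[mu]_x (g n x * w x)%:E.
  transitivity (\int[mu]_x (\sum_(y \in range (g n))
      (y * \1_(g n @^-1` [set y]) x * w x)%:E)); last first.
    apply: eq_integral => x _; rewrite fsbig_finite//= sumEFin.
    rewrite [in RHS]fimfunE fsbig_finite//= mulr_suml.
    by congr (_%:E); apply: eq_bigr => y _; rewrite mulrAC.
  rewrite ge0_integral_fsum//; last 2 first.
  - move=> y; apply/measurable_EFinP; apply: measurable_funM => //.
    exact: measurable_funM.
  (* [y] is an arbitrary real here, possibly negative; where the indicator does not vanish, [y] is a
     value of [g n], hence nonnegative. *)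
  - move=> y x _; rewrite lee_fin mulr_ge0//.
    have [->|yg] := eqVneq ((\1_(g n @^-1` [set y]) x) : R) 0%R; first by rewrite mulr0.
    rewrite mulr_ge0//.
    move: yg; rewrite indicE; case: (boolP (x \in _)) => [|_]; last by rewrite eqxx.
    by rewrite inE/= => <- _.
  rewrite integralT_nnsfun sintegralE; apply: eq_fsbigr => y /[!inE] -[z _ gz].
  have y0 : (0 <= y)%R by rewrite -gz.
  have mA : measurable (g n @^-1` [set y]) by exact: measurable_funPTI.
  rewrite nuE// integral_mkcond -ge0_integralZl//=; last 2 first.
  - by apply/(measurable_restrictT _ mA)/measurable_EFinP/measurable_funTS.
  - by move=> x _; apply: erestrict_ge0 => t _; rewrite lee_fin.
  apply: eq_integral => x _; rewrite patchE indicE.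
  by case: ifPn => _; rewrite ?mule0 ?mulr0 ?mul0r// mulr1.
transitivity (limn (fun n => \int[nu]_x (g n x)%:E)).
  rewrite -monotone_convergence//.
  - by apply: eq_integral => x _; apply/esym/cvg_lim.
  - by move=> n; exact/measurable_EFinP.
  - by move=> n x _; rewrite lee_fin.
  - by move=> x _ a b ab; rewrite lee_fin; exact/lefP/nd_nnsfun_approx.
under eq_fun do rewrite step.
rewrite -monotone_convergence//.
- apply: eq_integral => x _; apply/cvg_lim => //.
  by under eq_fun do rewrite EFinM; apply: cvgeZr.
- by move=> n; exact/measurable_EFinP/measurable_funM.
- by move=> n x _; rewrite lee_fin mulr_ge0.
- move=> x _ a b ab; rewrite lee_fin ler_wpM2r//.
  exact/lefP/nd_nnsfun_approx.
Qed.

End density.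

Section prod_prob_theory.
Context d (T : measurableType d) (R : realType).
Local Open Scope ereal_scope.

Lemma ge0_integral_prod_probS n (P : 'I_n.+1 -> probability T R)
    (f : n.+1.-tuple T -> \bar R) :
  measurable_fun [set: n.+1.-tuple T] f -> (forall t, 0 <= f t) ->
  \int[prod_prob P]_t f t =
  \int[P ord0]_x \int[prod_prob (fun i => P (lift ord0 i))]_t f (tuple_cons (x, t)).
Proof.
move=> mf f0; rewrite /= ge0_integral_distribution//.
rewrite fubini_tonelli1//; last by move=> x; exact: f0.
exact: (measurableT_comp mf (@measurable_tuple_cons _ T n)).
Qed.

Lemma ge0_integral_prod_prob0 (P : 'I_0 -> probability T R)
    (f : 0.-tuple T -> \bar R) :
  measurable_fun [set: 0.-tuple T] f -> \int[prod_prob P]_t f t = f [tuple].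
Proof. by move=> mf; rewrite /= integral_dirac// diracT mul1e. Qed.

Lemma measurable_prod_tnth n (f : 'I_n -> T -> R) :
  (forall i, measurable_fun [set: T] (f i)) ->
  measurable_fun [set: n.-tuple T] (fun t => \prod_(i < n) f i (tnth t i))%R.
Proof.
move=> mf; apply: measurable_prod => i _; apply: measurableT_comp => //.
exact: measurable_tnth.
Qed.

Lemma integral_prod_prob n (P : 'I_n -> probability T R) (f : 'I_n -> T -> R) :
  (forall i, measurable_fun [set: T] (f i)) -> (forall i x, 0 <= f i x)%R ->
  \int[prod_prob P]_t (\prod_(i < n) f i (tnth t i))%:E =
  \prod_(i < n) \int[P i]_x (f i x)%:E.
Proof.
elim: n P f => [|n IH] P f mf f0.
  rewrite ge0_integral_prod_prob0; last by apply/measurable_EFinP; exact: (measurable_prod_tnth mf).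
  by rewrite !big_ord0.
rewrite ge0_integral_prod_probS; last 2 first.
- by apply/measurable_EFinP; exact: (measurable_prod_tnth mf).
- by move=> t; rewrite lee_fin prodr_ge0.
rewrite big_ord_recl -(IH _ (fun i => f (lift ord0 i)))//.
rewrite -ge0_integralZr//; last 3 first.
- exact/measurable_EFinP.
- by move=> x _; rewrite lee_fin.
- by apply: integral_ge0 => t _; rewrite lee_fin prodr_ge0.
apply: eq_integral => x _; rewrite -ge0_integralZl//; last 3 first.
- apply/measurable_EFinP.
  exact: (measurable_prod_tnth (f:=fun i => f (lift ord0 i))).
- by move=> t _; rewrite lee_fin prodr_ge0.
- by rewrite lee_fin.
apply: eq_integral => t _; rewrite big_ord_recl tnth0 EFinM.
by under eq_bigr do rewrite tnthS.
Qed.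

(** Induction on the number of coordinates: the inner integral is changed first, and its
    measurability in the first coordinate comes from Tonelli. *)
Lemma prod_prob_density n (P Q : 'I_n -> probability T R) (w : 'I_n -> T -> R) :
  (forall i, measurable_fun [set: T] (w i)) -> (forall i x, 0 <= w i x)%R ->
  (forall i, has_density (P i) (Q i) (w i)) ->
  has_density (prod_prob P) (prod_prob Q) (fun t => \prod_(i < n) w i (tnth t i))%R.
Proof.
elim: n P Q w => [|n IH] P Q w mw w0 PQ f mf f0.
  rewrite !ge0_integral_prod_prob0 ?big_ord0 ?mule1//.
  by apply: emeasurable_funM => //; apply/measurable_EFinP; exact: (measurable_prod_tnth mw).
have mwt : measurable_fun [set: n.-tuple T]
    (fun t => \prod_(i < n) w (lift ord0 i) (tnth t i))%R.
  exact: (measurable_prod_tnth (f:=fun i => w (lift ord0 i))).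
have mfw : measurable_fun [set: n.+1.-tuple T]
    (fun t => f t * (\prod_(i < n.+1) w i (tnth t i))%:E).
  by apply: emeasurable_funM => //; apply/measurable_EFinP; exact: (measurable_prod_tnth mw).
have mfc x : measurable_fun [set: n.-tuple T] (fun t => f (tuple_cons (x, t))).
  by apply: measurableT_comp => //; exact: (measurableT_comp (@measurable_tuple_cons _ _ _)).
rewrite !ge0_integral_prod_probS//; last first.
  by move=> t; rewrite mule_ge0// lee_fin prodr_ge0.
pose F x := \int[prod_prob (fun i => Q (lift ord0 i))]_t
  (f (tuple_cons (x, t)) * (\prod_(i < n) w (lift ord0 i) (tnth t i))%:E).
transitivity (\int[P ord0]_x F x).
  by apply: eq_integral => x _; apply: (IH _ _ (fun i => w (lift ord0 i))).
have mFs : measurable_fun [set: T * n.-tuple T] (fun z =>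
    f (tuple_cons z) * (\prod_(i < n) w (lift ord0 i) (tnth z.2 i))%:E).
  apply: emeasurable_funM; first exact: measurableT_comp.
  apply/measurable_EFinP.
  exact: (measurableT_comp mwt measurable_snd).
have Fs0 z : 0 <= f (tuple_cons z) * (\prod_(i < n) w (lift ord0 i) (tnth z.2 i))%:E.
  by rewrite mule_ge0// lee_fin prodr_ge0.
rewrite (PQ ord0)//; last 2 first.
- exact: (measurable_fun_fubini_tonelli_F
    (m2 := prod_prob (fun i => Q (lift ord0 i))) _ mFs Fs0).
- by move=> x; apply: integral_ge0 => t _; exact: (Fs0 (x, t)).
apply: eq_integral => x _; rewrite -ge0_integralZr//; last 2 first.
- by apply: emeasurable_funM => //; exact/measurable_EFinP.
- by rewrite lee_fin.
apply: eq_integral => t _; rewrite big_ord_recl tnth0 -muleA -EFinM.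
under [in RHS]eq_bigr do rewrite tnthS.
by rewrite mulrC.
Qed.

End prod_prob_theory.

(** * Exponential moments *)

Section exponential_inequalities.
Context (R : realType).
Implicit Types x z : R.

Lemma ge0_is_derive_ge0 (f df : R -> R) x :
  (forall y : R, is_derive y 1 f (df y)) -> (forall y, 0 < y -> 0 <= df y) ->
  0 <= x -> f 0 <= f x.
Proof.
move=> fdf df0; rewrite le_eqVlt => /predU1P[<-//|x0].
have [|c] := @MVT R f df _ _ x0 (fun y _ => fdf y).
  apply: continuous_subspaceT => y.
  by apply: differentiable_continuous; apply/derivable1_diffP; case: (fdf y).
rewrite in_itv/= subr0 => /andP[c0 cx] fE.
by rewrite -subr_ge0 fE mulr_ge0 ?df0 ?ltW.
Qed.

Lemma expR_ge_quad x : 0 <= x -> 1 + x + x ^+ 2 / 2 <= expR x.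
Proof.
move=> x0.
pose f (y : R) := expR y - 1 - y - y ^+ 2 / 2.
have := @ge0_is_derive_ge0 f (fun y => expR y - 1 - y) x.
rewrite /f expR0 => H; suff : 1 - 1 - 0 - 0 ^+ 2 / 2 <= f x by rewrite /f; lra.
apply: H => // y.
- by apply: is_derive_eq; rewrite /GRing.scale/=; field.
- by move=> _; have := expR_ge1Dx y; lra.
Qed.

Lemma expR_le_quad_ge0 x : 0 <= x -> expR x <= 1 + x + x ^+ 2 / 2 * expR x.
Proof.
move=> x0.
pose f (y : R) := 1 + y + y ^+ 2 / 2 * expR y - expR y.
have := @ge0_is_derive_ge0 f (fun y => 1 + (y - 1) * expR y + y ^+ 2 / 2 * expR y) x.
rewrite /f expR0 => H; suff : 1 + 0 + 0 ^+ 2 / 2 * 1 - 1 <= f x by rewrite /f; lra.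
apply: H => // y.
- by apply: is_derive_eq; rewrite /GRing.scale/=; field.
- move=> y0; have := expR_ge1Dx (- y); have := expRxMexpNx_1 y.
  have := expR_gt0 y; have := expR_gt0 (- y); move: (expR y) (expR (- y)) => a b.
  by move=> *; nra.
Qed.

Lemma expR_le_quad z : expR z <= 1 + z + z ^+ 2 / 2 * expR `|z|.
Proof.
have [z0|z0] := leP 0 z; first by rewrite ger0_norm//; exact: expR_le_quad_ge0.
have y0 : 0 <= - z by lra.
have := expR_ge_quad y0; have := expRxMexpNx_1 z; have := expR_gt0 z.
move: (expR z) (expR (- z)) => a b a0 ab bz.
have : a <= 1 + z + z ^+ 2 / 2.
  have h : 0 <= 1 + z + z ^+ 2 / 2 by nra.
  have : a * (1 - z + z ^+ 2 / 2) <= 1 by rewrite -[leRHS]ab ler_pM2l//; move: bz; nra.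
  (* The product equals [1 + z^4 / 4]. *)
  move=> h2; have h3 : 1 <= (1 + z + z ^+ 2 / 2) * (1 - z + z ^+ 2 / 2) by nra.
  rewrite -(@ler_pM2r _ (1 - z + z ^+ 2 / 2)); last by nra.
  exact: le_trans h2 h3.
move=> /le_trans; apply; rewrite lerD2l ler_peMr//; first by nra.
by rewrite -expR0 ler_expR.
Qed.

(** Companion of [expR_le_quad]. Integrated against a law of mean 0 and variance 1, both leave
    [mgf2] as the only error term, so one window controls the cumulant from both sides. *)
Lemma expR_ge_quad_abs z : 1 + z + z ^+ 2 / 2 * (2 - expR `|z|) <= expR z.
Proof.
have [z0|z0] := leP 0 z.
  rewrite ger0_norm//.
  have := expR_ge_quad z0; have : 1 <= expR z by rewrite -expR0 ler_expR.
  by have := expR_gt0 z; nra.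
rewrite ltr0_norm//.
have y0 : 0 <= - z by lra.
have := expR_le_quad_ge0 y0; have := expR_ge_quad y0; have := expRxMexpNx_1 z.
have := expR_gt0 z; move: (expR z) (expR (- z)) => a b a0 ab bz1 bz2.
have h1 : 1 + z + z ^+ 2 / 2 * (2 - b) <= 1 + z + z ^+ 2 / 2 * (1 + z).
  by rewrite lerD2l ler_wpM2l//; nra.
apply: le_trans h1 _.
have h2 : 1 - z ^+ 2 / 2 <= a * (1 - z).
  have : a * b <= a * (1 - z + z ^+ 2 / 2 * b) by rewrite ler_pM2l//; move: bz2; nra.
  have -> : a * (1 - z + z ^+ 2 / 2 * b) = a * (1 - z) + z ^+ 2 / 2 * (a * b) by ring.
  by rewrite ab; lra.
(* After multiplication the left side is [(1 - z^2)(1 + z^2 / 2) = 1 - z^2 / 2 - z^4 / 2]. *)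
rewrite -(@ler_pM2r _ (1 - z)); last by lra.
apply: le_trans h2; nra.
Qed.

(** Chord of the convex function [expR] between 0 and [e1 * x]. It makes smallness in [e] explicit
    and replaces a dominated convergence argument in [mgf2_near1]. *)
Lemma expR_interp (e e1 x : R) : 0 <= e <= e1 -> 0 < e1 ->
  expR (e * x) <= 1 + e / e1 * (expR (e1 * x) - 1).
Proof.
move=> /andP[e0 ee1] e10.
have t1 : 0 <= e / e1 <= 1 by rewrite divr_ge0 ?(ltW e10)//= ler_pdivrMr// mul1r.
have := @convex_expR R (Itv01 (andP t1).1 (andP t1).2) (e1 * x) 0.
rewrite !convRE /= /unstable.onem expR0 mulr0 addr0 mulr1.
have -> : e / e1 * (e1 * x) = e * x by field; rewrite gt_eqF.
by lra.
Qed.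

Lemma sqr_le_expR (c x : R) : 0 < c -> x ^+ 2 <= 2 / c ^+ 2 * expR (c * `|x|).
Proof.
move=> c0; have cx : 0 <= c * `|x| by rewrite mulr_ge0// ltW.
rewrite mulrAC ler_pdivlMr ?exprn_gt0// mulrC -ler_pdivrMl//.
have := expR_ge_quad cx; rewrite exprMn real_normK ?num_real// => h.
rewrite mulrC; lra.
Qed.

Lemma expR_norm_le (x : R) : expR `|x| <= expR x + expR (- x).
Proof.
have [x0|x0] := leP 0 x; first by rewrite ger0_norm// lerDl expR_ge0.
by rewrite ltr0_norm// lerDr expR_ge0.
Qed.

End exponential_inequalities.

(** * Second-order expansion of a moment generating function *)

Section moment_generating_function.
Context (R : realType) (P : probability R R).
Implicit Types a h e u x : R.

Definition mgf (u : R) : R := \int[P]_x expR (u * x).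

Definition mgf1 (a : R) : R := \int[P]_x (x * expR (a * x)).

(** A bound for the second derivative of [mgf] on the interval of radius [e]; all Taylor remainders
    below are multiples of it. *)
Definition mgf2 (e : R) : R := \int[P]_x (x ^+ 2 * expR (e * `|x|)).

Lemma Rintegral_cst_prob (c : R) : \int[P]_x (fun=> c) x = c.
Proof.
rewrite Rintegral_cst//; transitivity (c * 1); last by rewrite mulr1.
congr (_ * _); exact: (congr1 fine (probability_setT P)).
Qed.

Let int_ (f : R -> R) := P.-integrable [set: R] (EFin \o f).

Lemma integrableZl_real (k : R) (f : R -> R) : int_ f -> int_ (fun x => k * f x).
Proof. by move=> fi; have := integrableZl measurableT k fi; apply. Qed.

Lemma le_integrable_real (f g : R -> R) : measurable_fun [set: R] f ->
  (forall x, `|f x| <= g x) -> int_ g -> int_ f.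
Proof.
move=> mf fg ig; apply: (le_integrable measurableT _ _ ig).
  exact/measurable_EFinP.
by move=> x _ /=; rewrite lee_fin (le_trans (fg x))// ler_norm.
Qed.

Lemma measurable_expRM (u : R) : measurable_fun [set: R] (fun x : R => expR (u * x)).
Proof. by apply: measurableT_comp => //; exact: measurable_funM. Qed.

Lemma measurable_expRMnorm (u : R) : measurable_fun [set: R] (fun x : R => expR (u * `|x|)).
Proof.
by apply: measurableT_comp => //; apply: measurable_funM.
Qed.

Variable r : R.
Hypothesis r_gt0 : 0 < r.
Hypothesis int_expR : forall u, `|u| <= r -> int_ (fun x => expR (u * x)).

Let r2r : r / 2 <= r. Proof. by have := r_gt0; lra. Qed.

Lemma integrable_expRnorm e : 0 <= e <= r -> int_ (fun x => expR (e * `|x|)).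
Proof.
move=> /andP[e0 er]; have er' : `|e| <= r by rewrite ger0_norm.
have er2 : `|- e| <= r by rewrite normrN.
apply: (@le_integrable_real _ (fun x => expR (e * x) + expR (- e * x))).
- exact: measurable_expRMnorm.
- move=> x; rewrite ger0_norm ?expR_ge0//.
  by have := expR_norm_le (e * x); rewrite normrM (ger0_norm e0) mulNr.
- by apply: (integrableD measurableT (int_expR er') (int_expR er2)).
Qed.

(** Half of the radius [r] absorbs the factor [x ^+ 2] through [sqr_le_expR], which is why [e] stops
    at [r / 2]. *)
Lemma integrable_sqr_expRnorm e : 0 <= e <= r / 2 ->
  int_ (fun x => x ^+ 2 * expR (e * `|x|)).
Proof.
move=> /andP[e0 er].
have rr : 0 <= r <= r by rewrite (ltW r_gt0) lexx.
apply: (@le_integrable_real _ (fun x => 2 / (r / 2) ^+ 2 * expR (r * `|x|))).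
- by apply: measurable_funM; [exact: measurable_funX|exact: measurable_expRMnorm].
- move=> x; rewrite ger0_norm; last by rewrite mulr_ge0 ?expR_ge0// sqr_ge0.
  have r20 : 0 < r / 2 by rewrite divr_gt0.
  have -> : r * `|x| = r / 2 * `|x| + r / 2 * `|x| by field.
  rewrite expRD mulrA ler_pM ?sqr_ge0 ?expR_ge0//; first exact: sqr_le_expR.
  by rewrite ler_expR ler_wpM2r.
- exact: (integrableZl_real _ (integrable_expRnorm rr)).
Qed.

Lemma integrable_M_expR a : `|a| <= r / 2 -> int_ (fun x => x * expR (a * x)).
Proof.
move=> ar.
have a1 : 0 <= `|a| <= r by rewrite normr_ge0 (le_trans ar).
have a2 : 0 <= `|a| <= r / 2 by rewrite normr_ge0.
apply: (@le_integrable_real _ (fun x => expR (`|a| * `|x|) + x ^+ 2 * expR (`|a| * `|x|))).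
- by apply: measurable_funM => //; exact: measurable_expRM.
- move=> x; rewrite normrM (ger0_norm (expR_ge0 _)).
  rewrite -[X in _ <= X + _]mul1r -mulrDl ler_pM ?expR_ge0//.
  + by rewrite -[x ^+ 2](real_normK (num_real x)); have := normr_ge0 x; nra.
  + by rewrite ler_expR -normrM ler_norm.
- exact: (integrableD measurableT (integrable_expRnorm a1) (integrable_sqr_expRnorm a2)).
Qed.

(** Tangent line of a convex function. Together with [mgf_le] it identifies [mgf1 a] as the
    derivative up to [O(h^2)], without differentiating under the integral. *)
Lemma mgf_ge a h : `|a| <= r / 2 -> `|a + h| <= r -> mgf a + h * mgf1 a <= mgf (a + h).
Proof.
move=> ar ahr.
have ar' : `|a| <= r by rewrite (le_trans ar).
have i1 := integrable_M_expR ar.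
rewrite /mgf /mgf1 -RintegralZl// -RintegralD//; first last.
- exact: (integrableZl_real _ i1).
- exact: int_expR.
apply: le_Rintegral => //.
- by apply: (integrableD measurableT (int_expR ar') (integrableZl_real h i1)).
- exact: int_expR.
move=> x _; have := expR_ge1Dx (h * x); rewrite mulrDl expRD.
by have := expR_gt0 (a * x); nra.
Qed.

Lemma mgf_le a h e : `|a| + `|h| <= e -> e <= r / 2 ->
  mgf (a + h) <= mgf a + h * mgf1 a + h ^+ 2 / 2 * mgf2 e.
Proof.
move=> ahe er.
have rr := r2r.
have a0 := normr_ge0 a; have h0 := normr_ge0 h.
have e0 : 0 <= e <= r / 2 by lra.
have ar2 : `|a| <= r / 2 by lra.
have ar' : `|a| <= r by lra.
have ahr : `|a + h| <= r by have := ler_normD a h; lra.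
have i1 := integrable_M_expR ar2.
have i2 := integrable_sqr_expRnorm e0.
have i0 := int_expR ar'.
have i3 : int_ (fun x => h * (x * expR (a * x))) by exact: (integrableZl_real _ i1).
have i4 : int_ (fun x => h ^+ 2 / 2 * (x ^+ 2 * expR (e * `|x|))).
  exact: (integrableZl_real _ i2).
have i5 : int_ (fun x => expR (a * x) + h * (x * expR (a * x))).
  exact: (integrableD measurableT i0 i3).
rewrite /mgf /mgf1 /mgf2 -RintegralZl// -RintegralZl// -RintegralD// -RintegralD//.
apply: le_Rintegral => //.
- exact: int_expR.
- exact: (integrableD measurableT i5 i4).
move=> x _; have := expR_le_quad (h * x); rewrite mulrDl expRD.
have e1 : expR (a * x) * expR `|h * x| <= expR (e * `|x|).
  rewrite -expRD ler_expR normrM; have := ler_norm (a * x); rewrite normrM.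
  by have := normr_ge0 x; nra.
have := expR_gt0 (a * x); move=> A0 B.
apply: (@le_trans _ _ (expR (a * x) * (1 + h * x + (h * x) ^+ 2 / 2 * expR `|h * x|))).
  by rewrite ler_pM2l.
have -> : expR (a * x) * (1 + h * x + (h * x) ^+ 2 / 2 * expR `|h * x|) =
  expR (a * x) + h * (x * expR (a * x)) +
  h ^+ 2 / 2 * (x ^+ 2 * (expR (a * x) * expR `|h * x|)) by field.
by rewrite lerD2l ler_wpM2l ?divr_ge0 ?sqr_ge0// ler_wpM2l ?sqr_ge0.
Qed.

Lemma mgf0 : mgf 0 = 1.
Proof.
rewrite /mgf (_ : (fun x => _) = cst 1); last first.
  by apply/funext => x /=; rewrite mul0r expR0.
exact: Rintegral_cst_prob.
Qed.

Hypothesis mean0 : \int[P]_x x = 0.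
Hypothesis var1 : \int[P]_x x ^+ 2 = 1.

Lemma mgf10 : mgf1 0 = 0.
Proof.
by rewrite /mgf1 -[RHS]mean0; apply: eq_Rintegral => x _; rewrite mul0r expR0 mulr1.
Qed.

Let r20 : (0 : R) <= 0 <= r / 2. Proof. by rewrite lexx divr_ge0// ltW. Qed.

Let int_x : int_ (fun x => x).
Proof.
rewrite (_ : (fun x => x) = (fun x : R => x * expR (0 * x))).
  by apply: integrable_M_expR; rewrite normr0; case/andP: r20.
by apply/funext => x; rewrite mul0r expR0 mulr1.
Qed.

Let int_x2 : int_ (fun x => x ^+ 2).
Proof.
rewrite (_ : (fun x => x ^+ 2) = (fun x : R => x ^+ 2 * expR (0 * `|x|))).
  exact: integrable_sqr_expRnorm.
by apply/funext => x; rewrite mul0r expR0 mulr1.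
Qed.

Let int_1 : int_ (fun=> 1).
Proof. exact: finite_measure_integrable_cst. Qed.

Lemma mgf_ge1 u : `|u| <= r -> 1 <= mgf u.
Proof.
by move=> ur; have := @mgf_ge 0 u; rewrite mgf0 mgf10 mulr0 addr0 add0r normr0; apply => //;
  case/andP: r20.
Qed.

Lemma mgf_ge_quad u e : `|u| <= e -> e <= r / 2 ->
  1 + u ^+ 2 / 2 * (2 - mgf2 e) <= mgf u.
Proof.
move=> ue er.
have u0 := normr_ge0 u; have rr := r2r.
have e0 : 0 <= e <= r / 2 by lra.
have i2 := integrable_sqr_expRnorm e0.
have i3 : int_ (fun x => u * x) by exact: (integrableZl_real _ int_x).
have i4 : int_ (fun x => u ^+ 2 * x ^+ 2) by exact: (integrableZl_real _ int_x2).
have i5 : int_ (fun x => u ^+ 2 / 2 * (x ^+ 2 * expR (e * `|x|))).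
  exact: (integrableZl_real _ i2).
have i6 : int_ (fun x => 1 + u * x) by exact: (integrableD measurableT int_1 i3).
have i7 : int_ (fun x => 1 + u * x + u ^+ 2 * x ^+ 2) by exact: (integrableD measurableT i6 i4).
have -> : 1 + u ^+ 2 / 2 * (2 - mgf2 e) =
  \int[P]_x ((1 + u * x + u ^+ 2 * x ^+ 2) - u ^+ 2 / 2 * (x ^+ 2 * expR (e * `|x|))).
  rewrite RintegralB// RintegralD// RintegralD// !RintegralZl//.
  by rewrite (Rintegral_cst_prob 1) mean0 var1 /mgf2/=; field.
apply: le_Rintegral => //.
- exact: (integrableB measurableT i7 i5).
- by apply: int_expR; lra.
move=> x _; have := expR_ge_quad_abs (u * x); apply: le_trans.
have : expR `|u * x| <= expR (e * `|x|) by rewrite ler_expR normrM ler_wpM2r.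
by rewrite exprMn; have := mulr_ge0 (sqr_ge0 u) (sqr_ge0 x); nra.
Qed.

Lemma mgf2_near1 (eta : R) : 0 < eta -> exists2 e, 0 < e <= r / 2 & mgf2 e <= 1 + eta.
Proof.
move=> eta0; have r2 : 0 < r / 2 by rewrite divr_gt0.
have e10 : 0 <= r / 2 <= r / 2 by rewrite (ltW r2)/=.
have i1 := integrable_sqr_expRnorm e10.
set K := mgf2 (r / 2).
have K0 : 0 <= K.
  by apply: Rintegral_ge0 => x _; rewrite mulr_ge0 ?sqr_ge0 ?expR_ge0.
(* The chord bound gives [mgf2 (t * r / 2) <= (1 - t) + t * K]; this [t] is at most 1 and makes
   [t * (K - 1) <= eta]. *)
pose t := eta / (eta + K).
have t0 : 0 < t by rewrite divr_gt0//; lra.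
have t1 : t <= 1 by rewrite ler_pdivrMr ?mul1r; lra.
exists (t * (r / 2)); first by nra.
have tr : 0 <= t * (r / 2) <= r / 2 by nra.
have i3 : int_ (fun x => t * (x ^+ 2 * expR (r / 2 * `|x|))).
  exact: (integrableZl_real _ i1).
have i4 : int_ (fun x => (1 - t) * x ^+ 2) by exact: (integrableZl_real _ int_x2).
apply: (@le_trans _ _ (\int[P]_x ((1 - t) * x ^+ 2 + t * (x ^+ 2 * expR (r / 2 * `|x|))))).
  apply: le_Rintegral => //.
  - exact: integrable_sqr_expRnorm.
  - exact: (integrableD measurableT i4 i3).
  move=> x _; have := expR_interp `|x| tr r2.
  rewrite mulfK ?gt_eqF// => h.
  apply: le_trans (ler_wpM2l (sqr_ge0 x) h) _.
  by rewrite le_eqVlt; apply/orP; left; apply/eqP; ring.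
rewrite RintegralD// !RintegralZl// var1 -/(mgf2 (r / 2)) -/K mulr1.
suff : t * (K - 1) <= eta by rewrite mulrBr mulr1 => h; lra.
have p0 : 0 < eta + K by rewrite (lt_le_trans eta0)// lerDl.
rewrite /t mulrAC ler_pdivrMr//.
by nra.
Qed.

End moment_generating_function.

(** * The cumulant function of the standardized family *)

Section one_dimensional.
Context d (X : measurableType d) (R : realType) (E : expFamily X R) (t0 : R)
  (B : R -> R).
Hypothesis Theta_t0 : interior (ef_Theta E) t0.
Hypothesis sigma_gt0 : 0 < sigma0 E t0.
Hypothesis BC : forall t, ef_Theta E t -> B (ef_eta E t) = ef_C E t.

Local Notation s0 := (s0 E t0).
Local Notation sset := (sset E t0).
Local Notation A := (Afun E t0 B).
Local Notation P := (ylaw E t0 s0).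
Local Notation Y := (Ystd E t0).

Definition cumulant (u : R) : R := A (s0 + u) - A s0.

Let Theta0 : ef_Theta E t0. Proof. exact: interior_subset. Qed.

Lemma measurable_expdensity t :
  measurable_fun [set: X] (expdensity (ef_eta E) (ef_C E) (ef_T E) (ef_h E) t).
Proof.
apply: measurable_funM; last exact: ef_h_measurable.
by apply: measurableT_comp => //; apply: measurable_funB => //; exact: measurable_funM.
Qed.

Lemma expdensity_ge0 t x : 0 <= expdensity (ef_eta E) (ef_C E) (ef_T E) (ef_h E) t x.
Proof. by rewrite mulr_ge0 ?expR_ge0 ?ef_h_ge0. Qed.

Lemma ef_law_density t : ef_Theta E t ->
  has_density (ef_law E t) (ef_mu E) (expdensity (ef_eta E) (ef_C E) (ef_T E) (ef_h E) t).
Proof.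
move=> Tt; apply: has_densityP.
- exact: measurable_expdensity.
- exact: expdensity_ge0.
- by move=> D mD; exact: ef_lawE.
Qed.

Lemma ge0_integral_ylaw t (f : R -> \bar R) : ef_Theta E t ->
  measurable_fun [set: R] f -> (forall y, (0 <= f y)%E) ->
  (\int[ylaw E t0 (ef_eta E t * sigma0 E t0)]_y f y = \int[ef_law E t]_x f (Y x))%E.
Proof.
move=> Tt mf f0; rewrite -[RHS](@ge0_integral_distribution _ _ _ _ _ (ef_law E t) Y)//.
by apply: eq_measure_integral => D mD _; exact: ylawE.
Qed.

(** Both laws are pulled back to [X], where they have explicit densities with respect to [ef_mu]; in
    their quotient the factor [ef_h] cancels. *)
Lemma ylaw_density s : sset s ->
  has_density (ylaw E t0 s) P (fun y => expR ((s - s0) * y - (A s - A s0))).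
Proof.
move=> [t Tt <-] f mf f0.
set s1 := _ * _; pose w y := expR ((s1 - s0) * y - (A s1 - A s0)).
have mw : measurable_fun [set: R] w.
  by apply: measurableT_comp => //; apply: measurable_funB => //; exact: measurable_funM.
rewrite ge0_integral_ylaw//.
rewrite [RHS](ge0_integral_ylaw (f := fun y => (f y * (w y)%:E)%E) Theta0); last 2 first.
- by apply: emeasurable_funM => //; exact/measurable_EFinP.
- by move=> y; rewrite mule_ge0// lee_fin expR_ge0.
have mY := measurable_Ystd E t0.
rewrite (ef_law_density Tt)//; last exact: measurableT_comp.
rewrite (ef_law_density Theta0); last 2 first.
- by apply: emeasurable_funM; [exact: measurableT_comp|exact/measurable_EFinP/measurableT_comp].
- by move=> x; rewrite mule_ge0// lee_fin expR_ge0.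
apply: eq_integral => x _; rewrite -muleA -EFinM; congr (_ * _%:E)%E.
rewrite (expdensity_Ystd x sigma_gt0 Tt (BC Tt)) (expdensity_Ystd x sigma_gt0 Theta0 (BC Theta0)).
rewrite [RHS]mulrA /w -expRD; congr (expR _ * _).
by rewrite -/s1 -/(Defs.s0 E t0); ring.
Qed.

Lemma s0_sset : sset s0. Proof. by exists t0. Qed.

(** The law at [s0 + u] has total mass 1; this is why the tilt is restricted to parameters of the
    family. *)
Lemma integral_expR_cumulant u : sset (s0 + u) ->
  (\int[P]_y (expR (u * y))%:E = (expR (cumulant u))%:E)%E.
Proof.
move=> su; have mu_ := measurable_expRM u.
have := @ylaw_density _ su (cst 1%E) (@measurable_cst _ _ _ _ _ _) (fun=> lee01).
have -> : (\int[ylaw E t0 (s0 + u)]_x cst 1 x = 1)%E.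
  by rewrite integral_cst// mul1e; exact: probability_setT.
move=> h.
transitivity (\int[P]_y ((expR (cumulant u))%:E *
  (1 * (expR ((s0 + u - s0) * y - (A (s0 + u) - A s0)))%:E)))%E.
  apply: eq_integral => y _; rewrite mul1e -EFinM -expRD; congr (expR _)%:E.
  by rewrite /cumulant; ring.
rewrite ge0_integralZl//; first by rewrite -h mule1.
under eq_fun do rewrite mul1e.
by apply/measurable_EFinP/measurableT_comp => //; apply: measurable_funB.
Qed.

(** [ef_eta] is continuous and strictly increasing on an interval around the interior point [t0], so
    the intermediate value theorem reaches every nearby value. *)
Lemma sset_nbhs : exists2 r, 0 < r & forall u, `|u| <= r -> sset (s0 + u).
Proof.
have /nbhs_ballP[e /= e0 eT] := Theta_t0.
pose f := ef_eta E; pose h := e / 2.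
have h0 : 0 < h by rewrite divr_gt0.
have inT t : t \in `[t0 - h, t0 + h] -> ef_Theta E t.
  rewrite in_itv/= => /andP[t1 t2]; apply: eT; rewrite /ball/= ltr_norml.
  by move: h0; rewrite /h => h0; apply/andP; split; move: t1 t2; rewrite /h; lra.
have df t : t \in `[t0 - h, t0 + h] -> derivable f t 1.
  by move=> /inT Tt; have [+ _] := ef_eta_C2 Tt; move=> /nbhs_singleton h1; case: h1.
have cf : {within `[t0 - h, t0 + h], continuous f}.
  apply: continuous_in_subspaceT => t /set_mem/= /df.
  by move=> /derivable1_diffP/differentiable_continuous.
have incr : forall x y, t0 - h <= x -> x < y -> y <= t0 + h -> f x < f y.
  apply: gtr0_derive1_incr => // t; rewrite in_itv/= => /andP[t1 t2].
    by apply: df; rewrite in_itv/= !ltW.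
  by apply: ef_eta_gt0; apply: inT; rewrite in_itv/= !ltW.
have lo : f (t0 - h) < f t0 by apply: incr; lra.
have hi : f t0 < f (t0 + h) by apply: incr; lra.
pose sg := sigma0 E t0; have sg0 : 0 < sg := sigma_gt0.
exists (sg * Num.min (f t0 - f (t0 - h)) (f (t0 + h) - f t0)).
  by rewrite mulr_gt0// lt_min !subr_gt0 lo hi.
move=> u; rewrite -ler_pdivrMl// => ur.
have [t tI ft] : exists2 c, c \in `[t0 - h, t0 + h] & f c = f t0 + u / sg.
  apply: IVT => //; first lra.
  rewrite (min_idPl _) ?(max_idPr _); try by rewrite ltW// (lt_trans lo hi).
  have : `|u / sg| <= Num.min (f t0 - f (t0 - h)) (f (t0 + h) - f t0).
    by rewrite normrM normfV (gtr0_norm sg0) mulrC.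
  by rewrite le_min !ler_norml => /andP[/andP[? ?] /andP[? ?]]; apply/andP; split; lra.
exists t; first exact: inT.
by rewrite -/f -/sg ft mulrDl divfK ?gt_eqF.
Qed.

Section moments.
Variable r : R.
Hypothesis r_gt0 : 0 < r.
Hypothesis r_sset : forall u, `|u| <= r -> sset (s0 + u).

Lemma integrable_expR_ylaw u : `|u| <= r ->
  P.-integrable [set: R] (EFin \o (fun y : R => expR (u * y))).
Proof.
move=> /r_sset su; apply/integrableP; split.
  by apply/measurable_EFinP; exact: measurable_expRM.
under eq_integral do rewrite /= ger0_norm ?expR_ge0//.
by rewrite integral_expR_cumulant// ltry.
Qed.

Lemma mgf_cumulant u : `|u| <= r -> mgf P u = expR (cumulant u).
Proof. by move=> /r_sset su; rewrite /mgf /Rintegral integral_expR_cumulant. Qed.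

Let int_norm : P.-integrable [set: R] (EFin \o (fun y : R => y)).
Proof.
rewrite (_ : (fun x => x) = (fun x : R => x * expR (0 * x))).
  apply: (integrable_M_expR r_gt0 integrable_expR_ylaw).
  by rewrite normr0 divr_ge0// ltW.
by apply/funext => x; rewrite mul0r expR0 mulr1.
Qed.

Lemma integrable_Ystd : (ef_law E t0).-integrable [set: X] (EFin \o Y).
Proof.
have /integrableP[_] := int_norm.
have mY : measurable_fun [set: X] (EFin \o Y).
  by apply/measurable_EFinP; exact: measurable_Ystd.
rewrite (ge0_integral_ylaw Theta0)//; last by do 2 apply: measurableT_comp => //.
by move=> h; apply/integrableP.
Qed.

Lemma ylaw_mean0 : \int[P]_y y = 0.
Proof.
have iY := integrable_Ystd.
have -> : (\int[P]_y y = \int[ef_law E t0]_x Y x)%R.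
  rewrite /Rintegral; congr fine.
  rewrite -(@integral_distribution _ _ _ _ _ (ef_law E t0) Y EFin)//.
  by apply: eq_measure_integral => D mD _; exact: ylawE.
have iT : (ef_law E t0).-integrable [set: X] (EFin \o ef_T E).
  rewrite (_ : _ \o _ = (fun x => (sigma0 E t0)%:E * (EFin \o Y) x + (m0 E t0)%:E)%E).
    apply: integrableD => //; first exact: integrableZl.
    exact: finite_measure_integrable_cst.
  by apply/funext => x /=; rewrite -EFinM -EFinD /Ystd; congr EFin; field; rewrite gt_eqF.
have ic : (ef_law E t0).-integrable [set: X] (EFin \o (fun=> m0 E t0)).
  exact: finite_measure_integrable_cst.
rewrite /Ystd RintegralZr//; last by have := integrableB measurableT iT ic; apply.
rewrite RintegralB//.
rewrite Rintegral_cst//.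
have -> : fine (ef_law E t0 [set: X]) = 1 by rewrite probability_setT.
by rewrite mulr1 /m0 unlock subrr mul0r.
Qed.

Lemma ylaw_var1 : \int[P]_y y ^+ 2 = 1.
Proof.
have m2 : measurable_fun [set: R] (fun y : R => (y ^+ 2)%:E).
  exact/measurable_EFinP/measurable_funX.
rewrite /Rintegral (ge0_integral_ylaw Theta0 m2); last by move=> y; rewrite lee_fin sqr_ge0.
have s20 : sigma0 E t0 ^+ 2 = fine ('V_(ef_law E t0)[ef_T E])%E.
  by rewrite /sigma0 sqr_sqrtr// fine_ge0// variance_ge0.
have s2 : sigma0 E t0 ^+ 2 != 0 by rewrite expf_neq0// gt_eqF.
apply: (mulfI s2); rewrite mulr1 [RHS]s20 /variance unlock unlock.
transitivity (fine ((sigma0 E t0 ^+ 2)%:E * \int[ef_law E t0]_x (Y x ^+ 2)%:E)%E).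
  (* [fine] commutes with the product only for a finite integral; finiteness comes from the
     exponential moments. *)
  have : (\int[ef_law E t0]_x (Y x ^+ 2)%:E)%E \is a fin_num.
    have := integrable_sqr_expRnorm r_gt0 integrable_expR_ylaw (e := 0).
    rewrite lexx divr_ge0 ?(ltW r_gt0)// => /(_ isT)/integrableP[_].
    under eq_integral do rewrite /= mul0r expR0 mulr1 ger0_norm ?sqr_ge0//.
    rewrite (ge0_integral_ylaw Theta0 m2); last by move=> y; rewrite lee_fin sqr_ge0.
    by rewrite -ge0_fin_numE// integral_ge0// => x _; rewrite lee_fin sqr_ge0.
  by case: (\int[_]_x _)%E.
congr fine; rewrite -ge0_integralZl//; last 3 first.
- exact: (measurableT_comp m2 (measurable_Ystd E t0)).
- by move=> x _; rewrite lee_fin sqr_ge0.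
- by rewrite lee_fin sqr_ge0.
apply: eq_integral => x _; rewrite -EFinM -exprMn; congr EFin.
rewrite expr2 /= /Ystd /m0; rewrite [sigma0 _ _ * _]mulrC divfK ?gt_eqF//.
by rewrite unlock.
Qed.

End moments.

End one_dimensional.

Section cumulant_estimates.
Context d (X : measurableType d) (R : realType) (E : expFamily X R) (t0 : R)
  (B : R -> R).
Hypothesis Theta_t0 : interior (ef_Theta E) t0.
Hypothesis sigma_gt0 : 0 < sigma0 E t0.
Hypothesis BC : forall t, ef_Theta E t -> B (ef_eta E t) = ef_C E t.

Local Notation s0 := (s0 E t0).
Local Notation sset := (sset E t0).
Local Notation A := (Afun E t0 B).
Local Notation P := (ylaw E t0 s0).
Local Notation phi := (cumulant E t0 B).

Lemma cumulant0 : phi 0 = 0.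
Proof. by rewrite /cumulant addr0 subrr. Qed.

Lemma cumulant_quad eta : 0 < eta -> exists2 eps, 0 < eps &
  forall u, `|u| <= eps -> sset (s0 + u) /\
    (1 - eta) * (u ^+ 2 / 2) <= phi u <= (1 + eta) * (u ^+ 2 / 2).
Proof.
wlog eta1 : eta / eta <= 1 => [wl eta0|eta0].
  have m1 : Num.min eta 1 <= 1 by rewrite ge_min lexx orbT.
  have m0 : 0 < Num.min eta 1 by rewrite lt_min eta0 ltr01.
  have [eps eps0 h] := wl _ m1 m0.
  exists eps => // u /h[su /andP[h1 h2]]; split => //.
  have u2 : 0 <= u ^+ 2 / 2 by rewrite divr_ge0 ?sqr_ge0.
  rewrite (le_trans _ h1) ?(le_trans h2)//= ler_wpM2r// ?lerD2l ?lerN2 ge_min lexx//.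
have [r r0 rs] := sset_nbhs Theta_t0 sigma_gt0.
have iexp := integrable_expR_ylaw Theta_t0 sigma_gt0 BC rs.
have mean0 := ylaw_mean0 Theta_t0 sigma_gt0 BC r0 rs.
have var1 := ylaw_var1 Theta_t0 sigma_gt0 BC r0 rs.
have e20 : 0 < eta / 2 by rewrite divr_gt0.
have [e /andP[e0 er] eK] := mgf2_near1 r0 iexp var1 e20.
(* One half of [eta] is spent on [mgf2], the other pays for taking logarithms: [|u| <= eta / 2] and
   [eta <= 1] give [u^2 / 2 <= eta / 8]. *)
exists (Num.min e (eta / 2)); first by rewrite lt_min e0.
move=> u; rewrite le_min => /andP[ue ueta].
have ur : `|u| <= r by lra.
split; first exact: rs.
have mgfE := mgf_cumulant Theta_t0 sigma_gt0 BC rs ur.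
have lo := mgf_ge_quad r0 iexp mean0 var1 ue er.
have hi : mgf P u <= 1 + u ^+ 2 / 2 * mgf2 P e.
  have := @mgf_le _ P _ r0 iexp 0 u e; rewrite normr0 !add0r.
  by move=> /(_ ue er); rewrite (mgf0 P) (mgf10 mean0) mulr0 addr0.
move: lo hi; rewrite mgfE.
set k := mgf2 _ _ in eK *; set x := u ^+ 2 / 2.
have x0 : 0 <= x by rewrite divr_ge0 ?sqr_ge0.
have xe : x <= eta / 8.
  by rewrite /x -[u ^+ 2](real_normK (num_real u)); have := normr_ge0 u; nra.
move=> lo hi; apply/andP; split; last first.
  have := expR_ge1Dx (phi u); nra.
rewrite -ler_expR; apply: le_trans lo.
have z0 : 0 <= (1 - eta) * x by rewrite mulr_ge0// subr_ge0.
have ex0 : 0 <= eta * x by rewrite mulr_ge0// ltW.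
have zx : (1 - eta) * x <= x by lra.
have := expR_le_quad_ge0 z0.
have zE : (1 - eta) * x = x - eta * x by ring.
set z := (1 - eta) * x in z0 zx zE *; set ez := expR z => ezq.
have ez0 : 0 < ez by exact: expR_gt0.
have zz : z ^+ 2 <= x * (eta / 8).
  by apply: (@le_trans _ _ (x * x)); [rewrite expr2 ler_pM|rewrite ler_wpM2l].
have z21 : z ^+ 2 / 2 <= 1 / 2 by nra.
have ez2 : ez <= 2 + 2 * x.
  have : z ^+ 2 / 2 * ez <= 1 / 2 * ez by rewrite ler_pM2r.
  by lra.
have x1 : 2 + 2 * x <= 4 by lra.
have ez3 : z ^+ 2 / 2 * ez <= z ^+ 2 / 2 * 4.
  by rewrite ler_wpM2l ?divr_ge0 ?sqr_ge0// (le_trans ez2).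
have kx : x * (1 - eta / 2) <= x * (2 - k) by rewrite ler_wpM2l//; lra.
have : x * (eta / 8) = x * eta / 8 by ring.
have : x * (1 - eta / 2) = x - x * eta / 2 by field.
by rewrite (mulrC eta) in ex0 zE; lra.
Qed.

(** Uniqueness of the first-order coefficient: [A] is known only through [phi], so its derivative is
    read off from an expansion of [expR phi] with quadratic remainder. *)
Lemma derive1_cumulant a D e : derivable A (s0 + a) 1 -> 0 < e ->
  (forall h, `|h| <= e -> `|expR (phi (a + h)) - expR (phi a) - h * D| <= h ^+ 2) ->
  D = expR (phi a) * derive1 A (s0 + a).
Proof.
move=> dA e1 hD; pose f v := expR (A v - A s0).
have <- : derive1 f (s0 + a) = expR (phi a) * derive1 A (s0 + a).
  have dA' : is_derive (s0 + a) 1 A (derive1 A (s0 + a)).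
    by apply: DeriveDef => //; rewrite derive1E.
  have dg : is_derive (s0 + a) 1 (fun v => A v - A s0) (derive1 A (s0 + a)).
    by rewrite -[derive1 _ _]subr0; exact: is_deriveB.
  have df : is_derive (s0 + a) 1 f (expR (phi a) * derive1 A (s0 + a)).
    exact: (is_derive1_comp (is_derive_expR _) dg).
  by rewrite derive1E derive_val.
apply/esym/cvg_lim => //; apply/cvgrPdist_le => eps eps0.
near=> h.
have h0 : h != 0 by near: h; exact: nbhs_dnbhs_neq.
have : `|expR (phi (a + h)) - expR (phi a) - h * D| <= h ^+ 2.
  by apply: hD; near: h; exact: dnbhs0_le.
have he : `|h| <= eps by near: h; exact: dnbhs0_le.
rewrite /f /cumulant (_ : s0 + (a + h) = h + (s0 + a)); last by ring.
set b := expR (A _ - _); set c := expR (A _ - _) => hb.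
have -> : D - h^-1 *: (b - c) = - (h^-1 * (b - c - h * D)).
  by rewrite /GRing.scale/=; field.
rewrite normrN normrM normfV ler_pdivrMl ?normr_gt0//.
apply: le_trans hb _; rewrite -(real_normK (num_real h)) expr2.
by rewrite ler_pM2l ?normr_gt0.
Unshelve. all: by end_near. Qed.

(** The first-order term is exact and only the remainder is estimated, so that [derive1 A (s0 + a)]
    itself, rather than its equivalent [a], reaches the conditions of the upper bound. *)
Lemma cumulant_slope : exists2 eps, 0 < eps & forall a l, 0 <= a <= eps -> 0 <= l <= eps ->
  derivable A (s0 + a) 1 -> phi (a - l) - phi a <= - l * derive1 A (s0 + a) + l ^+ 2.
Proof.
have [r r0 rs] := sset_nbhs Theta_t0 sigma_gt0.
have iexp := integrable_expR_ylaw Theta_t0 sigma_gt0 BC rs.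
have mean0 := ylaw_mean0 Theta_t0 sigma_gt0 BC r0 rs.
have var1 := ylaw_var1 Theta_t0 sigma_gt0 BC r0 rs.
(* Here [mgf2 P e <= 2], so the Taylor remainder [h^2 / 2 * mgf2 P e] is at most [h^2]. *)
have [e /andP[e0 er] eK] := mgf2_near1 r0 iexp var1 ltr01.
exists (e / 2); first by rewrite divr_gt0.
move=> a l /andP[a0 ae] /andP[l0 le] dA.
have an : `|a| <= e / 2 by rewrite ger0_norm.
have bnd h : `|h| <= e / 2 ->
    mgf P a + h * mgf1 P a <= mgf P (a + h) <= mgf P a + h * mgf1 P a + h ^+ 2.
  move=> he; apply/andP; split.
    apply: (mgf_ge r0 iexp); first lra.
    by have := ler_normD a h; lra.
  have := @mgf_le _ P _ r0 iexp a h e; move=> /(_ _ er) hle.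
  apply: le_trans (hle _) _; first lra.
  by rewrite lerD2l; have := sqr_ge0 h; nra.
have mE u : `|u| <= e -> mgf P u = expR (phi u).
  by move=> ue; apply: (mgf_cumulant Theta_t0 sigma_gt0 BC rs); lra.
have mEh h : `|h| <= e / 2 -> mgf P (a + h) = expR (phi (a + h)).
  by move=> he; apply: mE; have := ler_normD a h; lra.
have mEa : mgf P a = expR (phi a) by apply: mE; lra.
have DE : mgf1 P a = expR (phi a) * derive1 A (s0 + a).
  apply: (@derive1_cumulant _ _ (e / 2)) => // [|h he]; first by rewrite divr_gt0.
  have := bnd _ he; rewrite mEh// mEa => /andP[h1 h2].
  by rewrite ger0_norm; lra.
have ln' : `|- l| <= e / 2 by rewrite normrN ger0_norm.
have := bnd _ ln'; rewrite mEh// mEa DE => /andP[_].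
have Za : 1 <= expR (phi a) by rewrite -mEa; apply: (mgf_ge1 r0 iexp mean0); lra.
have := expR_ge1Dx (phi (a - l) - phi a); rewrite expRD expRN.
set z := expR (phi a) in Za *; set w := expR (phi (a - l)).
set q := derive1 A _ => hw h2.
have z0 : 0 < z by lra.
(* Dividing by [z = expR (phi a) >= 1] does not increase the remainder. *)
have : w / z <= 1 - l * q + l ^+ 2.
  by rewrite ler_pdivrMr//; have := sqr_ge0 l; nra.
lra.
Qed.

(** [ef_Theta] is an arbitrary set, so [s0 + (s - s0 - l)] may fall outside [sset] and the moment at
    that tilt cannot be evaluated. It is only compared with the moments at [v], [v - l] and
    [s - s0], which are explicit. *)
Lemma ylaw_expRN_le s v l : sset s -> sset (s0 + v) -> sset (s0 + (v - l)) ->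
  v <= s - s0 -> 0 < l ->
  (\int[ylaw E t0 s]_y (expR (- l * y))%:E <= (expR (phi (v - l) - phi v))%:E)%E.
Proof.
move=> ss sv svl vs l0; set u := s - s0.
have uE : s0 + u = s by rewrite /u; ring.
have su : sset (s0 + u) by rewrite uE.
have mexp := @measurable_expRM R.
rewrite (ylaw_density Theta_t0 sigma_gt0 BC ss); last 2 first.
- by apply/measurable_EFinP; exact: mexp.
- by move=> y; rewrite lee_fin expR_ge0.
have phiu : A s - A s0 = phi u by rewrite /cumulant uE.
rewrite phiu -/u.
have [G GE] : exists G, G = phi (v - l) - phi v by eexists.
rewrite -GE.
apply: (@le_trans _ _ ((expR (- phi u))%:E * \int[P]_y (expR ((u - l) * y))%:E)%E); last first.
  have IM := integral_expR_cumulant Theta_t0 sigma_gt0 BC.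
  pose y0 := - G / l; pose c := expR ((u - v) * y0).
  (* Chebyshev's association: [expR ((u - v) y)] increases and [expR (- l y)] decreases in [y], and
     [y0] is the point where the latter equals its mean [expR G] under the tilt by [v]. *)
  have key : (\int[P]_y (expR ((u - l) * y) + c * expR G * expR (v * y))%:E <=
      \int[P]_y (c * expR ((v - l) * y) + expR G * expR (u * y))%:E)%E.
    apply: ge0_le_integral => //.
    - by move=> y _; rewrite lee_fin addr_ge0 ?mulr_ge0 ?expR_ge0.
    - apply/measurable_EFinP; apply: measurable_funD; first exact: mexp.
      by apply: measurable_funM => //; exact: mexp.
    - apply/measurable_EFinP; apply: measurable_funD.
      by apply: measurable_funM => //; exact: mexp.
      by apply: measurable_funM => //; exact: mexp.
    move=> y _; rewrite lee_fin.
    have -> : (u - l) * y = (u - v) * y + - l * y + v * y by ring.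
    have -> : (v - l) * y = - l * y + v * y by ring.
    have -> : u * y = (u - v) * y + v * y by ring.
    rewrite !expRD -subr_ge0.
    set f := expR ((u - v) * y); set g := expR (- l * y); set ev := expR (v * y).
    rewrite [X in 0 <= X](_ : _ = ev * - ((f - c) * (g - expR G))); last by ring.
    rewrite mulr_ge0 ?expR_ge0// oppr_ge0 /f /g {f g}.
    have Gy : G = - l * y0 by rewrite /y0; field; rewrite gt_eqF.
    rewrite Gy /c; have [yy|yy] := leP y y0.
      rewrite mulr_le0_ge0// ?subr_le0 ?subr_ge0 ler_expR.
        by rewrite ler_wpM2l// subr_ge0.
      by nra.
    rewrite mulr_ge0_le0// ?subr_le0 ?subr_ge0 ler_expR.
      by rewrite ler_wpM2l ?subr_ge0// ltW.
    by nra.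
  move: key; under eq_integral do rewrite EFinD EFinM.
  under [X in (_ <= X)%E]eq_integral do rewrite EFinD 2!EFinM.
  have mE k : measurable_fun [set: R] (fun y => (expR (k * y))%:E).
    by apply/measurable_EFinP; exact: mexp.
  have ge0 k (y : R) : [set: R] y -> (0 <= (expR (k * y))%:E)%E by rewrite lee_fin expR_ge0.
  have mK k k' : measurable_fun [set: R] (fun y => (k'%:E * (expR (k * y))%:E)%E).
    by apply: measurable_funeM; exact: mE.
  have cG0 : (0 <= (c * expR G)%:E)%E by rewrite lee_fin mulr_ge0 ?expR_ge0.
  have c0 : (0 <= c%:E)%E by rewrite lee_fin expR_ge0.
  have G0 : (0 <= (expR G)%:E)%E by rewrite lee_fin expR_ge0.
  have g2 k k' (y : R) : (0 <= k'%:E)%E -> [set: R] y -> (0 <= k'%:E * (expR (k * y))%:E)%E.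
    by move=> h _; rewrite mule_ge0// lee_fin expR_ge0.
  rewrite ge0_integralD//; last by move=> y; exact: g2.
  rewrite ge0_integralD//; [|by move=> y; exact: g2..].
  rewrite !ge0_integralZl//; [|by move=> y; exact: ge0..].
  rewrite (IM _ sv) (IM _ svl) (IM _ su) -!EFinM.
  (* By the choice of [G] this term equals the one with factor [c] on the other side, and the two
     cancel. *)
  have -> : c * expR G * expR (phi v) = c * expR (phi (v - l)).
    by rewrite -mulrA -expRD GE subrK.
  rewrite [X in (_ <= X)%E]addeC leeD2rE// => key.
  apply: le_trans (lee_wpmul2l _ key) _; first by rewrite lee_fin expR_ge0.
  by rewrite -EFinM lee_fin mulrCA -expRD addNr expR0 mulr1.
rewrite -ge0_integralZl//; last by apply/measurable_EFinP; exact: mexp.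
rewrite le_eqVlt; apply/orP; left; apply/eqP; apply: eq_integral => y _.
by rewrite -!EFinM -!expRD; congr (expR _)%:E; ring.
Qed.

End cumulant_estimates.

(** * Linear statistics and the risk of the scan test *)

Lemma lee_prod (R : realType) (I : finType) (f g : I -> \bar R) :
  (forall i, 0 <= f i <= g i)%E -> (\prod_i f i <= \prod_i g i)%E.
Proof.
move=> fg; suff /andP[_ //] : (0 <= \prod_i f i <= \prod_i g i)%E.
elim/big_rec2 : _ => [|i x y _ /andP[x0 xy]]; first by rewrite lee01 lexx.
by have /andP[f0 fgi] := fg i; rewrite mule_ge0//= lee_pmul.
Qed.

Section model_theory.
Context d (X : measurableType d) (R : realType) (E : expFamily X R) (t0 : R)
  (B : R -> R) (N M : nat).
Hypothesis Theta_t0 : interior (ef_Theta E) t0.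
Hypothesis sigma_gt0 : 0 < sigma0 E t0.
Hypothesis BC : forall t, ef_Theta E t -> B (ef_eta E t) = ef_C E t.

Local Notation s0 := (s0 E t0).
Local Notation sset := (sset E t0).
Local Notation phi := (cumulant E t0 B).
Local Notation obs := (N.-tuple (M.-tuple R)).
Local Notation model := (@model _ X R E t0 N M).
Local Notation P0 := (model (const_mx s0)).

Definition linstat (c : 'I_N -> 'I_M -> R) (y : obs) : R :=
  \sum_(i < N) \sum_(j < M) c i j * entry y i j.

Lemma measurable_entry i j : measurable_fun [set: obs] (fun y : obs => entry y i j).
Proof.
apply: (measurableT_comp (f := fun t : M.-tuple R => tnth t j)); exact: measurable_tnth.
Qed.

Lemma measurable_linstat c : measurable_fun [set: obs] (linstat c).
Proof.
apply: measurable_sum => i; apply: measurable_sum => j.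
by apply: measurable_funM => //; exact: measurable_entry.
Qed.

Lemma measurable_expR_linstat c (k : R) :
  measurable_fun [set: obs] (fun y => expR (linstat c y + k)).
Proof.
by apply: measurableT_comp => //; apply: measurable_funD => //; exact: measurable_linstat.
Qed.

Lemma expR_linstat c y : expR (linstat c y) = \prod_i \prod_j expR (c i j * entry y i j).
Proof. by rewrite /linstat expR_sum; apply: eq_bigr => i _; rewrite expR_sum. Qed.

Lemma integral_model_prod (S : 'M[R]_(N, M)) (f : 'I_N -> 'I_M -> R -> R) :
  (forall i j, measurable_fun [set: R] (f i j)) -> (forall i j x, 0 <= f i j x) ->
  (\int[model S]_y (\prod_i \prod_j f i j (entry y i j))%:E =
   \prod_i \prod_j \int[ylaw E t0 (S i j)]_x (f i j x)%:E)%E.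
Proof.
move=> mf f0.
rewrite /model (integral_prod_prob (fun i => prod_prob (fun j => ylaw E t0 (S i j)))
  (f := fun i (t : M.-tuple R) => \prod_j f i j (tnth t j))).
- by apply: eq_bigr => i _; rewrite (integral_prod_prob (fun j => ylaw E t0 (S i j))).
- by move=> i; exact: measurable_prod_tnth.
- by move=> i t; apply: prodr_ge0.
Qed.

Lemma integral_model_expR_le (S : 'M[R]_(N, M)) (c b : 'I_N -> 'I_M -> R) :
  (forall i j, (\int[ylaw E t0 (S i j)]_x (expR (c i j * x))%:E <= (expR (b i j))%:E)%E) ->
  (\int[model S]_y (expR (linstat c y))%:E <= (expR (\sum_i \sum_j b i j))%:E)%E.
Proof.
move=> cb; under eq_integral do rewrite expR_linstat.
rewrite (integral_model_prod (S : 'M[R]_(N, M)) (f := fun i j x => expR (c i j * x))); last 2 first.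
- by move=> i j; exact: measurable_expRM.
- by move=> i j x; exact: expR_ge0.
rewrite expR_sum -prodEFin; apply: lee_prod => i; apply/andP; split.
  by apply: prode_ge0 => j _; apply: integral_ge0 => x _; rewrite lee_fin expR_ge0.
rewrite expR_sum -prodEFin; apply: lee_prod => j.
by rewrite cb andbT; apply: integral_ge0 => x _; rewrite lee_fin expR_ge0.
Qed.

Lemma integral_null_expR (c : 'I_N -> 'I_M -> R) (k : R) :
  (forall i j, sset (s0 + c i j)) ->
  (\int[P0]_y (expR (linstat c y + k))%:E = (expR (\sum_i \sum_j phi (c i j) + k))%:E)%E.
Proof.
move=> cs; under eq_integral do rewrite expRD EFinM.
rewrite ge0_integralZr//; last first.
  by apply/measurable_EFinP/measurableT_comp => //; exact: measurable_linstat.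
under eq_integral do rewrite expR_linstat.
rewrite (integral_model_prod _ (f := fun i j x => expR (c i j * x))); last 2 first.
- by move=> i j; exact: measurable_expRM.
- by move=> i j x; exact: expR_ge0.
rewrite expRD EFinM; congr (_ * _)%E.
rewrite expR_sum -prodEFin; apply: eq_bigr => i _.
rewrite expR_sum -prodEFin; apply: eq_bigr => j _.
by rewrite mxE (integral_expR_cumulant Theta_t0 sigma_gt0 BC).
Qed.

Lemma model_density (S : 'M[R]_(N, M)) : (forall i j, sset (S i j)) ->
  has_density (model S) P0 (fun y =>
    expR (linstat (fun i j => S i j - s0) y - \sum_i \sum_j phi (S i j - s0))).
Proof.
move=> Ss.
pose w i j x := expR ((S i j - s0) * x - phi (S i j - s0)).
have mw i j : measurable_fun [set: R] (w i j).
  by apply: measurableT_comp => //; apply: measurable_funB => //; exact: measurable_funM.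
rewrite (_ : (fun _ => _) = (fun y : obs => \prod_i \prod_j w i j (tnth (tnth y i) j))).
  apply: (prod_prob_density (w := fun i (t : M.-tuple R) => \prod_j w i j (tnth t j))).
  - by move=> i; exact: measurable_prod_tnth.
  - by move=> i t; apply: prodr_ge0 => j _; exact: expR_ge0.
  move=> i; apply: prod_prob_density => //; first by move=> j x; exact: expR_ge0.
  move=> j; rewrite mxE /w /cumulant.
  rewrite (_ : s0 + (S i j - s0) = S i j); last by ring.
  exact: (ylaw_density Theta_t0 sigma_gt0 BC).
apply/funext => y; rewrite /linstat -sumrB expR_sum; apply: eq_bigr => i _.
by rewrite -sumrB expR_sum.
Qed.

Definition rsum (C : {set 'I_N} * {set 'I_M}) (y : obs) : R :=
  \sum_(i in C.1) \sum_(j in C.2) entry y i j.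

Lemma sum_in_rect (C : {set 'I_N} * {set 'I_M}) (F : 'I_N -> 'I_M -> R) :
  \sum_i \sum_j (if in_rect C i j then F i j else 0) =
  \sum_(i in C.1) \sum_(j in C.2) F i j.
Proof.
rewrite [RHS]big_mkcond/=; apply: eq_bigr => i _; rewrite /in_rect.
by case: ifP => _ /=; [rewrite [RHS]big_mkcond|rewrite big1].
Qed.

Lemma sum_in_rect_cst (C : {set 'I_N} * {set 'I_M}) (x : R) :
  \sum_i \sum_j (if in_rect C i j then x else 0) = #|C.1|%:R * #|C.2|%:R * x.
Proof.
rewrite (sum_in_rect C (fun _ _ => x)) sumr_const -[LHS]mulr_natl sumr_const.
by rewrite -[X in _ * X]mulr_natl mulrA.
Qed.

Lemma linstat_rect (C : {set 'I_N} * {set 'I_M}) (x : R) y :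
  linstat (fun i j => if in_rect C i j then x else 0) y = x * rsum C y.
Proof.
rewrite /rsum -sum_in_rect mulr_sumr; apply: eq_bigr => i _.
rewrite mulr_sumr; apply: eq_bigr => j _.
by case: ifP; rewrite ?mul0r ?mulr0.
Qed.

Lemma linstatD c c' y : linstat (fun i j => c i j + c' i j) y = linstat c y + linstat c' y.
Proof.
rewrite /linstat -big_split/=; apply: eq_bigr => i _.
by rewrite -big_split/=; apply: eq_bigr => j _; rewrite mulrDl.
Qed.

Lemma measurable_rsum C : measurable_fun [set: obs] (rsum C).
Proof.
rewrite (_ : rsum C = linstat (fun i j => if in_rect C i j then 1 else 0)).
  exact: measurable_linstat.
by apply/funext => y; rewrite linstat_rect mul1r.
Qed.

End model_theory.

Lemma card_rect (N M n m : nat) :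
  #|[pred C : {set 'I_N} * {set 'I_M} | rect_of_size n m C]| = ('C(N, n) * 'C(M, m))%N.
Proof.
transitivity #|finset.setX [set A : {set 'I_N} | #|A| == n] [set A : {set 'I_M} | #|A| == m]|.
  by apply: eq_card => -[C1 C2]; rewrite !inE.
by rewrite cardsX !card_draws !card_ord.
Qed.

(** * Exponential and union bounds for the test at fixed sizes *)

Section upper_bound.
Context d (X : measurableType d) (R : realType) (E : expFamily X R) (t0 : R)
  (B : R -> R) (N M n m : nat).
Hypothesis Theta_t0 : interior (ef_Theta E) t0.
Hypothesis sigma_gt0 : 0 < sigma0 E t0.
Hypothesis BC : forall t, ef_Theta E t -> B (ef_eta E t) = ef_C E t.

Local Notation s0 := (s0 E t0).
Local Notation sset := (sset E t0).
Local Notation phi := (cumulant E t0 B).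
Local Notation obs := (N.-tuple (M.-tuple R)).
Local Notation model := (@model _ X R E t0 N M).
Local Notation P0 := (model (const_mx s0)).

Lemma ge0_le_integralW d' (T : measurableType d') (mu : {measure set T -> \bar R})
    (f g : T -> \bar R) :
  (forall x, 0 <= f x)%E -> (forall x, f x <= g x)%E ->
  (\int[mu]_x f x <= \int[mu]_x g x)%E.
Proof.
move=> f0 fg; have g0 x : (0 <= g x)%E := le_trans (f0 x) (fg x).
rewrite !ge0_integralTE//; apply: ereal_sup_le => _ [h hf <-].
by exists h => // x; exact: le_trans (hf x) (fg x).
Qed.

Lemma psistarE delta H (y : obs) :
  psistar n m delta H y =
  ((H < tlin y) || ((threshold N M n m delta)%:E < tmax n m y)%E)%:R.
Proof.
by rewrite /psistar; case: (_ < _); case: (_ < _)%E; rewrite /= ?maxxx// /Num.max ?ltr01// ltr10.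
Qed.

Lemma psistar_bound delta H (y : obs) :
  0 <= psistar n m delta H y <= 1.
Proof. by rewrite psistarE; case: (_ || _); rewrite ?ler01 ?lexx. Qed.

Let T (delta : R) := threshold N M n m delta.
Let lin : R := (Num.sqrt (N * M)%:R)^-1.
Let nrm : R := (Num.sqrt (n * m)%:R)^-1.

Lemma tlinE (y : obs) : tlin y = linstat (fun _ _ => lin) y.
Proof.
rewrite /tlin /linstat mulr_sumr; apply: eq_bigr => i _.
by rewrite mulr_sumr.
Qed.

(** Tilt 1 is enough for [tlin], whose level diverges; the maximum needs the optimal Gaussian tilt,
    the threshold itself, to compensate the number of rectangles. *)
Lemma psistar_le delta H (y : obs) :
  psistar n m delta H y <= expR (tlin y - H) +
    \sum_(C : {set 'I_N} * {set 'I_M} | rect_of_size n m C)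
      expR (T delta * (nrm * rsum C y - T delta)).
Proof.
have sum0 : 0 <= \sum_(C : {set 'I_N} * {set 'I_M} | rect_of_size n m C)
    expR (T delta * (nrm * rsum C y - T delta)).
  by apply: sumr_ge0 => C _; exact: expR_ge0.
have T0 : 0 <= T delta by exact: sqrtr_ge0.
rewrite psistarE; case: ltP => [Ht|_] /=.
  by apply: ler_wpDr => //; rewrite -expR0 ler_expR subr_ge0 ltW.
case: (boolP (_ < _)%E) => [|_]; last by rewrite addr_ge0 ?expR_ge0.
move=> /bigmax_gtP[//|[C Cr]]; rewrite lte_fin => TC.
apply: ler_wpDl; first exact: expR_ge0.
rewrite (bigD1 C)//= ler_wpDr//; first by apply: sumr_ge0 => ? _; exact: expR_ge0.
by rewrite -expR0 ler_expR mulr_ge0// subr_ge0 ltW.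
Qed.

Lemma one_sub_psistar_le_lin delta H (y : obs) :
  1 - psistar n m delta H y <= expR (H - tlin y).
Proof.
rewrite psistarE; case: ltP => [_|Ht] /=; first by rewrite subrr expR_ge0.
apply: (@le_trans _ _ 1); first by case: (_ < _)%E; rewrite ?subrr ?subr0.
by rewrite -expR0 ler_expR subr_ge0.
Qed.

Lemma one_sub_psistar_le_max delta H l C (y : obs) : 0 <= l -> rect_of_size n m C ->
  1 - psistar n m delta H y <= expR (l * (T delta - nrm * rsum C y)).
Proof.
move=> l0 Cr; rewrite psistarE.
case: ltP => [_|_] /=; first by rewrite subrr expR_ge0.
case: ltP => [_|h]; first by rewrite subrr expR_ge0.
rewrite subr0 -expR0 ler_expR mulr_ge0// subr_ge0 -lee_fin.
apply: le_trans h; exact: (le_bigmax_cond _ _ Cr).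
Qed.

Lemma type1_psistar_le delta H (bl bm : R) :
  sset (s0 + lin) -> phi lin <= bl ->
  sset (s0 + T delta * nrm) -> phi (T delta * nrm) <= bm ->
  (type1 E t0 (@psistar R N M n m delta H) <=
    (expR ((N * M)%:R * bl - H) +
     'C(N, n)%:R * 'C(M, m)%:R * expR ((n * m)%:R * bm - T delta ^+ 2))%:E)%E.
Proof.
move=> sl pl st pt; rewrite /type1 unlock.
pose f (C : {set 'I_N} * {set 'I_M}) (y : obs) :=
  if rect_of_size n m C then expR (T delta * (nrm * rsum C y - T delta)) else 0.
have f0 C y : 0 <= f C y by rewrite /f; case: ifP => // _; exact: expR_ge0.
apply: (@le_trans _ _ (\int[P0]_y ((expR (tlin y - H))%:E + \sum_C (f C y)%:E))%E).
  apply: ge0_le_integralW => y; first by rewrite lee_fin; have /andP[] := psistar_bound delta H y.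
  by rewrite sumEFin -EFinD lee_fin /f -big_mkcond; exact: psistar_le.
have fE C y : f C y = if rect_of_size n m C then
    expR (linstat (fun i j => if in_rect C i j then T delta * nrm else 0) y - T delta ^+ 2) else 0.
  by rewrite /f; case: ifP => // _; rewrite linstat_rect; congr expR; ring.
have mf C : measurable_fun [set: obs] (fun y => (f C y)%:E).
  apply/measurable_EFinP; rewrite (funext (fE C)).
  case: (rect_of_size n m C) => //; exact: measurable_expR_linstat.
have ml : measurable_fun [set: obs] (fun y => (expR (tlin y - H))%:E).
  under eq_fun do rewrite tlinE.
  by apply/measurable_EFinP; exact: measurable_expR_linstat.
rewrite ge0_integralD//; last 2 first.
- by move=> y _; apply: sume_ge0 => C _; rewrite lee_fin.
- exact: emeasurable_sum.
rewrite EFinD leeD//.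
  under eq_integral do rewrite tlinE.
  rewrite (integral_null_expR Theta_t0 sigma_gt0 BC)// lee_fin ler_expR lerD2r.
  rewrite sumr_const sumr_const !card_ord -mulrnA mulr_natl mulnC.
  by rewrite lerMn2r pl orbT.
rewrite ge0_integral_sum//; last by move=> C y _; rewrite lee_fin.
apply: (@le_trans _ _ (\sum_(C : {set 'I_N} * {set 'I_M} | rect_of_size n m C)
    (expR ((n * m)%:R * bm - T delta ^+ 2))%:E)%E).
  rewrite [X in (_ <= X)%E]big_mkcond/=; apply: lee_sum => C _.
  under eq_integral do rewrite fE.
  case: ifP => [/andP[/eqP C1 /eqP C2]|_]; last by rewrite integral0.
  rewrite (integral_null_expR Theta_t0 sigma_gt0 BC); last first.
    by move=> i j; case: ifP => // _; rewrite addr0; exact: s0_sset.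
  rewrite lee_fin ler_expR lerD2r.
  rewrite (_ : \sum_i _ = \sum_i \sum_j (if in_rect C i j then phi (T delta * nrm) else 0)).
    by rewrite sum_in_rect_cst C1 C2 natrM ler_wpM2l// mulr_ge0.
  by apply: eq_bigr => i _; apply: eq_bigr => j _; case: ifP => // _; exact: cumulant0.
rewrite sumEFin lee_fin sumr_const -[_ *+ _]mulr_natl.
by rewrite ler_wpM2r ?expR_ge0// -natrM ler_nat card_rect.
Qed.

Lemma type2_psistar_le_lin delta H a (b0 b1 : R) :
  sset (s0 - lin) -> phi (- lin) <= b0 -> 0 <= b0 ->
  (forall s, sset s -> a <= s - s0 ->
     (\int[ylaw E t0 s]_y (expR (- lin * y))%:E <= (expR b1)%:E)%E) ->
  (type2 E t0 n m a (@psistar R N M n m delta H) <=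
    (expR (H + (N * M)%:R * b0 + (n * m)%:R * b1))%:E)%E.
Proof.
move=> sl pl b00 hb; apply: ge_ereal_sup => _ [S [Ss [C [/andP[/eqP C1 /eqP C2] Sn Sa]]] <-].
rewrite unlock.
apply: (@le_trans _ _ (\int[model S]_y ((expR H)%:E * (expR (linstat (fun _ _ => - lin) y))%:E))%E).
  apply: ge0_le_integralW => y.
    by rewrite lee_fin subr_ge0; have /andP[] := psistar_bound delta H y.
  rewrite -EFinM lee_fin -expRD; apply: le_trans (one_sub_psistar_le_lin delta H y) _.
  rewrite ler_expR tlinE /linstat -sumrN lerD2l.
  rewrite le_eqVlt; apply/orP; left; apply/eqP; apply: eq_bigr => i _.
  by rewrite -sumrN; apply: eq_bigr => j _; rewrite mulNr.
rewrite ge0_integralZl//; last first.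
  by apply/measurable_EFinP/measurableT_comp => //; exact: measurable_linstat.
rewrite -addrA expRD EFinM lee_wpmul2l ?lee_fin ?expR_ge0//.
(* Entries of the rectangle are charged [b0] too, which is allowed since [0 <= b0] and leaves two
   constant sums. *)
apply: (@le_trans _ _ (expR (\sum_i \sum_j (b0 + (if in_rect C i j then b1 else 0))))%:E).
  apply: integral_model_expR_le => i j.
  have [Cij|Cij] := boolP (in_rect C i j).
    by apply: le_trans (hb _ (Ss i j) (Sa _ _ Cij)) _; rewrite lee_fin ler_expR lerDr.
  rewrite Sn//= addr0 (integral_expR_cumulant Theta_t0 sigma_gt0 BC)// lee_fin ler_expR//.
rewrite lee_fin ler_expR.
under eq_bigr do rewrite big_split/=.
rewrite big_split/= sum_in_rect_cst C1 C2 -natrM lerD2r.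
by rewrite sumr_const sumr_const !card_ord -mulrnA mulr_natl mulnC.
Qed.

Lemma type2_psistar_le_max delta H a l (b1 : R) : 0 <= l ->
  (forall s, sset s -> a <= s - s0 ->
     (\int[ylaw E t0 s]_y (expR (- (l * nrm) * y))%:E <= (expR b1)%:E)%E) ->
  (type2 E t0 n m a (@psistar R N M n m delta H) <=
    (expR (l * T delta + (n * m)%:R * b1))%:E)%E.
Proof.
move=> l0 hb; apply: ge_ereal_sup => _ [S [Ss [C [Cr Sn Sa]]] <-].
have /andP[/eqP C1 /eqP C2] := Cr.
rewrite unlock.
pose c := fun (i : 'I_N) (j : 'I_M) => if in_rect C i j then - (l * nrm) else 0.
apply: (@le_trans _ _ (\int[model S]_y ((expR (l * T delta))%:E * (expR (linstat c y))%:E))%E).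
  apply: ge0_le_integralW => y.
    by rewrite lee_fin subr_ge0; have /andP[] := psistar_bound delta H y.
  rewrite -EFinM lee_fin -expRD.
  apply: le_trans (one_sub_psistar_le_max delta H y l0 Cr) _.
  by rewrite /c linstat_rect ler_expR le_eqVlt; apply/orP; left; apply/eqP; ring.
rewrite ge0_integralZl//; last first.
  by apply/measurable_EFinP/measurableT_comp => //; exact: measurable_linstat.
rewrite expRD EFinM lee_wpmul2l ?lee_fin ?expR_ge0//.
apply: (@le_trans _ _ (expR (\sum_i \sum_j (if in_rect C i j then b1 else 0)))%:E).
  apply: integral_model_expR_le => i j; rewrite /c.
  case: ifP => Cij; first exact: hb (Ss i j) (Sa _ _ Cij).
  under eq_integral do rewrite mul0r expR0.
  by rewrite integral_cst// mul1e expR0; apply: probability_le1.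
by rewrite sum_in_rect_cst C1 C2 natrM.
Qed.

(** Over an empty set of alternatives the supremum in [type2] would be [-oo]; this is what bounds
    the risk from below by 0. *)
Lemma alternatives_nonempty a : (n <= N)%N -> (m <= M)%N -> sset (s0 + a) ->
  exists S : 'M[R]_(N, M), alternatives E t0 n m a S.
Proof.
move=> nN mM sa.
have draw k K : (k <= K)%N -> exists A : {set 'I_K}, #|A| = k.
  move=> kK; have : (0 < #|[set A : {set 'I_K} | #|A| == k]%SET|)%N.
    by rewrite card_draws card_ord bin_gt0.
  by case/card_gt0P => A; rewrite inE => /eqP; exists A.
have [A1 A1n] := draw _ _ nN; have [A2 A2m] := draw _ _ mM.
exists (\matrix_(i, j) (if in_rect (A1, A2) i j then s0 + a else s0)); split.
  by move=> i j; rewrite mxE; case: ifP => // _; exact: s0_sset.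
exists (A1, A2); split.
- by rewrite /rect_of_size/= A1n A2m !eqxx.
- by move=> i j; rewrite mxE => /negbTE ->.
- by move=> i j; rewrite mxE => ->; rewrite addrC addKr.
Qed.

Lemma type2_ge0 a (psi : obs -> R) (S : 'M[R]_(N, M)) :
  alternatives E t0 n m a S -> (forall y, psi y <= 1) ->
  (0 <= type2 E t0 n m a psi)%E.
Proof.
move=> aS p1; apply: (@le_trans _ _ ('E_(model S)[fun y => (1 - psi y)%R])%E).
  by apply: expectation_ge0 => y; rewrite subr_ge0.
by apply: ereal_sup_ubound; exists S.
Qed.

End upper_bound.

(** * Asymptotics of the upper bound *)

Section binomial_estimates.

(** A uniform [n]-subset of [N] points contains [k] given points with probability at most
    [(n / N)^k]. The case [k = n] also bounds ['C(N, n)] from below by [(N / n)^n]. *)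
Lemma bin_sub_le (N n k : nat) : (k <= n <= N)%N ->
  ('C(N - k, n - k) * N ^ k <= 'C(N, n) * n ^ k)%N.
Proof.
move=> /andP[kn nN]; elim: k kn => [|k IH] kn; first by rewrite !subn0 !expn0.
have Nk : (0 < N - k)%N by rewrite subn_gt0 (leq_trans kn).
rewrite -(leq_pmul2l Nk).
have e : ((N - k) * 'C(N - k.+1, n - k.+1) = (n - k) * 'C(N - k, n - k))%N.
  have -> : (n - k = (n - k.+1).+1)%N by rewrite subnSK.
  by rewrite -mul_bin_diag subnS.
rewrite mulnA e -mulnA expnS (mulnCA _ N) mulnA (mulnC (n - k)%N).
apply: (@leq_trans (N * (n - k) * ('C(N, n) * n ^ k))).
  by rewrite leq_pmul2l ?muln_gt0 ?(leq_trans _ nN) ?subn_gt0 ?kn ?(leq_trans _ kn)// IH// ltnW.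
rewrite expnS (mulnCA 'C(N, n)) [X in (_ <= X)%N]mulnA leq_mul2r; apply/orP; right.
by rewrite mulnBr mulnBl leq_sub// ?(mulnC n N)// (mulnC k) leq_mul2r nN orbT.
Qed.

Variable R : realType.

(** A single term of the expansion of [(1 + x) ^+ N]; it is used with [x = n / N]. *)
Lemma bin_exp_le (N n : nat) (x : R) : 0 <= x ->
  'C(N, n)%:R * x ^+ n <= expR (N%:R * x).
Proof.
move=> x0; have [Nn|nN] := ltnP N n.
  by rewrite bin_small// mul0r expR_ge0.
rewrite expRM_natl; apply: (@le_trans _ _ ((1 + x) ^+ N)); last first.
  by rewrite lerXn2r ?nnegrE ?addr_ge0 ?expR_ge0// expR_ge1Dx.
rewrite exprDn (bigD1 (Ordinal (nN : (n < N.+1)%N)))//= expr1n mul1r mulr_natl.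
by rewrite lerDl sumr_ge0// => i _; rewrite mulrn_wge0// expr1n mul1r exprn_ge0.
Qed.

Lemma ln_bin_bounds (N n : nat) : (0 < n <= N)%N ->
  n%:R * ln (n%:R / N%:R : R)^-1 <= ln ('C(N, n)%:R : R) <=
  n%:R * ln (n%:R / N%:R : R)^-1 + n%:R.
Proof.
move=> /andP[n0 nN]; set L := ln (_ / _)^-1.
have N0 : (0 < N)%N := leq_trans n0 nN.
have nR : 0 < n%:R :> R by rewrite ltr0n.
have NR : 0 < N%:R :> R by rewrite ltr0n.
have C0 : 0 < 'C(N, n)%:R :> R by rewrite ltr0n bin_gt0.
have p0 : 0 < (n%:R / N%:R : R) by rewrite divr_gt0.
have nL : n%:R * L = ln ((n%:R / N%:R)^-1 ^+ n).
  by rewrite lnXn ?invr_gt0// mulr_natl.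
apply/andP; split.
  rewrite nL ler_ln ?posrE ?exprn_gt0 ?invr_gt0//.
  rewrite invf_div expr_div_n ler_pdivrMr ?exprn_gt0// -!natrX -natrM ler_nat.
  by have := @bin_sub_le N n n; rewrite leqnn nN subnn bin0 mul1n => /(_ isT).
rewrite -[X in _ + X]expRK nL -lnM ?posrE ?exprn_gt0 ?invr_gt0 ?expR_gt0//.
rewrite ler_ln ?posrE ?mulr_gt0 ?exprn_gt0 ?invr_gt0 ?expR_gt0//.
rewrite exprVn ler_pdivlMl ?exprn_gt0// mulrC.
apply: le_trans (bin_exp_le _ _ (ltW p0)) _.
by rewrite mulrCA divff ?mulr1// gt_eqF.
Qed.

End binomial_estimates.

(** * Consequences of the growth conditions on the sizes *)

Section regime.
Context (R : realType) (N M n m : nat -> nat).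
Hypothesis nN : forall k, (n k <= N k)%N.
Hypothesis mM : forall k, (m k <= M k)%N.
Hypothesis noo : n @ \oo --> \oo.
Hypothesis moo : m @ \oo --> \oo.

Let p k : R := (n k)%:R / (N k)%:R.
Let q k : R := (m k)%:R / (M k)%:R.
Let Lp k := ln (p k)^-1.
Let Lq k := ln (q k)^-1.

Lemma near_natr_ge (u : nat -> nat) (K : R) : u @ \oo --> \oo ->
  \forall k \near \oo, K <= (u k)%:R.
Proof. by move=> uoo; exact: (uoo _ (nbhs_infty_ger K)). Qed.

Lemma near_ln_inv_ge (u : nat -> R) (K : R) : (\forall k \near \oo, 0 < u k) ->
  u @ \oo --> (0 : R) -> \forall k \near \oo, K <= ln (u k)^-1.
Proof.
move=> u0 /cvgrPdist_le /(_ (expR (- K)) (expR_gt0 _)) uK.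
near=> k; have uk : 0 < u k by near: k.
have : `|0 - u k| <= expR (- K) by near: k.
rewrite sub0r normrN gtr0_norm// expRN => h.
rewrite -[K]expRK ler_ln ?posrE ?expR_gt0 ?invr_gt0//.
by rewrite -[expR K]invrK lef_pV2 ?posrE ?invr_gt0 ?expR_gt0.
Unshelve. all: by end_near. Qed.

Lemma near_dims_gt0 : \forall k \near \oo, (0 < n k)%N /\ (0 < m k)%N.
Proof.
near=> k; split; near: k.
  have : \forall k \near \oo, (1 : R) <= (n k)%:R by exact: near_natr_ge.
  by apply: filterS => k; rewrite ler1n.
have : \forall k \near \oo, (1 : R) <= (m k)%:R by exact: near_natr_ge.
by apply: filterS => k; rewrite ler1n.
Unshelve. all: by end_near. Qed.

Hypothesis p0 : p @ \oo --> (0 : R).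
Hypothesis q0 : q @ \oo --> (0 : R).
Hypothesis small : (fun k => Lp k / (m k)%:R + Lq k / (n k)%:R) @ \oo --> (0 : R).

Lemma near_regime (K e : R) : 0 < e -> \forall k \near \oo,
  [/\ (0 < n k)%N, (0 < m k)%N, K <= (n k)%:R, K <= (m k)%:R &
   [/\ K <= Lp k, K <= Lq k & Lp k / (m k)%:R + Lq k / (n k)%:R <= e]].
Proof.
move=> e0.
have pq0 : \forall k \near \oo, 0 < p k /\ 0 < q k.
  apply: filterS near_dims_gt0 => k [n0 m0].
  by rewrite !divr_gt0 ?ltr0n ?n0 ?m0// ?(leq_trans n0 (nN k)) ?(leq_trans m0 (mM k)).
near=> k.
have [n0 m0] : (0 < n k)%N /\ (0 < m k)%N by near: k; exact: near_dims_gt0.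
split => //; [by near: k; exact: near_natr_ge..|split].
- near: k; apply: near_ln_inv_ge => //; by apply: filterS pq0 => k [].
- near: k; apply: near_ln_inv_ge => //; by apply: filterS pq0 => k [].
- have : `|0 - (Lp k / (m k)%:R + Lq k / (n k)%:R)| <= e.
    by near: k; move/cvgrPdist_le : small; exact.
  by rewrite sub0r normrN; apply: le_trans; exact: ler_norm.
Unshelve. all: by end_near. Qed.

End regime.

Section scales.
Context (R : realType) (N M n m : nat).
Hypothesis n0 : (0 < n)%N.
Hypothesis m0 : (0 < m)%N.
Hypothesis nN : (n <= N)%N.
Hypothesis mM : (m <= M)%N.

Local Notation p := (n%:R / N%:R : R).
Local Notation q := (m%:R / M%:R : R).
Local Notation Lp := (ln p^-1).
Local Notation Lq := (ln q^-1).
Local Notation rate := (n%:R * Lp + m%:R * Lq : R).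
Local Notation lnG := (ln ('C(N, n) * 'C(M, m))%:R : R).

Lemma sqr_sqrtV (x : R) : 0 <= x -> (Num.sqrt x)^-1 ^+ 2 = x^-1.
Proof. by move=> x0; rewrite exprVn sqr_sqrtr. Qed.

Lemma ler_of_sqr (x y : R) : 0 <= y -> x ^+ 2 <= y ^+ 2 -> x <= y.
Proof.
move=> y0; have [x0|x0] := leP 0 x; first by rewrite ler_pXn2r.
by move=> _; rewrite (le_trans (ltW x0)).
Qed.

Lemma rate_eq : rate = (n * m)%:R * (Lp / m%:R + Lq / n%:R).
Proof. by rewrite natrM; field; rewrite !pnatr_eq0 -!lt0n n0 m0. Qed.

Lemma lnG_rate : rate <= lnG <= rate + (n%:R + m%:R).
Proof.
have := @ln_bin_bounds R N n; rewrite n0 nN => /(_ isT) /=.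
have := @ln_bin_bounds R M m; rewrite m0 mM => /(_ isT) /=.
move=> /andP[a1 a2] /andP[b1 b2].
rewrite natrM lnM ?posrE ?ltr0n ?bin_gt0 ?nN ?mM//.
by apply/andP; split; lra.
Qed.

Lemma inv_sqrt_natr_le (x : nat) (e : R) : (n <= x)%N -> 0 < e -> (e ^+ 2)^-1 <= n%:R ->
  0 <= (Num.sqrt (x%:R : R))^-1 <= e.
Proof.
move=> nx e0 en; rewrite invr_ge0 sqrtr_ge0/=; apply: ler_of_sqr; first exact: ltW.
rewrite sqr_sqrtV ?ler0n// -[leRHS]invrK lef_pV2 ?posrE ?invr_gt0 ?exprn_gt0//.
  by rewrite (le_trans en)// ler_nat.
by rewrite ltr0n (leq_trans n0).
Qed.

Lemma rate_ge : 1 <= Lp -> 1 <= Lq -> n%:R + m%:R <= rate.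
Proof.
move=> Lp1 Lq1.
have : n%:R * 1 <= n%:R * Lp by rewrite ler_wpM2l.
have : m%:R * 1 <= m%:R * Lq by rewrite ler_wpM2l.
lra.
Qed.

Lemma sqr_threshold delta : 0 <= delta -> 1 <= Lp -> 1 <= Lq ->
  threshold N M n m delta ^+ 2 = (2 + delta) * lnG.
Proof.
move=> d0 Lp1 Lq1; rewrite sqr_sqrtr// mulr_ge0//; first lra.
have /andP[h _] := lnG_rate; apply: le_trans h.
by apply: le_trans (rate_ge Lp1 Lq1); rewrite addr_ge0.
Qed.

(** The squared tilt per entry of the scan bound is of the order of
    [rate / (n m) = Lp / m + Lq / n], so the growth condition of the theorem puts it inside the
    quadratic window of [phi]. *)
Lemma threshold_le delta e : 0 <= delta -> 1 <= Lp -> 1 <= Lq -> 0 < e ->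
  (2 + delta) * 2 * (Lp / m%:R + Lq / n%:R) <= e ^+ 2 ->
  0 <= threshold N M n m delta * (Num.sqrt ((n * m)%:R : R))^-1 <= e.
Proof.
move=> d0 Lp1 Lq1 e0 he; rewrite mulr_ge0 ?invr_ge0 ?sqrtr_ge0//=.
apply: ler_of_sqr; first exact: ltW.
rewrite exprMn sqr_sqrtV// sqr_threshold//.
have /andP[_ h] := lnG_rate; have h2 := rate_ge Lp1 Lq1.
have nm0 : 0 < (n * m)%:R :> R by rewrite ltr0n muln_gt0 n0.
rewrite ler_pdivrMr//; apply: (@le_trans _ _ ((2 + delta) * (2 * rate))).
  by rewrite ler_wpM2l//; lra.
rewrite {1}rate_eq; have -> : (2 + delta) * (2 * ((n * m)%:R * (Lp / m%:R + Lq / n%:R))) =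
  ((2 + delta) * 2 * (Lp / m%:R + Lq / n%:R)) * (n * m)%:R by ring.
by rewrite ler_wpM2r// ltW.
Qed.

End scales.

Section real_sequences.
Context (R : realType).
Implicit Types (u : nat -> R) (x y : R).

Lemma near_limn_esup_lt u (x : \bar R) : (limn_esup (fun k => (u k)%:E) < x)%E ->
  exists2 y, (y%:E < x)%E & \forall k \near \oo, u k <= y.
Proof.
move=> /ereal_inf_lt[_ [V Voo <-] supx].
have uV k : V k -> ((u k)%:E <= ereal_sup [set (u j)%:E | j in V])%E.
  by move=> Vk; apply: ereal_sup_ubound; exists k.
move: supx uV; case: (ereal_sup _) => [r| |] supx uV.
- by exists r => //; apply: filterS Voo => k /uV; rewrite lee_fin.
- by move: supx; rewrite ltNge leey.
- case: x supx => [x _| _|]; last by rewrite ltxx.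
    by exists (x - 1); [rewrite lte_fin; lra|apply: filterS Voo => k /uV].
  by exists 0; [rewrite ltry|apply: filterS Voo => k /uV].
Qed.

Lemma near_limn_einf_gt u x : (x%:E < limn_einf (fun k => (u k)%:E))%E ->
  exists2 y, x < y & \forall k \near \oo, y <= u k.
Proof.
rewrite /limn_einf lteNr => h.
have [|y yx yu] := @near_limn_esup_lt (fun k => - u k) (- x%:E)%E; first exact: h.
exists (- y); first by move: yx; rewrite lte_fin ltrNr.
by apply: filterS yu => k; rewrite lerNl.
Qed.

Lemma cvg_mul_sqrt_natr_pinfty (u : nat -> nat) (c : R) : 0 < c -> u @ \oo --> \oo ->
  (fun k => c * Num.sqrt (u k)%:R) @ \oo --> +oo%R.
Proof.
move=> c0 uoo; apply/cvgryPge => K.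
have : \forall k \near \oo, (c^-1 * K) ^+ 2 <= (u k)%:R by exact: near_natr_ge.
apply: filterS => k uK; rewrite -ler_pdivrMl//.
rewrite (le_trans (ler_norm _))// -sqrtr_sqr ler_sqrt//.
Qed.

Lemma cvg_expRN (v : nat -> R) : v @ \oo --> +oo%R -> (fun k => expR (- v k)) @ \oo --> (0 : R).
Proof. by move=> vy; apply: cvg_comp vy (@cvgr_expR R). Qed.

Lemma cvg_mul_natr_pinfty (u : nat -> nat) (c : R) : 0 < c -> u @ \oo --> \oo ->
  (fun k => c * (u k)%:R) @ \oo --> +oo%R.
Proof.
move=> c0 uoo; apply/cvgryPge => K.
have : \forall k \near \oo, c^-1 * K <= (u k)%:R by exact: near_natr_ge.
by apply: filterS => k; rewrite ler_pdivrMl.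
Qed.

Lemma near_le_of_cvg0 (u : nat -> R) (e : R) : 0 < e -> u @ \oo --> (0 : R) ->
  \forall k \near \oo, u k <= e.
Proof.
move=> e0 /cvgrPdist_le /(_ e e0); apply: filterS => k.
by rewrite sub0r normrN; apply: le_trans; exact: ler_norm.
Qed.

End real_sequences.

(** * Error probabilities of the test along the sequence *)

Section upper_asymptotics.
Context d (X : measurableType d) (R : realType) (E : expFamily X R) (t0 : R)
  (B : R -> R) (N M n m : nat -> nat).
Hypothesis Theta_t0 : interior (ef_Theta E) t0.
Hypothesis sigma_gt0 : 0 < sigma0 E t0.
Hypothesis BC : forall t, ef_Theta E t -> B (ef_eta E t) = ef_C E t.
Hypothesis nN : forall k, (n k <= N k)%N.
Hypothesis mM : forall k, (m k <= M k)%N.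
Hypothesis noo : n @ \oo --> \oo.
Hypothesis moo : m @ \oo --> \oo.

Local Notation s0 := (s0 E t0).
Local Notation sset := (sset E t0).
Local Notation phi := (cumulant E t0 B).
Local Notation A := (Afun E t0 B).
Local Notation p k := ((n k)%:R / (N k)%:R : R).
Local Notation q k := ((m k)%:R / (M k)%:R : R).
Local Notation Lp k := (ln (p k)^-1).
Local Notation Lq k := (ln (q k)^-1).
Local Notation nm k := ((n k)%:R * (m k)%:R : R).
Local Notation T k delta := (threshold (N k) (M k) (n k) (m k) delta).
Local Notation lin k := ((Num.sqrt (N k * M k)%:R)^-1 : R).
Local Notation nrm k := ((Num.sqrt (n k * m k)%:R)^-1 : R).
Local Notation psi k delta h := (@psistar R (N k) (M k) (n k) (m k) delta h).

Hypothesis p0 : (fun k => p k) @ \oo --> (0 : R).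
Hypothesis q0 : (fun k => q k) @ \oo --> (0 : R).
Hypothesis small : (fun k => Lp k / (m k)%:R + Lq k / (n k)%:R) @ \oo --> (0 : R).

Let regime := near_regime nN mM noo moo p0 q0 small.

Lemma near_regime1 (K e : R) : 0 < e -> \forall k \near \oo,
  [/\ (0 < n k)%N, (0 < m k)%N, K <= (n k)%:R, K <= (m k)%:R &
   [/\ 1 <= Lp k, 1 <= Lq k & Lp k / (m k)%:R + Lq k / (n k)%:R <= e]].
Proof.
move=> e0; apply: filterS (regime (Num.max 1 K) e0) => k [a b c e1 [f g h]].
by move: c e1 f g; rewrite !ge_max => /andP[_ c] /andP[_ e1] /andP[f _] /andP[g _].
Qed.

Lemma type1_psistar_near delta (H : nat -> R) : 0 < delta ->
  \forall k \near \oo, (type1 E t0 (psi k delta (H k)) <=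
    (expR (- (H k - 1)) + expR (- (delta / 4 * (n k)%:R)))%:E)%E.
Proof.
move=> d0.
have [e1 e10 q1] := cumulant_quad Theta_t0 sigma_gt0 BC ltr01.
(* In the Gaussian case the union bound has exponent [- delta / 2 * lnG]; this [eta] gives up half
   of it to the error in [phi]. *)
pose eta := delta / (2 * (2 + delta)).
have eta0 : 0 < eta by rewrite divr_gt0// mulr_gt0//; lra.
have [e2 e20 q2] := cumulant_quad Theta_t0 sigma_gt0 BC eta0.
have d2 : 0 < (2 + delta) * 2 by lra.
have e3 : 0 < e2 ^+ 2 / ((2 + delta) * 2) by rewrite divr_gt0 ?exprn_gt0.
near=> k.
have [n0 m0 nK mK [Lp1 Lq1 sm]] : [/\ (0 < n k)%N, (0 < m k)%N,
    (e1 ^+ 2)^-1 <= (n k)%:R, (e1 ^+ 2)^-1 <= (m k)%:R &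
   [/\ 1 <= Lp k, 1 <= Lq k &
     Lp k / (m k)%:R + Lq k / (n k)%:R <= e2 ^+ 2 / ((2 + delta) * 2)]].
  by near: k; exact: near_regime1.
have N0 : (0 < N k)%N := leq_trans n0 (nN k).
have M0 : (0 < M k)%N := leq_trans m0 (mM k).
have /andP[l0 le] : 0 <= lin k <= e1.
  apply: (inv_sqrt_natr_le (n := n k)) => //.
  by rewrite (leq_trans (nN k))// leq_pmulr.
have /andP[T0 Te] : 0 <= T k delta * nrm k <= e2.
  apply: threshold_le => //; first exact: ltW.
  by rewrite mulrC -ler_pdivlMr.
have [|ls /andP[_ lq]] := q1 (lin k); first by rewrite ger0_norm.
have [|ts /andP[_ tq]] := q2 (T k delta * nrm k); first by rewrite ger0_norm.
apply: le_trans (type1_psistar_le Theta_t0 sigma_gt0 BC (H k) ls lq ts tq) _.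
have NM0 : (N k * M k)%:R != 0 :> R by rewrite pnatr_eq0 -lt0n muln_gt0 N0.
have nm0 : (n k * m k)%:R != 0 :> R by rewrite pnatr_eq0 -lt0n muln_gt0 n0.
rewrite lee_fin lerD// ?ler_expR.
  rewrite sqr_sqrtV ?ler0n// (_ : _ - H k = - (H k - 1))//.
  by field; rewrite !pnatr_eq0 -!lt0n M0 N0.
rewrite -[X in X * _](lnK (x := 'C(N k, n k)%:R * 'C(M k, m k)%:R)); last first.
  by rewrite posrE -natrM ltr0n muln_gt0 !bin_gt0 nN mM.
rewrite -expRD ler_expR exprMn sqr_sqrtV ?ler0n// sqr_threshold ?(ltW d0)//.
have /andP[lo _] := lnG_rate R n0 m0 (nN k) (mM k).
rewrite -natrM; set G := ln ('C(N k, n k) * 'C(M k, m k))%:R in lo *.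
have h := rate_ge Lp1 Lq1.
have m0R : 0 <= (m k)%:R :> R by [].
have -> : G + ((n k * m k)%:R * ((1 + eta) * ((2 + delta) * G / (n k * m k)%:R / 2))
    - (2 + delta) * G) = - (delta / 4 * G).
  by rewrite /eta; field; rewrite !pnatr_eq0 -!lt0n m0 n0/= gt_eqF//; lra.
rewrite lerN2 ler_pM2l ?divr_gt0//; lra.
Unshelve. all: by end_near. Qed.

Lemma tlin_scale k : (0 < n k)%N -> (0 < m k)%N ->
  Num.sqrt (nm k * p k * q k) = (n k * m k)%:R * lin k.
Proof.
move=> n0 m0; have N0 := leq_trans n0 (nN k); have M0 := leq_trans m0 (mM k).
have -> : nm k * p k * q k = (n k * m k)%:R ^+ 2 * (N k * M k)%:R^-1.
  by rewrite !natrM; field; rewrite !pnatr_eq0 -!lt0n N0 M0.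
by rewrite sqrtrM ?sqr_ge0// sqrtr_sqr ger0_norm// sqrtrV.
Qed.

(** The constant 2 is made of two quadratic terms: [N M * lin^2 = 1] from the null moments and at
    most [n m * lin^2 <= 1] from [cumulant_slope] on the rectangle. *)
Lemma type2_psistar_lin_near (a H : nat -> R) delta :
  exists2 eps, 0 < eps & \forall k \near \oo, 0 < a k -> a k <= eps ->
    derivable A (s0 + a k) 1 ->
    (type2 E t0 (n k) (m k) (a k) (psi k delta (H k)) <=
     (expR (H k - derive1 A (s0 + a k) * Num.sqrt (nm k * p k * q k) + 2))%:E)%E.
Proof.
have [e1 e10 q1] := cumulant_quad Theta_t0 sigma_gt0 BC ltr01.
have [e2 e20 sl] := cumulant_slope Theta_t0 sigma_gt0 BC.
pose e3 := Num.min (e1 / 2) e2.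
have e30 : 0 < e3 by rewrite lt_min e20 divr_gt0.
exists e3 => //; near=> k => a0; rewrite le_min => /andP[ae1 ae2] dA.
have [n0 m0 nK mK [Lp1 Lq1 sm]] : [/\ (0 < n k)%N, (0 < m k)%N,
    (e3 ^+ 2)^-1 <= (n k)%:R, (e3 ^+ 2)^-1 <= (m k)%:R &
   [/\ 1 <= Lp k, 1 <= Lq k & Lp k / (m k)%:R + Lq k / (n k)%:R <= 1]].
  by near: k; exact: near_regime1.
have N0 : (0 < N k)%N := leq_trans n0 (nN k).
have M0 : (0 < M k)%N := leq_trans m0 (mM k).
have /andP[l0] : 0 <= lin k <= e3.
  apply: (inv_sqrt_natr_le (n := n k)) => //.
  by rewrite (leq_trans (nN k))// leq_pmulr.
rewrite le_min => /andP[le1 le2].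
have l0' : 0 < lin k by rewrite invr_gt0 sqrtr_gt0 ltr0n muln_gt0 N0.
have [|ls /andP[_ lq]] := q1 (- lin k); first by rewrite normrN ger0_norm//; lra.
have [|sa _] := q1 (a k); first by rewrite ger0_norm ?ltW//; lra.
have [|sal _] := q1 (a k - lin k); first by rewrite ler_norml; apply/andP; split; lra.
have b1 := sl (a k) (lin k); rewrite (ltW a0) ae2 l0 le2 in b1.
have {}b1 := b1 isT isT dA.
have l2 : lin k ^+ 2 = (N k * M k)%:R^-1 by rewrite sqr_sqrtV.
have b00 : 0 <= (1 + 1) * ((- lin k) ^+ 2 / 2) by rewrite mulr_ge0// divr_ge0// sqr_ge0.
have hb s : sset s -> a k <= s - s0 ->
    (\int[ylaw E t0 s]_y (expR (- lin k * y))%:E <=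
     (expR (- lin k * derive1 A (s0 + a k) + lin k ^+ 2))%:E)%E.
  move=> ss as0; apply: (le_trans (ylaw_expRN_le Theta_t0 sigma_gt0 BC ss sa sal as0 l0')).
  by rewrite lee_fin ler_expR.
have := type2_psistar_le_lin (n k) (m k) Theta_t0 sigma_gt0 BC delta (H k) ls lq b00 hb.
move=> /le_trans; apply.
rewrite lee_fin ler_expR (tlin_scale n0 m0) sqrrN l2.
have NM0 : (N k * M k)%:R != 0 :> R by rewrite pnatr_eq0 -lt0n muln_gt0 N0.
have -> : (N k * M k)%:R * ((1 + 1) * ((N k * M k)%:R^-1 / 2)) = 1 :> R.
  by field; rewrite !pnatr_eq0 -!lt0n M0 N0.
have : (n k * m k)%:R * (N k * M k)%:R^-1 <= 1 :> R.
  by rewrite ler_pdivrMr ?mul1r ?ler_nat ?leq_mul// ltr0n muln_gt0 N0.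
by set D := derive1 A _; lra.
Unshelve. all: by end_near. Qed.

(** Tilt 1 on the normalised sum suffices because its distance to the threshold will diverge; the
    constant 1 is [n m * nrm^2]. *)
Lemma type2_psistar_max_near (a H : nat -> R) delta :
  exists2 eps, 0 < eps & \forall k \near \oo, 0 < a k -> a k <= eps ->
    derivable A (s0 + a k) 1 ->
    (type2 E t0 (n k) (m k) (a k) (psi k delta (H k)) <=
     (expR (T k delta - derive1 A (s0 + a k) * Num.sqrt (nm k) + 1))%:E)%E.
Proof.
have [e1 e10 q1] := cumulant_quad Theta_t0 sigma_gt0 BC ltr01.
have [e2 e20 sl] := cumulant_slope Theta_t0 sigma_gt0 BC.
pose e3 := Num.min (e1 / 2) e2.
have e30 : 0 < e3 by rewrite lt_min e20 divr_gt0.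
exists e3 => //; near=> k => a0; rewrite le_min => /andP[ae1 ae2] dA.
have [n0 m0 nK mK [Lp1 Lq1 sm]] : [/\ (0 < n k)%N, (0 < m k)%N,
    (e3 ^+ 2)^-1 <= (n k)%:R, (e3 ^+ 2)^-1 <= (m k)%:R &
   [/\ 1 <= Lp k, 1 <= Lq k & Lp k / (m k)%:R + Lq k / (n k)%:R <= 1]].
  by near: k; exact: near_regime1.
have /andP[l0] : 0 <= nrm k <= e3.
  by apply: (inv_sqrt_natr_le (n := n k)) => //; rewrite leq_pmulr.
rewrite le_min => /andP[le1 le2].
have nm_gt0 : 0 < (n k * m k)%:R :> R by rewrite ltr0n muln_gt0 n0.
have l0' : 0 < nrm k by rewrite invr_gt0 sqrtr_gt0.
have [|sa _] := q1 (a k); first by rewrite ger0_norm ?ltW//; lra.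
have [|sal _] := q1 (a k - nrm k); first by rewrite ler_norml; apply/andP; split; lra.
have b1 := sl (a k) (nrm k); rewrite (ltW a0) ae2 l0 le2 in b1.
have {}b1 := b1 isT isT dA.
have hb s : sset s -> a k <= s - s0 ->
    (\int[ylaw E t0 s]_y (expR (- (1 * nrm k) * y))%:E <=
     (expR (- nrm k * derive1 A (s0 + a k) + nrm k ^+ 2))%:E)%E.
  move=> ss as0; rewrite mul1r.
  apply: (le_trans (ylaw_expRN_le Theta_t0 sigma_gt0 BC ss sa sal as0 l0')).
  by rewrite lee_fin ler_expR.
have := type2_psistar_le_max (N k) (M k) delta (H k) ler01 hb.
move=> /le_trans; apply.
rewrite lee_fin ler_expR mul1r sqr_sqrtV ?ler0n// -natrM.
have e : (n k * m k)%:R * nrm k = Num.sqrt (n k * m k)%:R :> R.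
  by rewrite -{1}[(n k * m k)%:R]sqr_sqrtr ?ler0n// expr2 mulfK// gt_eqF// sqrtr_gt0.
by set D := derive1 A _; rewrite mulrDr mulNr mulrN mulrA e divff ?gt_eqF//; lra.
Unshelve. all: by end_near. Qed.

(** For [a] bounded away from 0 the threshold is negligible with respect to [sqrt (n m)], so the
    scan part detects under either condition. Choosing [v = l = e] in [ylaw_expRN_le] leaves only
    [phi e], and no derivative of [A] far from [s0]. *)
Lemma type2_psistar_far_near (a H : nat -> R) delta eps : 0 <= delta -> 0 < eps ->
  exists2 c, 0 < c & \forall k \near \oo, eps <= a k ->
    (type2 E t0 (n k) (m k) (a k) (psi k delta (H k)) <= (expR (- (c * (n k)%:R)))%:E)%E.
Proof.
move=> d0 eps0.
have h2 : 0 < 1 / 2 :> R by lra.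
have [e1 e10 q1] := cumulant_quad Theta_t0 sigma_gt0 BC h2.
pose e := Num.min e1 eps.
have e0 : 0 < e by rewrite lt_min e10.
have ee1 : e <= e1 by rewrite ge_min lexx.
have eeps : e <= eps by rewrite ge_min lexx orbT.
(* Per entry, [phi e] gains at least [e^2 / 4], while the threshold, kept below [e / 8] per entry,
   costs at most [e^2 / 8]. *)
exists (e ^+ 2 / 8); first by rewrite divr_gt0 ?exprn_gt0.
have d2 : 0 < (2 + delta) * 2 by lra.
have e3 : 0 < (e / 8) ^+ 2 / ((2 + delta) * 2) by rewrite divr_gt0 ?exprn_gt0 ?divr_gt0.
have e80 : 0 < e / 8 by rewrite divr_gt0.
near=> k => ak.
have [n0 m0 nK mK [Lp1 Lq1 sm]] : [/\ (0 < n k)%N, (0 < m k)%N,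
    0 <= (n k)%:R :> R, 0 <= (m k)%:R :> R &
   [/\ 1 <= Lp k, 1 <= Lq k &
     Lp k / (m k)%:R + Lq k / (n k)%:R <= (e / 8) ^+ 2 / ((2 + delta) * 2)]].
  by near: k; exact: near_regime1.
have /andP[T0 Te] : 0 <= T k delta * nrm k <= e / 8.
  by apply: threshold_le => //; rewrite mulrC -ler_pdivlMr.
have nm_gt0 : 0 < (n k * m k)%:R :> R by rewrite ltr0n muln_gt0 n0.
have [|se /andP[qe _]] := q1 e; first by rewrite gtr0_norm.
set S := Num.sqrt (n k * m k)%:R : R in Te *.
have S0 : 0 < S by rewrite sqrtr_gt0.
have SS : S ^+ 2 = (n k * m k)%:R by rewrite sqr_sqrtr// ltW.
have eS : 0 <= e * S by rewrite mulr_ge0// ltW.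
have hb s : sset s -> a k <= s - s0 ->
    (\int[ylaw E t0 s]_y (expR (- (e * S / S) * y))%:E <= (expR (- phi e))%:E)%E.
  move=> ss as0; rewrite mulfK ?gt_eqF//.
  have s00 : sset (s0 + (e - e)) by rewrite subrr addr0; exact: s0_sset.
  have es : e <= s - s0 by lra.
  apply: (le_trans (ylaw_expRN_le Theta_t0 sigma_gt0 BC ss se s00 es e0)).
  by rewrite subrr cumulant0 sub0r.
have := type2_psistar_le_max (N k) (M k) delta (H k) eS hb.
move=> /le_trans; apply.
rewrite lee_fin ler_expR -SS.
have TS : T k delta <= e / 8 * S by rewrite -ler_pdivrMr.
have : e * S * T k delta <= e * S * (e / 8 * S) by rewrite ler_wpM2l// mulr_ge0// ltW.
have : S ^+ 2 * (e ^+ 2 / 4) <= S ^+ 2 * phi e by rewrite ler_wpM2l ?sqr_ge0//; lra.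
have : e ^+ 2 / 8 * (n k)%:R <= e ^+ 2 / 8 * S ^+ 2.
  by rewrite ler_wpM2l ?divr_ge0 ?sqr_ge0// SS ler_nat leq_pmulr.
by lra.
Unshelve. all: by end_near. Qed.

End upper_asymptotics.

Section upper_bound_theorem.
Context d (X : measurableType d) (R : realType) (E : expFamily X R) (t0 : R)
  (B : R -> R) (N M n m : nat -> nat).
Hypothesis Theta_t0 : interior (ef_Theta E) t0.
Hypothesis sigma_gt0 : 0 < sigma0 E t0.
Hypothesis BC : forall t, ef_Theta E t -> B (ef_eta E t) = ef_C E t.
Hypothesis nN : forall k, (n k <= N k)%N.
Hypothesis mM : forall k, (m k <= M k)%N.
Hypothesis noo : n @ \oo --> \oo.
Hypothesis moo : m @ \oo --> \oo.

Local Notation s0 := (s0 E t0).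
Local Notation sset := (sset E t0).
Local Notation A := (Afun E t0 B).
Local Notation p k := ((n k)%:R / (N k)%:R : R).
Local Notation q k := ((m k)%:R / (M k)%:R : R).
Local Notation Lp k := (ln (p k)^-1).
Local Notation Lq k := (ln (q k)^-1).
Local Notation nm k := ((n k)%:R * (m k)%:R : R).
Local Notation rate k := ((n k)%:R * Lp k + (m k)%:R * Lq k : R).
Local Notation T k delta := (threshold (N k) (M k) (n k) (m k) delta).
Local Notation psi k delta h := (@psistar R (N k) (M k) (n k) (m k) delta h).

Hypothesis p0 : (fun k => p k) @ \oo --> (0 : R).
Hypothesis q0 : (fun k => q k) @ \oo --> (0 : R).
Hypothesis small : (fun k => Lp k / (m k)%:R + Lq k / (n k)%:R) @ \oo --> (0 : R).

Variable a : nat -> R.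
Hypothesis a0 : forall k, 0 < a k.
Hypothesis a_sset : \forall k \near \oo, sset (s0 + a k) /\ derivable A (s0 + a k) 1.

Lemma risk_psistar_cvg0 delta (H w : nat -> R) : 0 < delta -> H @ \oo --> +oo%R ->
  w @ \oo --> (0 : R) ->
  (\forall k \near \oo, (type2 E t0 (n k) (m k) (a k) (psi k delta (H k)) <= (w k)%:E)%E) ->
  (fun k => risk E t0 (n k) (m k) (a k) (psi k delta (H k))) @ \oo --> (0%:E : \bar R).
Proof.
move=> d0 Hoo w0 tw.
pose v k := expR (- (H k - 1)) + expR (- (delta / 4 * (n k)%:R)) + w k.
have v0 : v @ \oo --> (0 : R).
  have -> : (0 : R) = 0 + 0 + 0 by rewrite !addr0.
  apply: cvgD => //; apply: cvgD.
    apply: cvg_expRN; apply/cvgryPge => K.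
    move/cvgryPge : Hoo => /(_ (K + 1)); apply: filterS => k; lra.
  by apply: cvg_expRN; apply: cvg_mul_natr_pinfty => //; rewrite divr_gt0.
apply: (@squeeze_cvge _ _ _ _ (cst 0%E) _ (fun k => (v k)%:E)).
- near=> k.
  have [sa _] : sset (s0 + a k) /\ derivable A (s0 + a k) 1 by near: k.
  have t1 : (type1 E t0 (psi k delta (H k)) <=
    (expR (- (H k - 1)) + expR (- (delta / 4 * (n k)%:R)))%:E)%E.
    by near: k; exact: (type1_psistar_near Theta_t0 sigma_gt0 BC nN mM noo moo p0 q0 small).
  have t2 : (type2 E t0 (n k) (m k) (a k) (psi k delta (H k)) <= (w k)%:E)%E by near: k.
  apply/andP; split; last by rewrite /risk /v EFinD leeD.
  rewrite adde_ge0//.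
    by apply: expectation_ge0 => y; case/andP: (psistar_bound (n k) (m k) delta (H k) y).
  have [S aS] := alternatives_nonempty Theta_t0 (nN k) (mM k) sa.
  by apply: (type2_ge0 aS) => y; case/andP: (psistar_bound (n k) (m k) delta (H k) y).
- exact: cvg_cst.
- by apply: cvg_EFin; [exact: nearW|exact: v0].
Unshelve. all: by end_near. Qed.

(** Once [Lp] and [Lq] exceed [2 / kap], the correction [n + m] of [lnG_rate] is at most
    [kap / 2 * rate], and [(2 + kap)(1 + kap / 2) = 2 (1 + kap / 2)^2]. *)
Lemma threshold_near kap : 0 < kap -> \forall k \near \oo, forall delta, 0 <= delta <= kap ->
  T k delta <= (1 + kap / 2) * Num.sqrt (2 * rate k).
Proof.
move=> kap0; near=> k => delta /andP[d0 dk].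
have [n0 m0 _ _ [Lp1 Lq1 sm]] : [/\ (0 < n k)%N, (0 < m k)%N,
    Num.max 1 (2 / kap) <= (n k)%:R :> R, Num.max 1 (2 / kap) <= (m k)%:R :> R &
   [/\ Num.max 1 (2 / kap) <= Lp k, Num.max 1 (2 / kap) <= Lq k &
     Lp k / (m k)%:R + Lq k / (n k)%:R <= 1]].
  by near: k; exact: (near_regime nN mM noo moo p0 q0 small).
move: Lp1 Lq1; rewrite !ge_max => /andP[Lp1 Lp2] /andP[Lq1 Lq2].
have kk : 0 < 2 / kap by rewrite divr_gt0.
have /andP[_ hi] := lnG_rate R n0 m0 (nN k) (mM k).
have h1 := rate_ge Lp1 Lq1.
have rate0 : 0 <= rate k by rewrite (le_trans _ h1)// addr_ge0.
have rk : ((n k)%:R + (m k)%:R) * (2 / kap) <= rate k.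
  by rewrite mulrDl lerD// ler_wpM2l.
apply: ler_of_sqr; first by rewrite mulr_ge0 ?sqrtr_ge0//; lra.
rewrite sqr_threshold// exprMn sqr_sqrtr ?mulr_ge0//.
apply: (@le_trans _ _ ((2 + kap) * ((1 + kap / 2) * rate k))); last first.
  by rewrite le_eqVlt; apply/orP; left; apply/eqP; field.
apply: ler_pM; [lra| |lra|].
  rewrite (le_trans rate0)//; by case/andP: (lnG_rate R n0 m0 (nN k) (mM k)).
apply: (le_trans hi); rewrite mulrDl mul1r lerD2l.
by move: rk; rewrite mulrA ler_pdivrMr// => rk; lra.
Unshelve. all: by end_near. Qed.

Lemma upper_bound_cvg :
  let condI := (fun k => derive1 A (s0 + a k) * Num.sqrt (nm k * p k * q k)) @ \oo --> +oo%R in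
  let condII := (1%:E < limn_einf (fun k => (derive1 A (s0 + a k) * Num.sqrt (nm k) /
                                Num.sqrt (2 * rate k))%:E))%E in
  condI \/ condII ->
  exists2 delta0 : R, 0 < delta0 &
    forall delta : R, 0 < delta <= delta0 ->
    forall H : nat -> R, H @ \oo --> +oo%R ->
    (condI -> exists2 c : R, 0 < c < 1 &
       \forall k \near \oo,
         H k <= c * (derive1 A (s0 + a k) * Num.sqrt (nm k * p k * q k))) ->
    (fun k => risk E t0 (n k) (m k) (a k) (psi k delta (H k))) @ \oo --> (0%:E : \bar R).
Proof.
move=> condI condII [cI|cII].
  (* Small [a] is detected by the linear part and large [a] by [type2_psistar_far_near], so any
     bound on [delta] will do. *)
  exists 1 => // delta /andP[d0 _] H Hoo /(_ cI)[c /andP[c0 c1] Hc].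
  have [eps eps0 near1] :=
    type2_psistar_lin_near Theta_t0 sigma_gt0 BC nN mM noo moo p0 q0 small a H delta.
  have [c' c1_gt0 near2] := type2_psistar_far_near
    Theta_t0 sigma_gt0 BC nN mM noo moo p0 q0 small a H (ltW d0) eps0.
  pose D k := derive1 A (s0 + a k) * Num.sqrt (nm k * p k * q k).
  apply: (@risk_psistar_cvg0 delta H
    (fun k => expR (- ((1 - c) * D k - 2)) + expR (- (c' * (n k)%:R)))) => //.
    rewrite -[0 in X in _ --> X]addr0; apply: cvgD.
      apply: cvg_expRN; apply/cvgryPge => K.
      move/cvgryPge : cI => /(_ ((1 - c)^-1 * (K + 2))); apply: filterS => k.
      rewrite ler_pdivrMl ?subr_gt0// -/(D k); lra.
    by apply: cvg_expRN; exact: cvg_mul_natr_pinfty.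
  near=> k.
  have [sa dA] : sset (s0 + a k) /\ derivable A (s0 + a k) 1 by near: k.
  have [ak|ak] := leP (a k) eps.
    have h : (type2 E t0 (n k) (m k) (a k) (psi k delta (H k)) <=
      (expR (H k - derive1 A (s0 + a k) * Num.sqrt (nm k * p k * q k) + 2))%:E)%E.
      by move: (a0 k) ak dA; near: k.
    apply: (le_trans h); rewrite lee_fin ler_wpDr ?expR_ge0// ler_expR.
    have : H k <= c * D k by near: k.
    by rewrite -/(D k); lra.
  have h : (type2 E t0 (n k) (m k) (a k) (psi k delta (H k)) <=
    (expR (- (c' * (n k)%:R)))%:E)%E.
    by move: (ltW ak); near: k.
  by apply: (le_trans h); rewrite lee_fin ler_wpDl ?expR_ge0.
have [y y1 near3] := near_limn_einf_gt cII.
(* The threshold uses at most [1 + kap / 2] of the available [1 + kap]; the gap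
   [kap / 2 * sqrt (2 * rate)] diverges at least like [sqrt n]. *)
pose kap := y - 1; have kap0 : 0 < kap by rewrite subr_gt0.
exists kap => // delta /andP[d0 dk] H Hoo _.
have [eps eps0 near1] :=
  type2_psistar_max_near Theta_t0 sigma_gt0 BC nN mM noo moo p0 q0 small a H delta.
have [c' c1_gt0 near2] := type2_psistar_far_near
  Theta_t0 sigma_gt0 BC nN mM noo moo p0 q0 small a H (ltW d0) eps0.
apply: (@risk_psistar_cvg0 delta H
  (fun k => expR (- (kap / 2 * Num.sqrt (n k)%:R - 1)) + expR (- (c' * (n k)%:R)))) => //.
  rewrite -[0 in X in _ --> X]addr0; apply: cvgD.
    apply: cvg_expRN; apply/cvgryPge => K.
    have k20 : 0 < kap / 2 by rewrite divr_gt0.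
    move/cvgryPge : (cvg_mul_sqrt_natr_pinfty k20 noo) => /(_ (K + 1)).
    by apply: filterS => k; lra.
  by apply: cvg_expRN; exact: cvg_mul_natr_pinfty.
near=> k.
have [sa dA] : sset (s0 + a k) /\ derivable A (s0 + a k) 1 by near: k.
have [ak|ak] := leP (a k) eps; last first.
  have h : (type2 E t0 (n k) (m k) (a k) (psi k delta (H k)) <=
    (expR (- (c' * (n k)%:R)))%:E)%E.
    by move: (ltW ak); near: k.
  by apply: (le_trans h); rewrite lee_fin ler_wpDl ?expR_ge0.
have h : (type2 E t0 (n k) (m k) (a k) (psi k delta (H k)) <=
  (expR (T k delta - derive1 A (s0 + a k) * Num.sqrt (nm k) + 1))%:E)%E.
  by move: (a0 k) ak dA; near: k.
apply: (le_trans h); rewrite lee_fin ler_wpDr ?expR_ge0// ler_expR.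
have [n0 m0 _ _ [Lp1 Lq1 sm]] : [/\ (0 < n k)%N, (0 < m k)%N,
    1 <= (n k)%:R :> R, 1 <= (m k)%:R :> R &
   [/\ 1 <= Lp k, 1 <= Lq k & Lp k / (m k)%:R + Lq k / (n k)%:R <= 1]].
  by near: k; exact: (near_regime nN mM noo moo p0 q0 small).
have h1 := rate_ge Lp1 Lq1.
have Tk : T k delta <= (1 + kap / 2) * Num.sqrt (2 * rate k).
  have thr : forall e, 0 <= e <= kap -> T k e <= (1 + kap / 2) * Num.sqrt (2 * rate k).
    by near: k; exact: threshold_near.
  by apply: thr; rewrite (ltW d0).
have yk : y <= derive1 A (s0 + a k) * Num.sqrt (nm k) / Num.sqrt (2 * rate k) by near: k.
set D := derive1 A _ * _ in yk *.
have n1 : 0 < (n k)%:R :> R by rewrite ltr0n.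
have m1 : 0 < (m k)%:R :> R by rewrite ltr0n.
have r0 : 0 < 2 * rate k by lra.
have sr : Num.sqrt (n k)%:R <= Num.sqrt (2 * rate k) :> R.
  by rewrite ler_sqrt ?ltW//; lra.
have sq0 : 0 < Num.sqrt (2 * rate k) by rewrite sqrtr_gt0.
move: yk; rewrite ler_pdivlMr// (_ : y = 1 + kap); last by rewrite /kap; ring.
move=> yk.
have : kap / 2 * Num.sqrt (n k)%:R <= kap / 2 * Num.sqrt (2 * rate k).
  by rewrite ler_wpM2l// divr_ge0// ltW.
lra.
Unshelve. all: by end_near. Qed.

End upper_bound_theorem.

(** * Second moment of the truncated likelihood ratio *)

Section overlap.
Context (R : realType).
Implicit Types y : R.

Lemma sum_subset_exp (I : finType) (S : {set I}) y :
  \sum_(J : {set I} | J \subset S) y ^+ #|J| = (1 + y) ^+ #|S|.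
Proof.
transitivity (\prod_i ((if i \in S then y else 0) + 1 : R)); last first.
  rewrite -prodr_const [RHS]big_mkcond/=; apply: eq_bigr => i _.
  by case: ifP => _; rewrite ?add0r// addrC.
rewrite bigA_distr big_mkcond/=; apply: eq_bigr => J _.
have [JS|/subsetPn[i iJ iS]] := boolP (J \subset S).
  rewrite -prodr_const big_mkcond/=; apply: eq_bigr => i _.
  by case: ifP => // /(fintype.subsetP JS) ->.
by rewrite (bigD1 i)//= iJ (negbTE iS) mul0r.
Qed.

Lemma card_superset_draws (N n : nat) (J : {set 'I_N}) : (n <= N)%N -> (#|J| <= n)%N ->
  #|[set A : {set 'I_N} | (#|A| == n) && (J \subset A)]%SET| = 'C(N - #|J|, n - #|J|).
Proof.
move=> nN Jn.
have JC : #|~: J| = (N - #|J|)%N by rewrite cardsCs finset.setCK card_ord.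
rewrite -bin_sub; last by rewrite leq_sub2r.
have -> : (N - #|J| - (n - #|J|) = N - n)%N by rewrite subnBA// subnK// (leq_trans Jn).
rewrite -JC -cards_draws -(card_imset _ (can_inj (@finset.setCK _))).
apply: eq_card => A; rewrite inE; apply/imsetP/andP => [[A' + ->]|[AJ An]].
  by rewrite inE => /andP[/eqP A'n JA']; rewrite finset.setCS JA' cardsCs finset.setCK card_ord A'n.
exists (~: A); last by rewrite finset.setCK.
rewrite inE -[J]finset.setCK finset.setCS AJ andbT cardsCs finset.setCK card_ord (eqP An).
by rewrite subKn.
Qed.

(** The hypergeometric overlap is dominated by a binomial one: [(1 + y) ^ #|A :&: A'|] is expanded
    over the common subsets [J], and by [bin_sub_le] each [J] lies in a random [A'] with probability
    at most [p ^ #|J|]. *)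
Lemma overlap_exp_le (N n : nat) (A : {set 'I_N}) y : (0 < n)%N -> (n <= N)%N -> #|A| = n ->
  0 <= y ->
  \sum_(A' : {set 'I_N} | #|A'| == n) (1 + y) ^+ #|A :&: A'| <=
  'C(N, n)%:R * expR (n%:R * (n%:R / N%:R) * y).
Proof.
move=> n0 nN An y0; have N0 : (0 < N)%N := leq_trans n0 nN.
under eq_bigr do rewrite -sum_subset_exp.
rewrite (exchange_big_dep (fun J : {set 'I_N} => J \subset A))/=; last first.
  by move=> A' J _; rewrite finset.subsetI => /andP[].
apply: (@le_trans _ _ (\sum_(J : {set 'I_N} | J \subset A)
    'C(N, n)%:R * (n%:R / N%:R * y) ^+ #|J|)).
  apply: ler_sum => J JA.
  have Jn : (#|J| <= n)%N by rewrite -An subset_leq_card.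
  rewrite (eq_bigl (fun A' : {set 'I_N} =>
    A' \in [set A' : {set 'I_N} | (#|A'| == n) && (J \subset A')]%SET)); last first.
    by move=> A'; rewrite inE finset.subsetI JA.
  rewrite sumr_const card_superset_draws// exprMn -[_ *+ _]mulr_natl mulrA.
  rewrite ler_wpM2r ?exprn_ge0// expr_div_n mulrA ler_pdivlMr ?exprn_gt0 ?ltr0n//.
  by rewrite -!natrX -!natrM ler_nat bin_sub_le// Jn.
rewrite -mulr_sumr sum_subset_exp An ler_wpM2l//.
rewrite -[in leRHS]mulrA expRM_natl lerXn2r ?nnegrE ?expR_ge0//.
  by rewrite addr_ge0// mulr_ge0// divr_ge0.
exact: expR_ge1Dx.
Qed.

Lemma overlap_mgf_le (N n : nat) (A : {set 'I_N}) (th : R) : (0 < n)%N -> (n <= N)%N ->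
  #|A| = n -> 0 <= th ->
  \sum_(A' : {set 'I_N} | #|A'| == n) expR (th * #|A :&: A'|%:R) <=
  'C(N, n)%:R * expR (n%:R * (n%:R / N%:R) * (expR th - 1)).
Proof.
move=> n0 nN An th0.
have y0 : 0 <= expR th - 1 by rewrite subr_ge0 -expR0 ler_expR.
apply: le_trans (overlap_exp_le n0 nN An y0); apply: ler_sum => A' _.
by rewrite expRM_natr addrC subrK.
Qed.

End overlap.

(** * The likelihood ratio of one rectangle and its truncation *)

Section truncated_likelihood.
Context d (X : measurableType d) (R : realType) (E : expFamily X R) (t0 : R)
  (B : R -> R) (N M n m : nat) (a : R) (big : nat -> nat -> bool) (tau : nat -> nat -> R).
Hypothesis Theta_t0 : interior (ef_Theta E) t0.
Hypothesis sigma_gt0 : 0 < sigma0 E t0.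
Hypothesis BC : forall t, ef_Theta E t -> B (ef_eta E t) = ef_C E t.

Local Notation s0 := (s0 E t0).
Local Notation sset := (sset E t0).
Local Notation phi := (cumulant E t0 B).
Local Notation obs := (N.-tuple (M.-tuple R)).
Local Notation rect := ({set 'I_N} * {set 'I_M})%type.
Local Notation model := (@model _ X R E t0 N M).
Local Notation P0 := (model (const_mx s0)).

Definition alt (C : rect) : 'M[R]_(N, M) :=
  \matrix_(i, j) (if in_rect C i j then s0 + a else s0).

(** The density of [model (alt C)] with respect to the null when [C] is an [n x m] rectangle, see
    [integral_alt]. *)
Definition lik (C : rect) (y : obs) : R := expR (a * rsum C y - (n * m)%:R * phi a).

Definition trunc (V : rect) (y : obs) : R := (rsum V y <= tau #|V.1| #|V.2|)%R%:R.

Definition subrect (C V : rect) : bool :=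
  [&& V.1 \subset C.1, V.2 \subset C.2 & big #|V.1| #|V.2|].

Definition good (C : rect) (y : obs) : R := \prod_(V | subrect C V) trunc V y.

Lemma measurable_lik C : measurable_fun [set: obs] (lik C).
Proof.
apply: measurableT_comp => //; apply: measurable_funB => //.
by apply: measurable_funM => //; exact: measurable_rsum.
Qed.

Lemma lik_ge0 C y : 0 <= lik C y. Proof. exact: expR_ge0. Qed.

Lemma measurable_trunc V : measurable_fun [set: obs] (trunc V).
Proof.
rewrite (_ : trunc V = (fun y => if rsum V y <= tau #|V.1| #|V.2| then 1 else 0)); last first.
  by apply/funext => y; rewrite /trunc; case: ifP.
apply: measurable_fun_ifT => //; apply: measurable_fun_ler => //.
exact: measurable_rsum.
Qed.

Lemma measurable_good C : measurable_fun [set: obs] (good C).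
Proof.
rewrite (_ : good C = (fun y => \prod_V (if subrect C V then trunc V y else 1))).
  by apply: measurable_prod => V _; case: (subrect C V) => //; exact: measurable_trunc.
by apply/funext => y; rewrite /good big_mkcond.
Qed.

Lemma trunc_bound V y : 0 <= trunc V y <= 1.
Proof. by rewrite /trunc; case: (rsum V y <= _); rewrite /= ?lexx ?ler01. Qed.

Lemma good_bound C y : 0 <= good C y <= 1.
Proof.
apply/andP; split; first by apply: prodr_ge0 => V _; case/andP: (trunc_bound V y).
by apply: prodr_ile1 => V _; exact: trunc_bound.
Qed.

Lemma one_sub_good_le C y : 1 - good C y <= \sum_(V | subrect C V) (1 - trunc V y).
Proof.
suff : 0 <= good C y <= 1 /\ 1 - good C y <= \sum_(V | subrect C V) (1 - trunc V y) by case.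
rewrite /good; apply: (big_rec2 (fun g s : R => 0 <= g <= 1 /\ 1 - g <= s)) =>
  [|V g s CV [/andP[g0 g1] gs]].
  by rewrite ler01 lexx subrr.
have /andP[t0' t1] := trunc_bound V y.
split; first by rewrite mulr_ge0//= mulr_ile1.
by move: t0' t1 g0 g1 gs; move: (trunc V y) => t; nra.
Qed.

Lemma one_sub_trunc_le V (x : R) y : 0 <= x ->
  1 - trunc V y <= expR (x * (rsum V y - tau #|V.1| #|V.2|)).
Proof.
move=> x0; rewrite /trunc; case: (leP (rsum V y)) => [_|h]; first by rewrite subrr expR_ge0.
by rewrite subr0 -expR0 ler_expR mulr_ge0// subr_ge0 ltW.
Qed.

Lemma trunc_le V (z : R) y : 0 <= z ->
  trunc V y <= expR (z * (tau #|V.1| #|V.2| - rsum V y)).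
Proof.
move=> z0; rewrite /trunc; case: (leP (rsum V y)) => [h|_]; last exact: expR_ge0.
by rewrite -expR0 ler_expR mulr_ge0// subr_ge0.
Qed.

Lemma good_le C V y : subrect C V -> good C y <= trunc V y.
Proof.
move=> CV; rewrite /good (bigD1 V)//= ler_piMr//.
by apply: prodr_ile1 => W _; exact: trunc_bound.
Qed.

Lemma integral_alt (C : rect) (f : obs -> R) : rect_of_size n m C -> sset (s0 + a) ->
  measurable_fun [set: obs] f -> (forall y, 0 <= f y) ->
  (\int[model (alt C)]_y (f y)%:E = \int[P0]_y (f y * lik C y)%:E)%E.
Proof.
move=> /andP[/eqP C1 /eqP C2] sa mf f0.
have sC i j : sset (alt C i j) by rewrite mxE; case: ifP => // _; exact: s0_sset.
rewrite (model_density Theta_t0 sigma_gt0 BC sC); last 2 first.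
- exact/measurable_EFinP.
- by move=> y; rewrite lee_fin.
apply: eq_integral => y _; rewrite -EFinM; congr (_ * expR _)%:E.
have e i j : alt C i j - s0 = if in_rect C i j then a else 0.
  by rewrite mxE; case: ifP => _; rewrite ?subrr// addrC addKr.
rewrite /linstat; under eq_bigr do under eq_bigr do rewrite e.
rewrite -/(linstat _ y) linstat_rect; congr (_ - _).
under eq_bigr do under eq_bigr do rewrite e.
rewrite -C1 -C2 natrM -sum_in_rect_cst; apply: eq_bigr => i _; apply: eq_bigr => j _.
by case: ifP => // _; exact: cumulant0.
Qed.

Lemma integral_lik_expR (C V : rect) (x k : R) : rect_of_size n m C ->
  V.1 \subset C.1 -> V.2 \subset C.2 -> sset (s0 + a) -> sset (s0 + (a + x)) ->
  (\int[P0]_y (lik C y * expR (x * rsum V y + k))%:E =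
   (expR (#|V.1|%:R * #|V.2|%:R * (phi (a + x) - phi a) + k))%:E)%E.
Proof.
move=> /andP[/eqP C1 /eqP C2] V1 V2 sa sax.
pose c i j := (if in_rect C i j then a else 0) + (if in_rect V i j then x else 0).
have VC i j : in_rect V i j -> in_rect C i j.
  by move=> /andP[iV jV]; rewrite /in_rect (fintype.subsetP V1)// (fintype.subsetP V2).
transitivity (\int[P0]_y (expR (linstat c y + (k - (n * m)%:R * phi a)))%:E)%E.
  apply: eq_integral => y _; rewrite /lik -expRD /c linstatD !linstat_rect.
  by congr (expR _)%:E; ring.
rewrite (integral_null_expR Theta_t0 sigma_gt0 BC); last first.
  move=> i j; rewrite /c; case: (boolP (in_rect V i j)) => [/VC ->//|_].
  by case: ifP => _; rewrite addr0// addr0; exact: s0_sset.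
congr (expR _)%:E.
have -> : \sum_i \sum_j phi (c i j) = \sum_i \sum_j ((if in_rect C i j then phi a else 0) +
    (if in_rect V i j then phi (a + x) - phi a else 0)).
  apply: eq_bigr => i _; apply: eq_bigr => j _; rewrite /c.
  case: (boolP (in_rect V i j)) => [/VC ->|_]; first by rewrite [RHS]addrC subrK.
  by case: ifP => _; rewrite !addr0// cumulant0.
under eq_bigr do rewrite big_split/=.
rewrite big_split/= !sum_in_rect_cst C1 C2 natrM; ring.
Qed.

Definition capr (C C' : rect) : rect := (C.1 :&: C'.1, C.2 :&: C'.2)%SET.

(** Outside the intersection every entry is tilted by [a] or by 0 and is normalised to 1; only the
    common entries, tilted by [2 * a - z], contribute. *)
Lemma integral_lik2_expR (C C' : rect) (z k : R) :
  rect_of_size n m C -> rect_of_size n m C' ->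
  sset (s0 + a) -> sset (s0 + (2 * a - z)) ->
  (\int[P0]_y (lik C y * lik C' y * expR (k - z * rsum (capr C C') y))%:E =
   (expR (#|(capr C C').1|%:R * #|(capr C C').2|%:R * (phi (2 * a - z) - 2 * phi a) + k))%:E)%E.
Proof.
move=> /andP[/eqP C1 /eqP C2] /andP[/eqP C1' /eqP C2'] sa saz; set V := capr C C'.
pose c i j := (if in_rect C i j then a else 0) + (if in_rect C' i j then a else 0) +
  (if in_rect V i j then - z else 0).
have VC i j : in_rect V i j = in_rect C i j && in_rect C' i j.
  by rewrite /in_rect /V /= !inE andbACA.
transitivity (\int[P0]_y (expR (linstat c y + (k - 2 * ((n * m)%:R * phi a))))%:E)%E.
  apply: eq_integral => y _; rewrite /lik -!expRD /c linstatD linstatD !linstat_rect.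
  by congr (expR _)%:E; ring.
rewrite (integral_null_expR Theta_t0 sigma_gt0 BC); last first.
  move=> i j; rewrite /c VC; case: (in_rect C i j); case: (in_rect C' i j) => //=;
    rewrite ?addr0 ?add0r//; last exact: s0_sset.
  by rewrite (_ : a + a - z = 2 * a - z)//; ring.
congr (expR _)%:E.
have -> : \sum_i \sum_j phi (c i j) = \sum_i \sum_j ((if in_rect C i j then phi a else 0) +
    (if in_rect C' i j then phi a else 0) +
    (if in_rect V i j then phi (2 * a - z) - 2 * phi a else 0)).
  apply: eq_bigr => i _; apply: eq_bigr => j _; rewrite /c VC.
  case: (in_rect C i j); case: (in_rect C' i j) => //=; rewrite ?addr0 ?add0r//.
    by rewrite (_ : a + a - z = 2 * a - z); ring.
  by rewrite cumulant0.
under eq_bigr do rewrite big_split/= big_split/=.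
rewrite big_split/= big_split/= !sum_in_rect_cst C1 C2 C1' C2' natrM; ring.
Qed.

End truncated_likelihood.

(* Pointwise [f (1 - L) <= |1 - L| <= k + (1 - L)^2 / (4 k)], integrated with all terms moved to
   the side where they are nonnegative. *)
Lemma second_moment_bound d (T : measurableType d) (R : realType) (P : probability T R)
    (L f : T -> R) (k e1 e2 : R) :
  measurable_fun [set: T] L -> (forall y, 0 <= L y) ->
  measurable_fun [set: T] f -> (forall y, 0 <= f y <= 1) -> 0 < k ->
  ((1 - e1)%:E <= \int[P]_y (L y)%:E)%E ->
  (\int[P]_y (L y ^+ 2)%:E <= (1 + e2)%:E)%E ->
  (\int[P]_y (f y)%:E <= \int[P]_y (f y * L y)%:E + (k + (e2 + 2 * e1) / (4 * k))%:E)%E.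
Proof.
move=> mL L0 mf f01 k0 L1 L2.
have f0 y : 0 <= f y by case/andP: (f01 y).
have c0 : 0 <= (2 * k)^-1 by rewrite invr_ge0 mulr_ge0// ltW.
have c1 : 0 <= (4 * k)^-1 by rewrite invr_ge0 mulr_ge0// ltW.
have mEL : measurable_fun [set: T] (EFin \o L) by exact/measurable_EFinP.
have mEf : measurable_fun [set: T] (EFin \o f) by exact/measurable_EFinP.
have mfL : measurable_fun [set: T] (fun y => (f y * L y)%:E).
  by apply/measurable_EFinP; exact: measurable_funM.
have mL2 : measurable_fun [set: T] (fun y => (L y ^+ 2)%:E).
  by apply/measurable_EFinP; exact: measurable_funX.
have key : (\int[P]_y ((f y)%:E + ((2 * k)^-1)%:E * (L y)%:E) <=
    \int[P]_y ((f y * L y)%:E + ((k + (4 * k)^-1)%:E + ((4 * k)^-1)%:E * (L y ^+ 2)%:E)))%E.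
  apply: ge0_le_integralW => y.
    by rewrite -EFinM -EFinD lee_fin addr_ge0// mulr_ge0.
  rewrite -!EFinM -!EFinD lee_fin.
  have h : f y * (1 - L y) <= k + (1 - L y) ^+ 2 / (4 * k).
    apply: (@le_trans _ _ `|1 - L y|).
      by rewrite (le_trans (ler_norm _))// normrM ger0_norm// ler_piMl//; case/andP: (f01 y).
    rewrite -(real_normK (num_real (1 - L y))); move: `|1 - L y| => t.
    rewrite -subr_ge0 (_ : _ - _ = (2 * k - t) ^+ 2 / (4 * k)); last by field; rewrite gt_eqF.
    by rewrite divr_ge0 ?sqr_ge0// mulr_ge0// ltW.
  rewrite -subr_ge0 [X in 0 <= X](_ : _ =
    k + (1 - L y) ^+ 2 / (4 * k) - f y * (1 - L y)); first by rewrite subr_ge0.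
  by field; rewrite gt_eqF.
have cst_ge0 : (0 <= (k + (4 * k)^-1)%:E)%E by rewrite lee_fin addr_ge0// ltW.
have cL2_ge0 y : [set: T] y -> (0 <= ((4 * k)^-1)%:E * (L y ^+ 2)%:E)%E.
  by rewrite -EFinM lee_fin mulr_ge0// sqr_ge0.
have mcL2 : measurable_fun [set: T] (fun y => (((4 * k)^-1)%:E * (L y ^+ 2)%:E)%E).
  exact: measurable_funeM.
have mcL : measurable_fun [set: T] (fun y => (((2 * k)^-1)%:E * (L y)%:E)%E).
  exact: measurable_funeM.
have nf y : [set: T] y -> (0 <= (f y)%:E)%E by rewrite lee_fin.
have nL y : [set: T] y -> (0 <= (L y)%:E)%E by rewrite lee_fin.
have nfL y : [set: T] y -> (0 <= (f y * L y)%:E)%E by rewrite lee_fin mulr_ge0.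
have nL2 y : [set: T] y -> (0 <= (L y ^+ 2)%:E)%E by rewrite lee_fin sqr_ge0.
have ncL y : [set: T] y -> (0 <= ((2 * k)^-1)%:E * (L y)%:E)%E.
  by rewrite -EFinM lee_fin mulr_ge0.
have nc2 y : [set: T] y -> (0 <= (k + (4 * k)^-1)%:E + ((4 * k)^-1)%:E * (L y ^+ 2)%:E)%E.
  by move=> yT; rewrite adde_ge0// cL2_ge0.
have mc2 : measurable_fun [set: T]
    (fun y => ((k + (4 * k)^-1)%:E + ((4 * k)^-1)%:E * (L y ^+ 2)%:E)%E).
  by apply: emeasurable_funD.
have e1D := ge0_integralD P measurableT nf mEf ncL mcL.
have e2D := ge0_integralD P measurableT nfL mfL nc2 mc2.
have e3D := ge0_integralD P measurableT (fun _ _ => cst_ge0) (measurable_cst _) cL2_ge0 mcL2.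
have e1Z := ge0_integralZl P measurableT mEL nL (k := ((2 * k)^-1)%:E) c0.
have e2Z := ge0_integralZl P measurableT mL2 nL2 (k := ((4 * k)^-1)%:E) c1.
have eC : (\int[P]_y (k + (4 * k)^-1)%:E = (k + (4 * k)^-1)%:E)%E.
  rewrite integral_cst// -[RHS]mule1; congr (_ * _)%E; exact: probability_setT.
move: key; rewrite e1D e2D e3D eC e1Z e2Z => key.
rewrite -(@leeD2rE _ ((2 * k)^-1 * (1 - e1))%:E)//.
apply: (@le_trans _ _ (\int[P]_y (f y)%:E + ((2 * k)^-1)%:E * \int[P]_y (L y)%:E)%E).
  by rewrite leeD2l// EFinM lee_wpmul2l.
apply: (le_trans key); rewrite -[leRHS]addeA leeD2l//.
apply: (@le_trans _ _ ((k + (4 * k)^-1)%:E + ((4 * k)^-1)%:E * (1 + e2)%:E)%E).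
  by rewrite leeD2l// lee_wpmul2l.
rewrite -EFinM -!EFinD lee_fin le_eqVlt; apply/orP; left; apply/eqP.
by field; rewrite gt_eqF.
Qed.

(** * From the truncated mixture to a lower bound on the type II error *)

Section lower_bound.
Context d (X : measurableType d) (R : realType) (E : expFamily X R) (t0 : R)
  (B : R -> R) (N M n m : nat) (a : R) (big : nat -> nat -> bool) (tau : nat -> nat -> R).
Hypothesis Theta_t0 : interior (ef_Theta E) t0.
Hypothesis sigma_gt0 : 0 < sigma0 E t0.
Hypothesis BC : forall t, ef_Theta E t -> B (ef_eta E t) = ef_C E t.
Hypothesis nN : (n <= N)%N.
Hypothesis mM : (m <= M)%N.

Local Notation s0 := (s0 E t0).
Local Notation sset := (sset E t0).
Local Notation phi := (cumulant E t0 B).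
Local Notation obs := (N.-tuple (M.-tuple R)).
Local Notation rect := ({set 'I_N} * {set 'I_M})%type.
Local Notation model := (@model _ X R E t0 N M).
Local Notation P0 := (model (const_mx s0)).
Local Notation lik := (@lik _ X R E t0 B N M n m a).
Local Notation good := (@good R N M big tau).
Local Notation trunc := (@trunc R N M tau).
Local Notation alt := (@alt _ X R E t0 N M a).

Hypothesis sa : sset (s0 + a).

Let G : R := ('C(N, n) * 'C(M, m))%:R.

Let G0 : 0 < G. Proof. by rewrite ltr0n muln_gt0 !bin_gt0 nN mM. Qed.

Lemma sum_rect_cst (x : R) : \sum_(C : rect | rect_of_size n m C) x = G * x.
Proof. by rewrite sumr_const card_rect mulr_natl. Qed.

Definition mixlik (y : obs) : R :=
  G^-1 * \sum_(C : rect | rect_of_size n m C) lik C y * good C y.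

Lemma lik_good_ge0 C y : 0 <= lik C y * good C y.
Proof. by rewrite mulr_ge0 ?lik_ge0//; case/andP: (good_bound big tau C y). Qed.

Lemma measurable_lik_good C : measurable_fun [set: obs] (fun y => lik C y * good C y).
Proof. by apply: measurable_funM; [exact: measurable_lik|exact: measurable_good]. Qed.

Lemma mixlik_ge0 y : 0 <= mixlik y.
Proof.
rewrite mulr_ge0 ?invr_ge0 ?(ltW G0)// sumr_ge0// => C _; exact: lik_good_ge0.
Qed.

Lemma integral_sum_rect (f : rect -> obs -> R) (Q : {measure set obs -> \bar R}) :
  (forall C, measurable_fun [set: obs] (f C)) -> (forall C y, 0 <= f C y) ->
  forall p : pred rect,
  (\int[Q]_y (\sum_(C | p C) f C y)%:E = \sum_(C | p C) \int[Q]_y (f C y)%:E)%E.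
Proof.
move=> mf f0 p; rewrite [RHS]big_mkcond/=.
transitivity (\int[Q]_y (\sum_C (if p C then f C y else 0)%:E))%E.
  by apply: eq_integral => y _; rewrite big_mkcond sumEFin.
rewrite ge0_integral_sum//.
- by apply: eq_bigr => C _; case: (p C) => //; rewrite integral0.
- move=> C; apply/measurable_EFinP; case: (p C) => //; exact: mf.
- by move=> C y _; rewrite lee_fin; case: (p C).
Qed.

Lemma measurable_mixlik : measurable_fun [set: obs] mixlik.
Proof.
apply: measurable_funM => //.
rewrite (_ : (fun _ => _) =
  (fun y => \sum_C (if rect_of_size n m C then lik C y * good C y else 0))).
  apply: measurable_sum => C; case: (rect_of_size n m C) => //.
  exact: measurable_lik_good.
by apply/funext => y; rewrite big_mkcond.
Qed.

Lemma integral_lik (C : rect) : rect_of_size n m C -> (\int[P0]_y (lik C y)%:E = 1)%E.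
Proof.
move=> Cr.
have := integral_lik_expR Theta_t0 sigma_gt0 BC (x := 0) 0 Cr (subxx _) (subxx _) sa.
rewrite addr0 subrr mulr0 addr0 expR0 => <- //.
by apply: eq_integral => y _; rewrite mul0r addr0 expR0 mulr1.
Qed.

Lemma card_subrect_le (C : rect) : rect_of_size n m C ->
  (#|[pred V : rect | subrect big C V]| <= 2 ^ (n + m))%N.
Proof.
move=> /andP[/eqP C1 /eqP C2].
rewrite expnD -{1}C1 -C2 -!card_powerset -cardsX subset_leq_card//.
by apply/fintype.subsetP => -[V1 V2]; rewrite !inE/= => /and3P[-> ->].
Qed.

(** Union bound over the at most [2 ^ (n + m)] subrectangles, each exceedance being estimated by a
    Chernoff bound under the planted law with its own tilt [x]. *)
Lemma integral_lik_good_ge (C : rect) (beta : R) : rect_of_size n m C ->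
  (forall V, subrect big C V -> exists x, [/\ 0 <= x, sset (s0 + (a + x)) &
     #|V.1|%:R * #|V.2|%:R * (phi (a + x) - phi a) - x * tau #|V.1| #|V.2| <= - beta]) ->
  ((1 - 2 ^+ (n + m) * expR (- beta))%:E <= \int[P0]_y (lik C y * good C y)%:E)%E.
Proof.
move=> Cr hV.
have t01 V y : 0 <= 1 - trunc V y by rewrite subr_ge0; case/andP: (trunc_bound tau V y).
have mt V : measurable_fun [set: obs] (fun y => lik C y * (1 - trunc V y)).
  apply: measurable_funM; first exact: measurable_lik.
  by apply: measurable_funB => //; exact: measurable_trunc.
rewrite EFinB leeBlDr//.
apply: (@le_trans _ _ (\int[P0]_y ((lik C y * good C y)%:E +
   (\sum_(V | subrect big C V) lik C y * (1 - trunc V y))%:E))%E).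
  rewrite -(integral_lik Cr); apply: ge0_le_integralW => y; first by rewrite lee_fin lik_ge0.
  rewrite -EFinD lee_fin -mulr_sumr -mulrDr ler_peMr ?lik_ge0//.
  by rewrite -lerBlDl; exact: one_sub_good_le.
rewrite ge0_integralD//; last 4 first.
- by move=> y _; rewrite lee_fin lik_good_ge0.
- by apply/measurable_EFinP; exact: measurable_lik_good.
- by move=> y _; rewrite lee_fin sumr_ge0// => V _; rewrite mulr_ge0 ?lik_ge0.
- apply/measurable_EFinP.
  rewrite (_ : (fun _ => _) =
    (fun y => \sum_V (if subrect big C V then lik C y * (1 - trunc V y) else 0))).
    by apply: measurable_sum => V; case: (subrect big C V).
  by apply/funext => y; rewrite big_mkcond.
rewrite leeD2l// integral_sum_rect//; last by move=> V y; rewrite mulr_ge0 ?lik_ge0.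
apply: (@le_trans _ _ (\sum_(V | subrect big C V) (expR (- beta))%:E)%E).
  apply: lee_sum => V CV; have [x [x0 sx xb]] := hV V CV.
  have /and3P[V1 V2 _] := CV.
  apply: (@le_trans _ _
    (\int[P0]_y (lik C y * expR (x * rsum V y + - (x * tau #|V.1| #|V.2|)))%:E)%E).
    apply: ge0_le_integralW => y; first by rewrite lee_fin mulr_ge0 ?lik_ge0.
    rewrite lee_fin ler_wpM2l ?lik_ge0//; apply: le_trans (one_sub_trunc_le tau V y x0) _.
    by rewrite mulrBr.
  by rewrite (integral_lik_expR Theta_t0 sigma_gt0 BC)// lee_fin ler_expR.
rewrite sumEFin lee_fin sumr_const -[_ *+ _]mulr_natl ler_wpM2r ?expR_ge0//.
by rewrite -natrX ler_nat card_subrect_le.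
Qed.

(** Of all truncations only the one on the intersection of [C] and [C'] is kept, as an exponential
    with multiplier [z]; [z = 0] stands for no truncation and is the only choice for an intersection
    that is not [big]. *)
Lemma integral_lik_good2_le (C C' : rect) (F : R) : rect_of_size n m C -> rect_of_size n m C' ->
  (exists z, [/\ 0 <= z, z = 0 \/ big #|C.1 :&: C'.1| #|C.2 :&: C'.2|,
     sset (s0 + (2 * a - z)) &
     expR (z * tau #|C.1 :&: C'.1| #|C.2 :&: C'.2| +
       #|C.1 :&: C'.1|%:R * #|C.2 :&: C'.2|%:R * (phi (2 * a - z) - 2 * phi a)) <= F]) ->
  (\int[P0]_y (lik C y * good C y * (lik C' y * good C' y))%:E <= F%:E)%E.
Proof.
move=> Cr Cr' [z [z0 zb sz zF]].
set V := capr C C'; pose k := z * tau #|V.1| #|V.2|.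
apply: (@le_trans _ _ (\int[P0]_y (lik C y * lik C' y * expR (k - z * rsum V y))%:E)%E).
  apply: ge0_le_integralW => y; first by rewrite lee_fin mulr_ge0// lik_good_ge0.
  rewrite lee_fin mulrACA ler_wpM2l ?mulr_ge0 ?lik_ge0//.
  have /andP[g0 g1] := good_bound big tau C y; have /andP[g0' g1'] := good_bound big tau C' y.
  apply: (@le_trans _ _ (good C y)); first by rewrite ler_piMr.
  case: zb => [z00|zb]; first by rewrite /k z00 !mul0r subrr expR0.
  have CV : subrect big C V by rewrite /subrect /V/= !finset.subsetIl.
  by apply: le_trans (good_le tau y CV) _; rewrite /k -mulrBr; exact: trunc_le.
rewrite (integral_lik2_expR Theta_t0 sigma_gt0 BC)// lee_fin addrC.
exact: zF.
Qed.

Lemma mixlik_mean_ge (e1 : R) :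
  (forall C : rect, rect_of_size n m C ->
     ((1 - e1)%:E <= \int[P0]_y (lik C y * good C y)%:E)%E) ->
  ((1 - e1)%:E <= \int[P0]_y (mixlik y)%:E)%E.
Proof.
move=> h; under eq_integral do rewrite /mixlik EFinM.
rewrite ge0_integralZl//; last 3 first.
- apply/measurable_EFinP.
  rewrite (_ : (fun _ => _) = (fun y => G * mixlik y)).
    by apply: measurable_funM => //; exact: measurable_mixlik.
  by apply/funext => y; rewrite /mixlik mulrA divff ?gt_eqF// mul1r.
- by move=> y _; rewrite lee_fin sumr_ge0// => C _; exact: lik_good_ge0.
- by rewrite lee_fin invr_ge0 ltW.
rewrite integral_sum_rect; [|exact: measurable_lik_good|exact: lik_good_ge0].
apply: (@le_trans _ _ ((G^-1)%:E * \sum_(C : rect | rect_of_size n m C) (1 - e1)%:E)%E).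
  by rewrite sumEFin sum_rect_cst -EFinM lee_fin mulrA mulVf ?gt_eqF// mul1r.
rewrite lee_wpmul2l ?lee_fin ?invr_ge0 ?(ltW G0)//.
by apply: lee_sum => C; exact: h.
Qed.

Lemma mixlik_sqr_le (F : rect -> rect -> R) (e2 : R) :
  (forall C C', rect_of_size n m C -> rect_of_size n m C' ->
    (\int[P0]_y (lik C y * good C y * (lik C' y * good C' y))%:E <= (F C C')%:E)%E) ->
  (forall C, rect_of_size n m C ->
    \sum_(C' : rect | rect_of_size n m C') F C C' <= G * (1 + e2)) ->
  (\int[P0]_y (mixlik y ^+ 2)%:E <= (1 + e2)%:E)%E.
Proof.
move=> hF hs.
pose g C C' (y : obs) := lik C y * good C y * (lik C' y * good C' y).
have g0 C C' y : 0 <= g C C' y by rewrite mulr_ge0// lik_good_ge0.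
have mg C C' : measurable_fun [set: obs] (g C C').
  by apply: measurable_funM; exact: measurable_lik_good.
have mgs C : measurable_fun [set: obs]
    (fun y => \sum_(C' : rect | rect_of_size n m C') g C C' y).
  rewrite (_ : (fun _ => _) = (fun y => \sum_C' (if rect_of_size n m C' then g C C' y else 0))).
    by apply: measurable_sum => C'; case: (rect_of_size n m C').
  by apply/funext => y; rewrite big_mkcond.
have gs0 C y : 0 <= \sum_(C' : rect | rect_of_size n m C') g C C' y by exact: sumr_ge0.
have e y : mixlik y ^+ 2 = (G ^- 2) * \sum_(C : rect | rect_of_size n m C)
    \sum_(C' : rect | rect_of_size n m C') g C C' y.
  rewrite /mixlik exprMn exprVn; congr (_ * _).
  by rewrite expr2 mulr_suml; apply: eq_bigr => C _; rewrite mulr_sumr.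
under eq_integral do rewrite e EFinM.
rewrite ge0_integralZl//; last 3 first.
- apply/measurable_EFinP.
  rewrite (_ : (fun _ => _) = (fun y => G ^+ 2 * mixlik y ^+ 2)).
    by apply: measurable_funM => //; apply: measurable_funX; exact: measurable_mixlik.
  by apply/funext => y; rewrite e mulrA divff ?mul1r// expf_neq0// gt_eqF.
- by move=> y _; rewrite lee_fin sumr_ge0.
- by rewrite lee_fin invr_ge0 exprn_ge0// ltW.
rewrite integral_sum_rect//.
apply: (@le_trans _ _ ((G ^- 2)%:E * \sum_(C : rect | rect_of_size n m C) (G * (1 + e2))%:E)%E).
  rewrite lee_wpmul2l ?lee_fin ?invr_ge0 ?exprn_ge0 ?(ltW G0)//.
  apply: lee_sum => C Cr; rewrite integral_sum_rect//.
  apply: (@le_trans _ _ (\sum_(C' : rect | rect_of_size n m C') (F C C')%:E)%E).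
    by apply: lee_sum => C' Cr'; exact: hF.
  by rewrite sumEFin lee_fin hs.
rewrite sumEFin sum_rect_cst -EFinM lee_fin le_eqVlt; apply/orP; left; apply/eqP.
by rewrite (mulrA G) -expr2 mulrA mulVf ?mul1r// expf_neq0// gt_eqF.
Qed.

(** A supremum dominates an average, here over the planted rectangles with all entries at [s0 + a];
    inserting the factor [good C <= 1] only lowers the average. *)
Lemma type2_ge_mixlik (psi : obs -> R) : is_test psi ->
  (\int[P0]_y ((1 - psi y) * mixlik y)%:E <= type2 E t0 n m a psi)%E.
Proof.
move=> [mpsi psi01].
have p0 y : 0 <= 1 - psi y by rewrite subr_ge0; case/andP: (psi01 y).
have mp : measurable_fun [set: obs] (fun y => 1 - psi y) by exact: measurable_funB.
have altC C : rect_of_size n m C -> alternatives E t0 n m a (alt C).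
  move=> Cr; split; first by move=> i j; rewrite mxE; case: ifP => // _; exact: s0_sset.
  exists C; split => // i j; rewrite mxE; first by move=> /negbTE ->.
  by move=> ->; rewrite addrC addKr.
have [C0 C0r] : exists C : rect, rect_of_size n m C.
  have : (0 < #|[pred C : rect | rect_of_size n m C]|)%N.
    by rewrite card_rect muln_gt0 !bin_gt0 nN mM.
  by case/card_gt0P => C; exists C.
have tge C : rect_of_size n m C ->
    (\int[P0]_y ((1 - psi y) * lik C y)%:E <= type2 E t0 n m a psi)%E.
  move=> Cr; rewrite -(integral_alt Theta_t0 sigma_gt0 BC Cr sa mp p0).
  by apply: ereal_sup_ubound; exists (alt C); [exact: altC|rewrite unlock].
have t1 : (type2 E t0 n m a psi <= 1)%E.
  apply: ge_ereal_sup => _ [S _ <-]; rewrite unlock.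
  apply: (@le_trans _ _ (\int[model S]_y 1)%E).
    apply: ge0_le_integralW => y; first by rewrite lee_fin.
    by rewrite lee_fin gerBl; case/andP: (psi01 y).
  by rewrite integral_cst// mul1e; exact: probability_le1.
have t0' : (0 <= type2 E t0 n m a psi)%E.
  by apply: (type2_ge0 (altC _ C0r)) => y; case/andP: (psi01 y).
have tfin : type2 E t0 n m a psi \is a fin_num.
  by rewrite ge0_fin_numE// (le_lt_trans t1)// ltry.
under eq_integral => y _.
  rewrite /mixlik mulrCA mulr_sumr EFinM; over.
rewrite ge0_integralZl//; last 3 first.
- apply/measurable_EFinP.
  rewrite (_ : (fun _ => _) = (fun y => G * ((1 - psi y) * mixlik y))).
    by apply: measurable_funM => //; apply: measurable_funM => //; exact: measurable_mixlik.
  apply/funext => y; rewrite /mixlik (mulrCA _ G^-1) (mulrA G) divff ?gt_eqF// mul1r.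
  by rewrite mulr_sumr.
- by move=> y _; rewrite lee_fin sumr_ge0// => C _; rewrite mulr_ge0// lik_good_ge0.
- by rewrite lee_fin invr_ge0 ltW.
rewrite integral_sum_rect; last 2 first.
- by move=> C; apply: measurable_funM => //; exact: measurable_lik_good.
- by move=> C y; rewrite mulr_ge0// lik_good_ge0.
apply: (@le_trans _ _ ((G^-1)%:E * \sum_(C : rect | rect_of_size n m C)
    (fine (type2 E t0 n m a psi))%:E)%E).
  rewrite lee_wpmul2l ?lee_fin ?invr_ge0 ?(ltW G0)//.
  apply: lee_sum => C Cr; rewrite fineK//; apply: le_trans (tge C Cr).
  apply: ge0_le_integralW => y; first by rewrite lee_fin mulr_ge0// lik_good_ge0.
  rewrite lee_fin ler_wpM2l// ler_piMr ?lik_ge0//.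
  by case/andP: (good_bound big tau C y).
by rewrite sumEFin sum_rect_cst -EFinM mulrA mulVf ?gt_eqF// mul1r fineK.
Qed.

Lemma type2_lower_bound (F : rect -> rect -> R) (e1 e2 k : R) (psi : obs -> R) :
  is_test psi -> 0 < k ->
  (forall C : rect, rect_of_size n m C ->
     ((1 - e1)%:E <= \int[P0]_y (lik C y * good C y)%:E)%E) ->
  (forall C C', rect_of_size n m C -> rect_of_size n m C' ->
    (\int[P0]_y (lik C y * good C y * (lik C' y * good C' y))%:E <= (F C C')%:E)%E) ->
  (forall C, rect_of_size n m C ->
    \sum_(C' : rect | rect_of_size n m C') F C C' <= G * (1 + e2)) ->
  (\int[P0]_y (1 - psi y)%:E <=
    type2 E t0 n m a psi + (k + (e2 + 2 * e1) / (4 * k))%:E)%E.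
Proof.
move=> psit k0 h1 h2 h3; have [mpsi psi01] := psit.
apply: le_trans (second_moment_bound measurable_mixlik mixlik_ge0 _ _ k0
  (mixlik_mean_ge h1) (mixlik_sqr_le h2 h3)) _.
- exact: measurable_funB.
- by move=> y; have /andP[p0 p1] := psi01 y; rewrite subr_ge0 p1 gerBl.
by rewrite leeD2r// type2_ge_mixlik.
Qed.

Lemma sum_rect_prod (f : {set 'I_N} -> R) (g : {set 'I_M} -> R) :
  \sum_(C : rect | rect_of_size n m C) f C.1 * g C.2 =
  (\sum_(A : {set 'I_N} | #|A| == n) f A) * (\sum_(A : {set 'I_M} | #|A| == m) g A).
Proof.
rewrite mulr_suml; under [RHS]eq_bigr do rewrite mulr_sumr.
by rewrite pair_big/=; apply: eq_bigr => -[].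
Qed.

End lower_bound.

(** * Averages over a random rectangle of functions of its overlap *)

Section overlap_sums.
Context (R : realType) (N M n m : nat).
Hypothesis n0 : (0 < n)%N.
Hypothesis m0 : (0 < m)%N.
Hypothesis nN : (n <= N)%N.
Hypothesis mM : (m <= M)%N.

Local Notation rect := ({set 'I_N} * {set 'I_M})%type.
Local Notation p := (n%:R / N%:R : R).
Local Notation q := (m%:R / M%:R : R).
Local Notation G := (('C(N, n) * 'C(M, m))%:R : R).

Variable C : rect.
Hypothesis Cr : rect_of_size n m C.

Let C1 : #|C.1| = n. Proof. by case/andP: Cr => /eqP. Qed.
Let C2 : #|C.2| = m. Proof. by case/andP: Cr => _ /eqP. Qed.

Local Notation ovn C' := (#|C.1 :&: C'.1|%:R : R).
Local Notation ovm C' := (#|C.2 :&: C'.2|%:R : R).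

Lemma overlap_sum_expR (th1 th2 b : R) : 0 <= th1 -> 0 <= th2 ->
  \sum_(C' : rect | rect_of_size n m C') expR (th1 * ovn C' + th2 * ovm C' - b) <=
  G * expR (n%:R * p * (expR th1 - 1) + m%:R * q * (expR th2 - 1) - b).
Proof.
move=> h1 h2.
have -> : \sum_(C' : rect | rect_of_size n m C') expR (th1 * ovn C' + th2 * ovm C' - b) =
  expR (- b) * \sum_(C' : rect | rect_of_size n m C') expR (th1 * ovn C') * expR (th2 * ovm C').
  by rewrite mulr_sumr; apply: eq_bigr => C' _; rewrite -!expRD; congr expR; ring.
rewrite (sum_rect_prod n m (fun A' => expR (th1 * #|C.1 :&: A'|%:R))
  (fun A' => expR (th2 * #|C.2 :&: A'|%:R))).
rewrite !expRD natrM [leRHS](_ : _ = expR (- b) *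
  (('C(N, n)%:R * expR (n%:R * p * (expR th1 - 1))) *
   ('C(M, m)%:R * expR (m%:R * q * (expR th2 - 1))))); last by ring.
rewrite ler_wpM2l ?expR_ge0// ler_pM ?sumr_ge0//; try by move=> ? _; exact: expR_ge0.
  exact: overlap_mgf_le.
exact: overlap_mgf_le.
Qed.

Lemma expR_sub1_le (x : R) : 0 <= x <= 1 -> expR x - 1 <= 3 * x.
Proof.
move=> x01; have := @expR_interp R x 1 1 x01 ltr01; rewrite !mulr1 divr1.
(* This says [expR 1 <= 2 + expR 1 / 2], hence [expR 1 <= 4], and the slope of the chord is at most
   3. *)
have := @expR_le_quad_ge0 R 1 ler01; rewrite expr1n; move: (expR 1) => e.
by move=> e1; have /andP[x0 _] := x01; nra.
Qed.

(** Rows are averaged first with the column overlap [l] fixed: [c * l <= 1] allows a linear bound of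
    the exponential, giving tilt [th] on the columns, and [th <= 1] allows the same once more,
    whence [9 = 3 * 3]. *)
Lemma overlap_sum_small (c l0 : R) : 0 <= c -> c * l0 <= 1 -> 3 * (n%:R * p * c) <= 1 ->
  \sum_(C' : rect | rect_of_size n m C')
    (if ovm C' <= l0 then expR (c * (ovn C' * ovm C')) else 0) <=
  G * expR (9 * (c * (n%:R * p) * (m%:R * q))).
Proof.
move=> c0 cl npc.
have np0 : 0 <= n%:R * p by rewrite mulr_ge0// divr_ge0.
have mq0 : 0 <= m%:R * q by rewrite mulr_ge0// divr_ge0.
pose th := 3 * (n%:R * p * c); have th0 : 0 <= th by rewrite !mulr_ge0.
rewrite -(pair_big (fun A : {set 'I_N} => #|A| == n) (fun A : {set 'I_M} => #|A| == m)
  (fun A A' => if #|C.2 :&: A'|%:R <= l0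
    then expR (c * (#|C.1 :&: A|%:R * #|C.2 :&: A'|%:R)) else 0))/= exchange_big/=.
apply: (@le_trans _ _ (\sum_(A' : {set 'I_M} | #|A'| == m)
    'C(N, n)%:R * expR (th * #|C.2 :&: A'|%:R))).
  apply: ler_sum => A' _; set l : R := #|_|%:R.
  have l_ge0 : 0 <= l by [].
  have [ll|_] := leP l l0; last by rewrite sumr_const mul0rn mulr_ge0 ?expR_ge0.
  have cl01 : 0 <= c * l <= 1.
    by rewrite mulr_ge0//= (le_trans _ cl)// ler_wpM2l.
  under eq_bigr do rewrite (mulrC _ l) mulrA.
  have /andP[cl0 _] := cl01.
  apply: le_trans (overlap_mgf_le n0 nN C1 cl0) _.
  rewrite ler_wpM2l// ler_expR; apply: le_trans (ler_wpM2l np0 (expR_sub1_le cl01)) _.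
  by rewrite /th le_eqVlt; apply/orP; left; apply/eqP; ring.
rewrite -mulr_sumr natrM -mulrA ler_wpM2l//.
apply: le_trans (overlap_mgf_le m0 mM C2 th0) _.
rewrite ler_wpM2l// ler_expR.
have th1 : 0 <= th <= 1 by rewrite th0.
apply: le_trans (ler_wpM2l mq0 (expR_sub1_le th1)) _.
by rewrite /th le_eqVlt; apply/orP; left; apply/eqP; ring.
Qed.

End overlap_sums.

Section truncated_exponent.
Context (R : realType).
Implicit Types a t kap : R.

(* With [phi(u)] replaced by [u^2 / 2]: truncating at slope [t] costs [(2a - h) t + h^2 / 2 - a^2]
   with [h = min t (2a)], which is smaller than [t^2 / 2] by a definite factor. *)
Lemma truncated_exponent_le a t kap eta h : 0 <= a -> 0 < kap <= 1 / 2 ->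
  a <= (1 - kap) * t -> eta = kap ^+ 2 / 4 -> h = Num.min t (2 * a) ->
  (2 * a - h) * t + (1 + eta) * (h ^+ 2 / 2) - 2 * ((1 - eta) * (a ^+ 2 / 2)) <=
  (1 - kap ^+ 2 / 2) * (t ^+ 2 / 2).
Proof.
move=> a0 /andP[k0 k1] at_ etaE hE.
have t0 : 0 <= t by nra.
have at2 : a ^+ 2 <= t ^+ 2 by rewrite ler_pXn2r//; nra.
have k2 : kap ^+ 2 <= 1 / 4 by nra.
have k20 : 0 <= kap ^+ 2 by exact: sqr_ge0.
have t20 : 0 <= t ^+ 2 by exact: sqr_ge0.
have ka : kap ^+ 2 * a ^+ 2 <= kap ^+ 2 * t ^+ 2 by rewrite ler_wpM2l.
have ka4 : kap ^+ 2 * t ^+ 2 <= 1 / 4 * t ^+ 2 by rewrite ler_wpM2r.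
(* With [eta] set to 0, the exponent for [h = t] is [t^2 / 2 - (t - a)^2], and [t - a >= kap * t];
   for [h = 2 * a] it is [a^2], at most [t^2 / 4]. *)
rewrite hE; have [ta|ta] := leP t (2 * a).
  have tka : (kap * t) ^+ 2 <= (t - a) ^+ 2.
    by rewrite ler_pXn2r ?nnegrE ?mulr_ge0 ?(ltW k0)//; nra.
  by rewrite exprMn in tka; rewrite etaE; nra.
have a4 : a ^+ 2 <= t ^+ 2 / 4.
  have : (2 * a) ^+ 2 <= t ^+ 2 by rewrite ler_pXn2r ?nnegrE ?mulr_ge0// ltW.
  by rewrite exprMn; lra.
have ka5 : kap ^+ 2 * a ^+ 2 <= 1 / 4 * a ^+ 2 by rewrite ler_wpM2r// sqr_ge0.
by rewrite etaE; nra.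
Qed.

(** With [eta] set to 0 the left side is [- (t - a)^2 / 2], the Gaussian cost of a level [t] when
    the mean is [a]; the terms in [eta] use up at most half of it. *)
Lemma first_exponent_le a t kap eta : 0 <= a -> 0 < kap <= 1 / 2 ->
  a <= (1 - kap) * t -> eta = kap ^+ 2 / 4 ->
  (1 + eta) * (t ^+ 2 / 2) - (1 - eta) * (a ^+ 2 / 2) - (t - a) * t <=
  - (kap ^+ 2 / 4 * t ^+ 2).
Proof.
move=> a0 /andP[k0 k1] at_ etaE.
have t0 : 0 <= t by nra.
have at2 : a ^+ 2 <= t ^+ 2 by rewrite ler_pXn2r//; nra.
have k20 : 0 <= kap ^+ 2 by exact: sqr_ge0.
have ka : kap ^+ 2 * a ^+ 2 <= kap ^+ 2 * t ^+ 2 by rewrite ler_wpM2l.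
have tka : (kap * t) ^+ 2 <= (t - a) ^+ 2.
  by rewrite ler_pXn2r ?nnegrE ?mulr_ge0 ?(ltW k0)//; nra.
by rewrite exprMn in tka; rewrite etaE; nra.
Qed.

End truncated_exponent.

(** * The lower bound at fixed sizes, under explicit numerical conditions *)

Section lower_bound_fixed.
Context d (X : measurableType d) (R : realType) (E : expFamily X R) (t0 : R)
  (B : R -> R) (N M n m : nat) (a kap rho eps : R).
Hypothesis Theta_t0 : interior (ef_Theta E) t0.
Hypothesis sigma_gt0 : 0 < sigma0 E t0.
Hypothesis BC : forall t, ef_Theta E t -> B (ef_eta E t) = ef_C E t.
Hypothesis n0 : (0 < n)%N.
Hypothesis m0 : (0 < m)%N.
Hypothesis nN : (n <= N)%N.
Hypothesis mM : (m <= M)%N.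

Local Notation s0 := (s0 E t0).
Local Notation sset := (sset E t0).
Local Notation phi := (cumulant E t0 B).
Local Notation obs := (N.-tuple (M.-tuple R)).
Local Notation rect := ({set 'I_N} * {set 'I_M})%type.
Local Notation P0 := (@model _ X R E t0 N M (const_mx s0)).
Local Notation p := (n%:R / N%:R : R).
Local Notation q := (m%:R / M%:R : R).
Local Notation Lp := (ln p^-1).
Local Notation Lq := (ln q^-1).
Local Notation rate := (n%:R * Lp + m%:R * Lq : R).
Local Notation eta := (kap ^+ 2 / 4).

Hypothesis a_gt0 : 0 < a.
Hypothesis kap_bound : 0 < kap <= 1 / 2.
Hypothesis rho_bound : 0 < rho <= 1.
Hypothesis phi_quad : forall u, `|u| <= eps -> sset (s0 + u) /\
  (1 - eta) * (u ^+ 2 / 2) <= phi u <= (1 + eta) * (u ^+ 2 / 2).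
Hypothesis a_eps : 2 * a <= eps.
Hypothesis a_rate : a ^+ 2 * (n%:R * m%:R) <= (1 - kap) ^+ 2 * (2 * rate).
Hypothesis Lp_ge : 8 <= Lp.
Hypothesis Lq_ge : 8 <= Lq.
Hypothesis slope_eps : 2 / rho * (Lp / m%:R + Lq / n%:R) <= eps ^+ 2.
Hypothesis a_n : 2 * a ^+ 2 * (rho * n%:R) <= Lq / 8.
Hypothesis a_m : 2 * a ^+ 2 * (rho * m%:R) <= Lp / 8.
Hypothesis p_rho : expR (- (Lp / 2)) <= rho.
Hypothesis a_sqrtq : 2 * a ^+ 2 * (m%:R * expR (- (Lq / 2))) <= 1.
Hypothesis a_p : 3 * (n%:R * p * (2 * a ^+ 2)) <= 1.
Hypothesis rho_Lp : 2 <= rho * (kap ^+ 2 / 4 * Lp).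
Hypothesis rho_Lq : 2 <= rho * (kap ^+ 2 / 4 * Lq).

Let big (k l : nat) : bool := (rho * n%:R < k%:R) && (rho * m%:R < l%:R).
(* [w k l] is about the logarithm of the number of [k x l] subrectangles; under the null, such a
   sum exceeds [tau k l] with probability about [expR (- w k l)]. *)
Let w (k l : nat) : R := k%:R * Lp + l%:R * Lq.
Let tau (k l : nat) : R := Num.sqrt (2 * (k%:R * l%:R) * w k l).

Local Notation lik := (@lik _ X R E t0 B N M n m a).
Local Notation good := (@good R N M big tau).

Let nR : 0 < n%:R :> R. Proof. by rewrite ltr0n. Qed.
Let mR : 0 < m%:R :> R. Proof. by rewrite ltr0n. Qed.
Let Lp0 : 0 < Lp. Proof. by apply: lt_le_trans Lp_ge. Qed.
Let Lq0 : 0 < Lq. Proof. by apply: lt_le_trans Lq_ge. Qed.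
Let eps0 : 0 <= eps. Proof. by apply: le_trans a_eps; rewrite mulr_ge0// ltW. Qed.
Let rho0 : 0 < rho. Proof. by case/andP: rho_bound. Qed.

Let pE : p = expR (- Lp).
Proof.
rewrite lnV ?posrE ?divr_gt0 ?ltr0n ?(leq_trans n0)// opprK lnK//.
by rewrite posrE divr_gt0// ltr0n (leq_trans n0).
Qed.
Let qE : q = expR (- Lq).
Proof.
rewrite lnV ?posrE ?divr_gt0 ?ltr0n ?(leq_trans m0)// opprK lnK//.
by rewrite posrE divr_gt0// ltr0n (leq_trans m0).
Qed.

Let sa : sset (s0 + a).
Proof. by case: (phi_quad (u := a)) => //; rewrite gtr0_norm//; move: a_gt0 a_eps; lra. Qed.

(** [t] is the truncation level per entry, with [t^2 = 2 (Lp / l + Lq / k)]. It decreases in [k] and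
    [l], so it is smallest for the full rectangle, where [a_rate] puts [a] below it by the factor
    [1 - kap]; it is largest at the boundary of [big], where [slope_eps] keeps it in the window. *)
Lemma slope_facts (k l : nat) : (k <= n)%N -> (l <= m)%N -> big k l ->
  exists t, [/\ 0 < k%:R * l%:R :> R, tau k l = k%:R * l%:R * t, k%:R * l%:R * (t ^+ 2 / 2) = w k l,
    a <= (1 - kap) * t & 0 <= t <= eps].
Proof.
move=> kn lm /andP[kb lb]; have [k0 k1] := andP kap_bound.
have kR : 0 < k%:R :> R by apply: le_lt_trans kb; rewrite mulr_ge0// ltW.
have lR : 0 < l%:R :> R by apply: le_lt_trans lb; rewrite mulr_ge0// ltW.
have kl : 0 < k%:R * l%:R :> R by rewrite mulr_gt0.
have w0 : 0 <= w k l by rewrite addr_ge0// mulr_ge0// ltW.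
have kl2 : 0 <= 2 * (k%:R * l%:R) * w k l by rewrite !mulr_ge0.
pose t := tau k l / (k%:R * l%:R).
have t0' : 0 <= t by rewrite divr_ge0 ?sqrtr_ge0// ltW.
have tE : t ^+ 2 = 2 * (Lp / l%:R + Lq / k%:R).
  rewrite /t expr_div_n sqr_sqrtr// /w; field; by rewrite !gt_eqF.
have dec (u v c : R) : 0 < u -> u <= v -> 0 <= c -> c / v <= c / u.
  by move=> u0 uv c0; rewrite ler_wpM2l// lef_pV2// posrE (lt_le_trans u0).
exists t; split => //.
- by rewrite /t mulrC divfK// gt_eqF.
- by rewrite tE /w; field; rewrite !gt_eqF.
- have k0' : 0 <= 1 - kap by lra.
  apply: ler_of_sqr; first exact: mulr_ge0.
  rewrite exprMn tE.
  apply: (@le_trans _ _ ((1 - kap) ^+ 2 * (2 * (Lp / m%:R + Lq / n%:R)))).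
    rewrite -(@ler_pM2r _ (n%:R * m%:R)) ?mulr_gt0//; apply: le_trans a_rate _.
    by rewrite le_eqVlt; apply/orP; left; apply/eqP; field; rewrite !gt_eqF.
  rewrite ler_wpM2l ?sqr_ge0// ler_wpM2l// lerD//.
    by apply: dec => //; [rewrite ler_nat|exact: ltW].
  by apply: dec => //; [rewrite ler_nat|exact: ltW].
- rewrite t0'/=; apply: ler_of_sqr => //; apply: le_trans slope_eps; rewrite tE.
  rewrite -mulrA ler_wpM2l// mulrDr lerD//.
    apply: le_trans (dec (rho * m%:R) _ _ _ (ltW lb) (ltW Lp0)) _; first exact: mulr_gt0.
    by rewrite le_eqVlt; apply/orP; left; apply/eqP; field; rewrite !gt_eqF.
  apply: le_trans (dec (rho * n%:R) _ _ _ (ltW kb) (ltW Lq0)) _; first exact: mulr_gt0.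
  by rewrite le_eqVlt; apply/orP; left; apply/eqP; field; rewrite !gt_eqF.
Qed.

Lemma first_moment_fixed (C : rect) : rect_of_size n m C ->
  ((1 - 2 ^+ (n + m) * expR (- (rho * (kap ^+ 2 / 2) * rate)))%:E <=
   \int[P0]_y (lik C y * good C y)%:E)%E.
Proof.
move=> Cr; have [k0 k1] := andP kap_bound; have /andP[/eqP C1 /eqP C2] := Cr.
apply: (integral_lik_good_ge Theta_t0 sigma_gt0 BC sa Cr) => V /and3P[V1 V2 Vb].
have kn : (#|V.1| <= n)%N by rewrite -C1 subset_leq_card.
have lm : (#|V.2| <= m)%N by rewrite -C2 subset_leq_card.
have [t [kl tauE wE at_ /andP[t0' te]]] := slope_facts kn lm Vb.
have a0 : 0 <= a by exact: ltW.
have ta : a <= t by nra.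
(* The optimal Gaussian tilt: it moves each entry of [V] from [a] to the level [t]. *)
exists (t - a); rewrite subr_ge0 ta (_ : a + (t - a) = t); last by ring.
have [|st /andP[_ pt]] := phi_quad (u := t); first by rewrite ger0_norm.
have [|_ /andP[pa _]] := phi_quad (u := a); first by rewrite ger0_norm//; move: a_eps; lra.
split=> //; rewrite tauE.
have h := first_exponent_le a0 kap_bound at_ erefl.
apply: (@le_trans _ _ (#|V.1|%:R * #|V.2|%:R * - (kap ^+ 2 / 4 * t ^+ 2))).
  rewrite (_ : _ - _ = #|V.1|%:R * #|V.2|%:R * (phi t - phi a - (t - a) * t)); last by ring.
  by rewrite ler_pM2l//; lra.
rewrite (_ : _ * - _ = - (kap ^+ 2 / 2 * (#|V.1|%:R * #|V.2|%:R * (t ^+ 2 / 2)))); last by field.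
rewrite wE lerN2 (_ : rho * _ * _ = kap ^+ 2 / 2 * (rho * rate)); last by ring.
rewrite ler_wpM2l ?divr_ge0 ?sqr_ge0//.
have /andP[Vn Vm] := Vb; rewrite /w mulrDr !mulrA.
by rewrite lerD// ler_pM2r// ltW.
Qed.

(** At tilt [Lp / 2] the exponential moment of the row overlap has exponent at most
    [n p expR (Lp / 2) = n expR (- (Lp / 2))], which sets the scale above which that tilt is
    profitable. The maximum with 1 records that an overlap above this scale is a positive
    integer. *)
Let k1 : R := Num.max 1 (n%:R * expR (- (Lp / 2))).
Let l1 : R := Num.max 1 (m%:R * expR (- (Lq / 2))).
(** The gain [kap^2 / 2] of [truncated_exponent_le] is split in two: one half lowers the tilt to
    [th], with [p expR (th * Lp) <= 1], the other becomes the negative constant in [F4]. *)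
Let th : R := 1 - kap ^+ 2 / 4.

(* [F1]: the overlap has few columns; [F2], [F3]: one side is at most a fraction [rho] of the
   rectangle, no truncation is needed; [F4]: both sides are large and the truncation acts. *)
Let F1 (k l : nat) : R :=
  if l%:R <= m%:R * expR (- (Lq / 2)) then expR (2 * a ^+ 2 * (k%:R * l%:R)) else 0.
Let F2 (k l : nat) : R := expR (0 * k%:R + Lq / 2 * l%:R - 3 / 8 * Lq * l1).
Let F3 (k l : nat) : R := expR (Lp / 2 * k%:R + 0 * l%:R - 3 / 8 * Lp * k1).
Let F4 (k l : nat) : R := expR (th * Lp * k%:R + th * Lq * l%:R -
  kap ^+ 2 / 4 * (Lp * (rho * n%:R) + Lq * (rho * m%:R))).

Let F1_ge0 k l : 0 <= F1 k l. Proof. by rewrite /F1; case: ifP => // _; exact: expR_ge0. Qed.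

Lemma small_overlap (k l : nat) :
  k%:R * l%:R * (phi (2 * a) - 2 * phi a) <= 2 * a ^+ 2 * (k%:R * l%:R).
Proof.
have [k0 k1'] := andP kap_bound.
have [|_ /andP[_ p2]] := phi_quad (u := 2 * a); first by rewrite ger0_norm// mulr_ge0// ltW.
have [|_ /andP[pa _]] := phi_quad (u := a).
  by rewrite gtr0_norm//; move: a_gt0 a_eps; lra.
rewrite [leRHS]mulrC ler_wpM2l// ?mulr_ge0//.
have a2 : 0 <= a ^+ 2 by exact: sqr_ge0.
have k2 : kap ^+ 2 <= 1 by nra.
have : kap ^+ 2 * a ^+ 2 <= a ^+ 2 by rewrite ler_piMl.
rewrite exprMn in p2; nra.
Qed.

Lemma second_moment_exponent (k l : nat) : (k <= n)%N -> (l <= m)%N ->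
  exists z, [/\ 0 <= z, z = 0 \/ big k l, sset (s0 + (2 * a - z)) &
    expR (z * tau k l + k%:R * l%:R * (phi (2 * a - z) - 2 * phi a)) <=
    F1 k l + F2 k l + F3 k l + F4 k l].
Proof.
move=> kn lm; have [k0 k1'] := andP kap_bound.
have s2a : sset (s0 + (2 * a - 0)).
  by rewrite subr0; case: (phi_quad (u := 2 * a)) => //; rewrite ger0_norm// mulr_ge0// ltW.
have F20 : 0 <= F2 k l by exact: expR_ge0.
have F30 : 0 <= F3 k l by exact: expR_ge0.
have F40 : 0 <= F4 k l by exact: expR_ge0.
have F10 := F1_ge0 k l.
have small := small_overlap k l.
have a20 : 0 <= 2 * a ^+ 2 by rewrite mulr_ge0// sqr_ge0.
have [lq|lq] := leP (l%:R : R) (m%:R * expR (- (Lq / 2))).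
  exists 0; split => //; [by left|].
  rewrite mul0r add0r subr0; apply: (@le_trans _ _ (F1 k l)); last by move: F20 F30 F40; lra.
  by rewrite /F1 lq ler_expR.
have l_ge1 : 1 <= l%:R :> R.
  by rewrite ler1n -(ltr0n R); apply: le_lt_trans lq; rewrite mulr_ge0// expR_ge0.
have l_l1 : l1 <= l%:R by rewrite ge_max l_ge1 ltW.
have [krho|krho] := leP (k%:R : R) (rho * n%:R).
  exists 0; split => //; [by left|].
  rewrite mul0r add0r subr0; apply: (@le_trans _ _ (F2 k l)); last by move: F10 F30 F40; lra.
  (* Each column costs at most [Lq / 8] by [a_n], so [3 / 8 * Lq] of the tilt [Lq / 2] remains, on
     at least [l1] columns. *)
  rewrite /F2 ler_expR mul0r add0r; apply: le_trans small _.
  have : 2 * a ^+ 2 * k%:R <= Lq / 8 by apply: le_trans a_n; rewrite ler_wpM2l.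
  move=> h; have : 2 * a ^+ 2 * k%:R * l%:R <= Lq / 8 * l%:R by rewrite ler_wpM2r.
  have : Lq * l1 <= Lq * l%:R by rewrite ler_wpM2l// ltW.
  by lra.
(* [p_rho] places the scale of [k1] below [rho * n], so the rows need no separate small case. *)
have kp : n%:R * expR (- (Lp / 2)) < k%:R.
  by apply: le_lt_trans krho; rewrite mulrC ler_wpM2r.
have k_ge1 : 1 <= k%:R :> R.
  by rewrite ler1n -(ltr0n R); apply: le_lt_trans kp; rewrite mulr_ge0// expR_ge0.
have k_k1 : k1 <= k%:R by rewrite ge_max k_ge1 ltW.
have [lrho|lrho] := leP (l%:R : R) (rho * m%:R).
  exists 0; split => //; [by left|].
  rewrite mul0r add0r subr0; apply: (@le_trans _ _ (F3 k l)); last by move: F10 F20 F40; lra.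
  rewrite /F3 ler_expR mul0r addr0; apply: le_trans small _.
  have : 2 * a ^+ 2 * l%:R <= Lp / 8 by apply: le_trans a_m; rewrite ler_wpM2l.
  move=> h; have : 2 * a ^+ 2 * l%:R * k%:R <= Lp / 8 * k%:R by rewrite ler_wpM2r.
  have : Lp * k1 <= Lp * k%:R by rewrite ler_wpM2l// ltW.
  by lra.
have bkl : big k l by rewrite /big krho lrho.
have [t [kl tauE wE at_ /andP[t0' te]]] := slope_facts kn lm bkl.
(* The Gaussian exponent [z * t + (2 * a - z)^2 / 2] is minimal at [2 * a - z = t]; the constraint
   [0 <= z] forces the minimum with [2 * a]. *)
pose h := Num.min t (2 * a).
have h2a : h <= 2 * a by rewrite ge_min lexx orbT.
have h0 : 0 <= h by rewrite le_min t0' mulr_ge0// ltW.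
have he : h <= eps by rewrite ge_min te.
have [|sh /andP[_ ph]] := phi_quad (u := h); first by rewrite ger0_norm.
have [|_ /andP[pa _]] := phi_quad (u := a).
  by rewrite gtr0_norm//; move: a_gt0 a_eps; lra.
exists (2 * a - h); rewrite (_ : 2 * a - (2 * a - h) = h); last by ring.
split => //; [by rewrite subr_ge0|by right|].
apply: (@le_trans _ _ (F4 k l)); last by move: F10 F20 F30; lra.
rewrite /F4 ler_expR tauE.
have key := truncated_exponent_le (ltW a_gt0) kap_bound at_ erefl (erefl h).
apply: (@le_trans _ _ ((1 - kap ^+ 2 / 2) * w k l)).
  rewrite -wE [leRHS](_ : _ = k%:R * l%:R * ((1 - kap ^+ 2 / 2) * (t ^+ 2 / 2))); last by ring.
  move: (phi h) (phi a) ph pa => fh fa ph pa.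
  rewrite [leLHS](_ : _ = k%:R * l%:R * ((2 * a - h) * t + (fh - 2 * fa))); last by ring.
  by rewrite ler_pM2l//; lra.
have : kap ^+ 2 / 4 * Lp * (rho * n%:R) <= kap ^+ 2 / 4 * Lp * k%:R.
  by rewrite ler_wpM2l ?mulr_ge0 ?sqr_ge0 ?(ltW Lp0)// ltW.
have : kap ^+ 2 / 4 * Lq * (rho * m%:R) <= kap ^+ 2 / 4 * Lq * l%:R.
  by rewrite ler_wpM2l ?mulr_ge0 ?sqr_ge0 ?(ltW Lq0)// ltW.
by rewrite /w /th; lra.
Qed.

Lemma overlap_sum_fixed (C : rect) : rect_of_size n m C ->
  \sum_(C' : rect | rect_of_size n m C')
    (F1 #|C.1 :&: C'.1| #|C.2 :&: C'.2| + F2 #|C.1 :&: C'.1| #|C.2 :&: C'.2| +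
     F3 #|C.1 :&: C'.1| #|C.2 :&: C'.2| + F4 #|C.1 :&: C'.1| #|C.2 :&: C'.2|) <=
  ('C(N, n) * 'C(M, m))%:R *
   (expR (18 * (a ^+ 2 * (n%:R * m%:R) * p * q)) + expR (1 - 3 / 8 * Lq) +
    expR (1 - 3 / 8 * Lp) + expR (- n%:R)).
Proof.
move=> Cr; have [k0 k1'] := andP kap_bound.
have k2 : kap ^+ 2 <= 1 by nra.
have k20 : 0 <= kap ^+ 2 by exact: sqr_ge0.
rewrite !big_split/= !mulrDr; do !apply: lerD.
- have a20 : 0 <= 2 * a ^+ 2 by rewrite mulr_ge0// sqr_ge0.
  apply: le_trans (overlap_sum_small n0 m0 nN mM Cr a20 a_sqrtq a_p) _.
  by rewrite ler_wpM2l// ler_expR le_eqVlt; apply/orP; left; apply/eqP; ring.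
- have L2 : 0 <= Lq / 2 by rewrite divr_ge0// ltW.
  apply: le_trans (overlap_sum_expR n0 m0 nN mM Cr _ (lexx 0) L2) _.
  rewrite ler_wpM2l// ler_expR expR0 subrr mulr0 add0r.
  have qs : q * expR (Lq / 2) = expR (- (Lq / 2)) by rewrite {1}qE -expRD; congr expR; field.
  have : m%:R * q * (expR (Lq / 2) - 1) <= m%:R * expR (- (Lq / 2)).
    by rewrite mulrBr -mulrA qs mulr1 gerBl mulr_ge0.
  have : m%:R * expR (- (Lq / 2)) <= l1 by rewrite le_max lexx orbT.
  have : 1 <= l1 by rewrite le_max lexx.
  (* [l1 - 3 / 8 * Lq * l1 <= 1 - 3 / 8 * Lq], since [l1 >= 1] and [Lq >= 8]. *)
  by move: Lq_ge; move: (m%:R * _ * _) => x; nra.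
- have L2 : 0 <= Lp / 2 by rewrite divr_ge0// ltW.
  apply: le_trans (overlap_sum_expR n0 m0 nN mM Cr _ L2 (lexx 0)) _.
  rewrite ler_wpM2l// ler_expR expR0 subrr mulr0 addr0.
  have qs : p * expR (Lp / 2) = expR (- (Lp / 2)) by rewrite {1}pE -expRD; congr expR; field.
  have : n%:R * p * (expR (Lp / 2) - 1) <= n%:R * expR (- (Lp / 2)).
    by rewrite mulrBr -mulrA qs mulr1 gerBl mulr_ge0.
  have : n%:R * expR (- (Lp / 2)) <= k1 by rewrite le_max lexx orbT.
  have : 1 <= k1 by rewrite le_max lexx.
  by move: Lp_ge; move: (n%:R * _ * _) => x; nra.
have th0 : 0 <= th by rewrite /th; lra.
have L1 : 0 <= th * Lp by rewrite mulr_ge0// ltW.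
have L2 : 0 <= th * Lq by rewrite mulr_ge0// ltW.
apply: le_trans (overlap_sum_expR n0 m0 nN mM Cr _ L1 L2) _.
rewrite ler_wpM2l// ler_expR.
(* For rows as for columns, the exponential moment costs at most [x] while the subtracted constant
   is at least [2 * x]. *)
have bnd (x L r : R) : 0 < x -> 0 < L -> r = expR (- L) ->
    2 <= rho * (kap ^+ 2 / 4 * L) ->
    x * r * (expR (th * L) - 1) - kap ^+ 2 / 4 * (L * (rho * x)) <= - x.
  move=> x0 L0 rE rL.
  have : r * (expR (th * L) - 1) <= 1.
    rewrite mulrBr mulr1 {1}rE -expRD.
    have : expR (- L + th * L) <= 1.
      by rewrite -expR0 ler_expR /th; move: (mulr_ge0 k20 (ltW L0)); lra.
    by have := expR_ge0 (- L); rewrite -rE; lra.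
  by move=> h; move: (expR _ - 1) h => e; nra.
have := bnd _ _ _ nR Lp0 pE rho_Lp; have := bnd _ _ _ mR Lq0 qE rho_Lq.
by move: mR; lra.
Qed.

Lemma type2_lower_bound_fixed (psi : obs -> R) (k : R) : is_test psi -> 0 < k ->
  (\int[P0]_y (1 - psi y)%:E <= type2 E t0 n m a psi +
    (k + (expR (18 * (a ^+ 2 * (n%:R * m%:R) * p * q)) - 1 + expR (1 - 3 / 8 * Lq) +
    expR (1 - 3 / 8 * Lp) + expR (- n%:R) +
    2 * (2 ^+ (n + m) * expR (- (rho * (kap ^+ 2 / 2) * rate)))) / (4 * k))%:E)%E.
Proof.
move=> psit k0.
apply: (type2_lower_bound Theta_t0 sigma_gt0 BC nN mM sa psit k0 first_moment_fixed
  (F := fun C C' => F1 #|C.1 :&: C'.1| #|C.2 :&: C'.2| + F2 #|C.1 :&: C'.1| #|C.2 :&: C'.2| +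
     F3 #|C.1 :&: C'.1| #|C.2 :&: C'.2| + F4 #|C.1 :&: C'.1| #|C.2 :&: C'.2|)).
- move=> C C' Cr Cr'; have /andP[/eqP C1 /eqP C2] := Cr.
  apply: (integral_lik_good2_le Theta_t0 sigma_gt0 BC sa Cr Cr').
  by apply: second_moment_exponent; rewrite -?C1 -?C2 subset_leq_card// finset.subsetIl.
- move=> C Cr; apply: le_trans (overlap_sum_fixed Cr) _.
  by rewrite ler_wpM2l//; lra.
Qed.

End lower_bound_fixed.
(** * Asymptotics of the lower bound *)

Section scale_facts.
Context (R : realType).
Implicit Types (K rho del bet kap e x y z n m Lp Lq : R).

Lemma seq_ubound (s : seq R) : exists W, forall x, x \in s -> x <= W.
Proof.
elim: s => [|y s [W sW]]; first by exists 0.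
exists (Num.max y W) => x; rewrite inE => /orP[/eqP ->|/sW xW].
  by rewrite le_max lexx.
by rewrite le_max xW orbT.
Qed.

Lemma expRN_le (x y : R) : 0 < y -> - ln y <= x -> expR (- x) <= y.
Proof. by move=> y0 xy; rewrite -[leRHS]lnK ?posrE// ler_expR lerNl. Qed.

Lemma ln_le_expR x y : 0 < x -> 0 < y -> ln x / y <= 1 / 4 -> x <= expR (y / 4).
Proof.
move=> x0 y0; rewrite ler_pdivrMr// => h.
by rewrite -[x]lnK// ler_expR; lra.
Qed.

(** The balance turns the two-term rate into [2 (K + 1) * (m * Lq)], and [m] cancels: this is how
    [a^2 n] is compared with [Lq] alone. *)
Lemma balanced_slope_le K n m Lp Lq x : 0 < m -> n * Lp <= K * (m * Lq) ->
  x * (n * m) <= 2 * (n * Lp + m * Lq) -> x * n <= 2 * (K + 1) * Lq.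
Proof.
by move=> m0 bal xr; rewrite -(ler_pM2r m0) -(mulrA x); apply: le_trans xr _; lra.
Qed.

Lemma slope_rho_le K rho x y z : 0 < rho -> rho * (K + 1) = 1 / 32 ->
  x * y <= 2 * (K + 1) * z -> 2 * x * (rho * y) <= z / 8.
Proof.
move=> rho0 rhoK /(ler_wpM2l (ltW rho0)).
have -> : rho * (2 * (K + 1) * z) = 2 * (rho * (K + 1)) * z by ring.
by rewrite rhoK; lra.
Qed.

(** [y <= expR (z / 4)] uses half of the decay [expR (- (z / 2))]; the other half absorbs the
    constant [12 (K + 1)]. *)
Lemma slope_expR_le K x y z : 1 <= K -> 4 * ln (12 * (K + 1)) <= z ->
  x <= 2 * (K + 1) * y -> y <= expR (z / 4) -> 6 * (x * expR (- (z / 2))) <= 1.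
Proof.
move=> K1 zK xy yz; have K12 : 0 < 12 * (K + 1) by lra.
have h1 : y * expR (- (z / 2)) <= expR (- (z / 4)).
  by apply: (le_trans (ler_wpM2r (expR_ge0 _) yz)); rewrite -expRD ler_expR; lra.
have h2 := ler_wpM2r (expR_ge0 (- (z / 2))) xy.
have h3 := ler_wpM2l (ltW K12) h1.
have h4 : expR (- (z / 4)) <= (12 * (K + 1))^-1.
  by apply: expRN_le; rewrite ?invr_gt0// lnV ?posrE// opprK; lra.
have h5 := ler_wpM2l (ltW K12) h4.
by move: h5; rewrite divff ?gt_eqF//; lra.
Qed.

Lemma exp2_le_expR (k : nat) : 2 ^+ k <= expR k%:R :> R.
Proof.
rewrite -[k%:R]mulr1 expRM_natl lerXn2r ?nnegrE ?expR_ge0//.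
by have := expR_ge1Dx (1 : R); lra.
Qed.

Lemma mass_error_le bet del Lp Lq (n m : nat) : 0 < bet -> 0 < del ->
  2 / bet <= Lp -> 2 / bet <= Lq -> - ln (del / 2) <= n%:R ->
  2 * (2 ^+ (n + m) * expR (- (bet * (n%:R * Lp + m%:R * Lq)))) <= del.
Proof.
move=> bet0 del0 bp bq dn.
suff : 2 ^+ (n + m) * expR (- (bet * (n%:R * Lp + m%:R * Lq))) <= del / 2 by lra.
apply: (le_trans (ler_wpM2r (expR_ge0 _) (exp2_le_expR _))).
rewrite -expRD -[leRHS]lnK ?posrE ?divr_gt0// ler_expR natrD.
move: bp bq; rewrite !ler_pdivrMr// => bp bq.
have := ler_wpM2l (ler0n R n) bp; have := ler_wpM2l (ler0n R m) bq.
have := ler0n R m; lra.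
Qed.

Lemma error_sum_le e x1 x2 x3 x4 x5 : 0 < e ->
  x1 <= e ^+ 2 / 6 -> x2 <= e ^+ 2 / 6 -> x3 <= e ^+ 2 / 6 -> x4 <= e ^+ 2 / 6 ->
  x5 <= e ^+ 2 / 6 -> e / 2 + (x1 + x2 + x3 + x4 + x5) / (4 * (e / 2)) <= e.
Proof.
move=> e0 h1 h2 h3 h4 h5.
rewrite -lerBrDl ler_pdivrMr; last by lra.
by have := sqr_ge0 e; lra.
Qed.

End scale_facts.

Section lower_bound_theorem.
Context d (X : measurableType d) (R : realType) (E : expFamily X R) (t0 : R)
  (B : R -> R) (N M n m : nat -> nat).
Hypothesis Theta_t0 : interior (ef_Theta E) t0.
Hypothesis sigma_gt0 : 0 < sigma0 E t0.
Hypothesis BC : forall t, ef_Theta E t -> B (ef_eta E t) = ef_C E t.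
Hypothesis nN : forall k, (n k <= N k)%N.
Hypothesis mM : forall k, (m k <= M k)%N.
Hypothesis noo : n @ \oo --> \oo.
Hypothesis moo : m @ \oo --> \oo.

Local Notation s0 := (s0 E t0).
Local Notation sset := (sset E t0).
Local Notation p k := ((n k)%:R / (N k)%:R : R).
Local Notation q k := ((m k)%:R / (M k)%:R : R).
Local Notation Lp k := (ln (p k)^-1).
Local Notation Lq k := (ln (q k)^-1).
Local Notation nm k := ((n k)%:R * (m k)%:R : R).
Local Notation rate k := ((n k)%:R * Lp k + (m k)%:R * Lq k : R).
Local Notation P0 k := (@model _ X R E t0 (N k) (M k) (const_mx s0)).

Hypothesis p0 : (fun k => p k) @ \oo --> (0 : R).
Hypothesis q0 : (fun k => q k) @ \oo --> (0 : R).
Hypothesis small : (fun k => Lp k / (m k)%:R + Lq k / (n k)%:R) @ \oo --> (0 : R).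

Hypothesis lnLp : (fun k => ln (Lp k) / Lq k) @ \oo --> (0 : R).
Hypothesis lnLq : (fun k => ln (Lq k) / Lp k) @ \oo --> (0 : R).
Hypothesis balanced : asymp_equiv (fun k => (n k)%:R * Lp k) (fun k => (m k)%:R * Lq k).

Variable a : nat -> R.
Hypothesis a0 : forall k, 0 < a k.
Hypothesis a_pq : (fun k => a k ^+ 2 * nm k * p k * q k) @ \oo --> (0 : R).
Hypothesis a_sup : (limn_esup (fun k => (a k ^+ 2 * nm k / (2 * rate k))%:E) < 1%:E)%E.

Let regime := near_regime nN mM noo moo p0 q0 small.

Lemma near_balanced : exists2 K : R, 1 <= K &
  \forall k \near \oo, (n k)%:R * Lp k <= K * ((m k)%:R * Lq k) /\
    (m k)%:R * Lq k <= K * ((n k)%:R * Lp k).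
Proof.
have [lo hi] := balanced.
have [y1 y10 near1] := near_limn_einf_gt lo.
have [y2 _ near2] := near_limn_esup_lt hi.
exists (Num.max 1 (Num.max y2 y1^-1)); first by rewrite le_max lexx.
near=> k.
have [n_gt0 m_gt0 _ _ [Lp1 Lq1 _]] : [/\ (0 < n k)%N, (0 < m k)%N,
    1 <= (n k)%:R :> R, 1 <= (m k)%:R :> R &
   [/\ 1 <= Lp k, 1 <= Lq k & Lp k / (m k)%:R + Lq k / (n k)%:R <= 1]].
  by near: k; exact: regime.
have u0 : 0 < (n k)%:R * Lp k by rewrite mulr_gt0 ?ltr0n// (lt_le_trans _ Lp1).
have v0 : 0 < (m k)%:R * Lq k by rewrite mulr_gt0 ?ltr0n// (lt_le_trans _ Lq1).
have h1 : y1 <= (n k)%:R * Lp k / ((m k)%:R * Lq k) by near: k.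
have h2 : (n k)%:R * Lp k / ((m k)%:R * Lq k) <= y2 by near: k.
split.
  move: h2; rewrite ler_pdivrMr// => /le_trans; apply.
  by rewrite ler_pM2r// !le_max lexx orbT.
move: h1; rewrite ler_pdivlMr// -ler_pdivlMl// => /le_trans; apply.
by rewrite ler_pM2r// !le_max lexx !orbT.
Unshelve. all: by end_near. Qed.

Lemma near_kap : exists2 kap : R, 0 < kap <= 1 / 2 &
  \forall k \near \oo, a k ^+ 2 * nm k / (2 * rate k) <= (1 - kap) ^+ 2.
Proof.
have [y y1 near1] := near_limn_esup_lt a_sup.
rewrite lte_fin in y1.
(* [kap <= (1 - y) / 2] gives [(1 - kap)^2 >= 1 - 2 * kap >= y]. *)
exists (Num.min (1 / 2) ((1 - y) / 2)).
  by rewrite ge_min lexx lt_min divr_gt0//= divr_gt0// subr_gt0.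
apply: filterS near1 => k /le_trans; apply.
set kap := Num.min _ _.
have : kap <= (1 - y) / 2 by rewrite ge_min lexx orbT.
by have := sqr_ge0 kap; lra.
Qed.

Lemma type2_lower_bound_near (e : R) : 0 < e -> \forall k \near \oo,
  sset (s0 + a k) /\ forall psi, is_test psi ->
  (\int[P0 k]_y (1 - psi y)%:E <= type2 E t0 (n k) (m k) (a k) psi + e%:E)%E.
Proof.
move=> e0.
have [K K1 nearK] := near_balanced.
have [kap kap01 nearkap] := near_kap.
have [kap0 kap1] := andP kap01.
have eta0 : 0 < kap ^+ 2 / 4 by rewrite divr_gt0 ?exprn_gt0.
have [eps eps0 quad] := cumulant_quad Theta_t0 sigma_gt0 BC eta0.
(* From [a^2 n <= 2 (K + 1) Lq] this value yields exactly [2 a^2 * (rho * n) <= Lq / 8]. *)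
pose rho := (32 * (K + 1))^-1.
have K0 : 0 < 32 * (K + 1) by lra.
have rho0 : 0 < rho by rewrite invr_gt0.
have rho1 : rho <= 1 by rewrite invf_le1//; lra.
have rhoK : rho * (K + 1) = 1 / 32 by rewrite /rho; field; lra.
(* With [k = e / 2] in the second moment bound, five errors of size [e^2 / 6] contribute [5 e / 12],
   less than the remaining [e / 2]. *)
pose del := e ^+ 2 / 6; have del0 : 0 < del by rewrite divr_gt0// exprn_gt0.
pose bet := rho * (kap ^+ 2 / 2).
have bet0 : 0 < bet by rewrite mulr_gt0// divr_gt0// exprn_gt0.
have [W WE] := seq_ubound [:: 8; - (2 * ln rho); 4 * ln (12 * (K + 1));
  4 / bet; 2 / bet; 8 / 3 * (1 - ln del); - ln del; - ln (del / 2)].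
(* The first bound keeps [2 * a] in the quadratic window, the second the truncation level of the
   [big] subrectangles. *)
pose sm := Num.min (eps ^+ 2 / 8) (rho / 2 * eps ^+ 2).
have sm0 : 0 < sm by rewrite lt_min divr_gt0 ?exprn_gt0//= mulr_gt0 ?divr_gt0 ?exprn_gt0.
(* [expR_sub1_le] needs [18 * x <= 1] and gives [expR (18 * x) - 1 <= 54 * x]. *)
pose sm' := Num.min (1 / 18) (del / 54).
have sm'0 : 0 < sm' by rewrite lt_min; apply/andP; split; apply: divr_gt0.
have rhoL x : W <= x -> 2 <= rho * (kap ^+ 2 / 4 * x).
  move=> Wx; have : 4 / bet <= x.
    by apply: le_trans (WE _ _) Wx; rewrite !inE eqxx ?orbT.
  by rewrite ler_pdivrMr// /bet; lra.
have expd x : W <= x -> expR (1 - 3 / 8 * x) <= del.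
  move=> Wx; have : 8 / 3 * (1 - ln del) <= x.
    by apply: le_trans (WE _ _) Wx; rewrite !inE eqxx ?orbT.
  by move=> hx; rewrite -opprB; apply: expRN_le => //; lra.
have eps4 x : x ^+ 2 <= 2 * sm -> 2 * x <= eps.
  move=> xsm; apply: ler_of_sqr; first exact: ltW.
  rewrite exprMn; have : sm <= eps ^+ 2 / 8 by rewrite ge_min lexx.
  lra.
have eps1 x : 0 < x -> 2 * x <= eps -> `|x| <= eps by move=> x0; rewrite gtr0_norm//; lra.
have smT x : 0 <= x -> x <= sm' -> expR (18 * x) - 1 <= del.
  rewrite le_min => x0 /andP[s1 s2].
  by apply: (le_trans (expR_sub1_le _)); lra.
have exp_rho x : W <= x -> expR (- (x / 2)) <= rho.
  move=> Wx; apply: expRN_le => //.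
  have : - (2 * ln rho) <= x by apply: le_trans (WE _ _) Wx; rewrite !inE eqxx ?orbT.
  lra.
have kap2 : (1 - kap) ^+ 2 <= 1 by rewrite exprn_ile1//; lra.
near=> k.
have [n_gt0 m_gt0 nW mW [LpW LqW hsm]] : [/\ (0 < n k)%N, (0 < m k)%N,
    W <= (n k)%:R, W <= (m k)%:R &
   [/\ W <= Lp k, W <= Lq k & Lp k / (m k)%:R + Lq k / (n k)%:R <= sm]].
  by near: k; exact: regime.
have nR : 0 < (n k)%:R :> R by rewrite ltr0n.
have mR : 0 < (m k)%:R :> R by rewrite ltr0n.
have nmR : 0 < nm k by rewrite mulr_gt0.
have Lp8 : 8 <= Lp k by apply: le_trans (WE _ _) LpW; rewrite !inE eqxx ?orbT.
have Lq8 : 8 <= Lq k by apply: le_trans (WE _ _) LqW; rewrite !inE eqxx ?orbT.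
have Lp0 : 0 < Lp k := lt_le_trans (ltr0n R 8) Lp8.
have Lq0 : 0 < Lq k := lt_le_trans (ltr0n R 8) Lq8.
have [bal1 bal2] : (n k)%:R * Lp k <= K * ((m k)%:R * Lq k) /\
    (m k)%:R * Lq k <= K * ((n k)%:R * Lp k) by near: k.
have rate0 : 0 < rate k by rewrite addr_gt0// mulr_gt0.
have a2rate : a k ^+ 2 * nm k <= (1 - kap) ^+ 2 * (2 * rate k).
  by rewrite -ler_pdivrMr ?mulr_gt0//; near: k.
have a2rate' : a k ^+ 2 * nm k <= 2 * rate k.
  by apply: le_trans a2rate _; rewrite ler_piMl// mulr_ge0// ltW.
(* Smallness of [a] is derived: its square is at most [2 * rate / (n m)], which tends to 0. *)
have a2sm : a k ^+ 2 <= 2 * sm.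
  have e1 : 2 * rate k = 2 * (Lp k / (m k)%:R + Lq k / (n k)%:R) * nm k.
    by field; rewrite !gt_eqF.
  have : a k ^+ 2 <= 2 * (Lp k / (m k)%:R + Lq k / (n k)%:R).
    by rewrite -(ler_pM2r nmR) -e1.
  by move=> /le_trans; apply; rewrite ler_wpM2l.
have a2eps := eps4 _ a2sm.
have an : a k ^+ 2 * (n k)%:R <= 2 * (K + 1) * Lq k.
  exact: balanced_slope_le bal1 a2rate'.
have am : a k ^+ 2 * (m k)%:R <= 2 * (K + 1) * Lp k.
  by apply: balanced_slope_le bal2 _; rewrite // mulrC (mulrC (m k)%:R) mulrC addrC.
(* The condition on iterated logarithms enters here: [a^2 m] is only bounded by a multiple of [Lp],
   and must be absorbed by [expR (- (Lq / 2))]. *)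
have lnp : Lp k <= expR (Lq k / 4).
  by apply: ln_le_expR => //; near: k; apply: near_le_of_cvg0.
have lnq : Lq k <= expR (Lp k / 4).
  by apply: ln_le_expR => //; near: k; apply: near_le_of_cvg0.
have WK x : W <= x -> 4 * ln (12 * (K + 1)) <= x.
  by move=> Wx; apply: le_trans (WE _ _) Wx; rewrite !inE eqxx ?orbT.
have pE : p k = expR (- Lp k).
  have pk0 : 0 < p k by rewrite divr_gt0// ltr0n (leq_trans n_gt0 (nN k)).
  by rewrite lnV ?posrE// opprK lnK.
have slope_eps : 2 / rho * (Lp k / (m k)%:R + Lq k / (n k)%:R) <= eps ^+ 2.
  have : sm <= rho / 2 * eps ^+ 2 by rewrite ge_min lexx orbT.
  move/(le_trans hsm); rewrite -ler_pdivrMl ?divr_gt0//.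
  by rewrite invf_div.
have a_n := slope_rho_le rho0 rhoK an.
have a_m := slope_rho_le rho0 rhoK am.
have a_sqrtq : 2 * a k ^+ 2 * ((m k)%:R * expR (- (Lq k / 2))) <= 1.
  have := slope_expR_le K1 (WK _ LqW) am lnp.
  apply: le_trans; rewrite -[leLHS]mulrA [X in 2 * X]mulrA ler_wpM2r ?ler_nat//.
  by rewrite !mulr_ge0 ?expR_ge0 ?exprn_ge0 ?(ltW (a0 k)).
have a_p : 3 * ((n k)%:R * p k * (2 * a k ^+ 2)) <= 1.
  rewrite {1}pE; have := slope_expR_le K1 (WK _ LpW) an lnq.
  apply: le_trans.
  have -> : 3 * ((n k)%:R * expR (- Lp k) * (2 * a k ^+ 2)) =
    6 * (a k ^+ 2 * (n k)%:R * expR (- Lp k)) by ring.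
  rewrite ler_wpM2l// ler_wpM2l ?mulr_ge0 ?exprn_ge0 ?(ltW (a0 k))// ler_expR lerN2.
  by rewrite ler_pdivrMr// ler_peMr ?(ltW Lp0) ?ler1n.
have key psi (psit : is_test psi) := type2_lower_bound_fixed (rho := rho)
  Theta_t0 sigma_gt0 BC n_gt0 m_gt0 (nN k) (mM k) (a0 k) kap01
  (introT andP (conj rho0 rho1)) quad a2eps a2rate Lp8 Lq8 slope_eps a_n a_m
  (exp_rho _ LpW) a_sqrtq a_p (rhoL _ LpW) (rhoL _ LqW) psit (divr_gt0 e0 (ltr0n R 2)).
split; first by case: (quad (a k)) => //; exact: eps1.
move=> psi psit; apply: le_trans (key psi psit) _.
rewrite leeD2l// lee_fin; apply: error_sum_le => //.
- apply: smT; last by near: k; exact: near_le_of_cvg0.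
  by do !apply: mulr_ge0; rewrite ?invr_ge0 ?ler0n ?(ltW (a0 k)).
- exact: expd.
- exact: expd.
- apply: expRN_le => //.
  by apply: le_trans (WE _ _) nW; rewrite !inE eqxx ?orbT.
- apply: mass_error_le => //.
  + by apply: le_trans (WE _ _) LpW; rewrite !inE eqxx ?orbT.
  + by apply: le_trans (WE _ _) LqW; rewrite !inE eqxx ?orbT.
  + by apply: le_trans (WE _ _) nW; rewrite !inE eqxx ?orbT.
Unshelve. all: by end_near. Qed.

End lower_bound_theorem.

Lemma cvge_of_le (R : realType) (f : nat -> \bar R) (l : R) :
  (\forall k \near \oo, (f k <= l%:E)%E) ->
  (forall e : R, 0 < e -> \forall k \near \oo, ((l - e)%:E <= f k)%E) ->
  f @ \oo --> l%:E.
Proof.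
move=> fl lf; apply/fine_cvgP; split.
  apply: filterS2 fl (lf 1 ltr01) => k; case: (f k) => //.
apply/cvgrPdist_le => e e0; apply: filterS2 fl (lf e e0) => k /=.
by case: (f k) => //= r; rewrite !lee_fin => h1 h2; rewrite ger0_norm; lra.
Qed.

(** * From one inequality valid for all tests to the two minimax quantities *)

Section minimax.
Context d (X : measurableType d) (R : realType) (E : expFamily X R) (t0 : R).
Variables (N M n m : nat) (a : R).

Local Notation P0 := (@model _ X R E t0 N M (const_mx (s0 E t0))).

Lemma is_test_cst (c : R) : 0 <= c <= 1 -> is_test (fun _ : obs R N M => c).
Proof. by move=> c01; split. Qed.

Lemma type1_cst (c : R) : type1 E t0 (fun _ : obs R N M => c) = c%:E.
Proof. exact: expectation_cst. Qed.

Lemma type2_cst_le (c : R) :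
  (type2 E t0 n m a (fun _ : obs R N M => c) <= (1 - c)%:E)%E.
Proof.
by apply: ge_ereal_sup => _ [S _ <-]; rewrite expectation_cst.
Qed.

Lemma minimax_risk_le1 : (minimax_risk E t0 N M n m a <= 1)%E.
Proof.
apply: (@le_trans _ _ (risk E t0 n m a (fun _ : obs R N M => 0))).
  by apply: ereal_inf_lbound; exists (fun=> 0) => //; apply: is_test_cst; rewrite lexx ler01.
by rewrite /risk type1_cst add0e (le_trans (type2_cst_le _))// subr0.
Qed.

Lemma minimax_type2_le (alpha : R) : 0 <= alpha <= 1 ->
  (minimax_type2 E t0 N M n m a alpha <= (1 - alpha)%:E)%E.
Proof.
move=> /andP[al0 al1].
apply: (@le_trans _ _ (type2 E t0 n m a (fun _ : obs R N M => alpha))).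
  apply: ereal_inf_lbound; exists (fun=> alpha) => //; split.
    by apply: is_test_cst; rewrite al0.
  by rewrite type1_cst.
exact: type2_cst_le.
Qed.

(** Turns the bound of the null mean of [1 - psi] by the type II error into lower bounds for the
    total risk and for the type II error at a given level. *)
Lemma type1_compl (psi : obs R N M -> R) : is_test psi ->
  (type1 E t0 psi + \int[P0]_y (1 - psi y)%:E = 1)%E.
Proof.
move=> [mpsi psi01]; rewrite /type1 unlock -ge0_integralD//; last 4 first.
- by move=> y _; rewrite lee_fin; have /andP[] := psi01 y.
- exact/measurable_EFinP.
- by move=> y _; rewrite lee_fin subr_ge0; have /andP[] := psi01 y.
- by apply/measurable_EFinP; apply: measurable_funB.
under eq_integral do rewrite -EFinD addrC subrK.
by rewrite integral_cst// mul1e; exact: probability_setT.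
Qed.

Lemma minimax_risk_ge (e : R) :
  (forall psi, is_test psi ->
    \int[P0]_y (1 - psi y)%:E <= type2 E t0 n m a psi + e%:E)%E ->
  ((1 - e)%:E <= minimax_risk E t0 N M n m a)%E.
Proof.
move=> lb; apply: le_ereal_inf_tmp => _ [psi psit <-].
rewrite EFinB leeBlDr// /risk -addeA -(type1_compl psit).
by rewrite leeD2l//; exact: lb.
Qed.

Lemma minimax_type2_ge (alpha e : R) :
  (forall psi, is_test psi ->
    \int[P0]_y (1 - psi y)%:E <= type2 E t0 n m a psi + e%:E)%E ->
  ((1 - alpha - e)%:E <= minimax_type2 E t0 N M n m a alpha)%E.
Proof.
move=> lb; apply: le_ereal_inf_tmp => _ [psi [psit psia] <-].
rewrite EFinB leeBlDr// (le_trans _ (lb _ psit))// EFinB leeBlDl//.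
by rewrite -(type1_compl psit) leeD2r.
Qed.

End minimax.

Theorem theorem4p2 (R : realType) (d : measure_display) (X : measurableType d)
    (E : expFamily X R) (t0 : R) (B : R -> R) (N M n m : nat -> nat)
    (Theta_t0 : interior (ef_Theta E) t0)
    (sigma_gt0 : 0 < sigma0 E t0)
    (BC : forall t, ef_Theta E t -> B (ef_eta E t) = ef_C E t)
    (nN : forall k, (n k <= N k)%N) (mM : forall k, (m k <= M k)%N)
    (Noo : N @ \oo --> \oo) (Moo : M @ \oo --> \oo)
    (noo : n @ \oo --> \oo) (moo : m @ \oo --> \oo) :
  let p := fun k => (n k)%:R / (N k)%:R : R in
  let q := fun k => (m k)%:R / (M k)%:R : R in
  let Lp := fun k => ln (p k)^-1 in
  let Lq := fun k => ln (q k)^-1 in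
  let nm := fun k => (n k)%:R * (m k)%:R : R in
  let rate := fun k => (n k)%:R * Lp k + (m k)%:R * Lq k : R in
  let A := Afun E t0 B in
  p @ \oo --> (0 : R) ->
  q @ \oo --> (0 : R) ->
  (fun k => Lp k / (m k)%:R + Lq k / (n k)%:R) @ \oo --> (0 : R) ->
  (forall a : nat -> R,
    let condI :=
      (fun k => derive1 A (s0 E t0 + a k) * Num.sqrt (nm k * p k * q k)) @ \oo --> +oo%R in
    let condII :=
      (1%:E < limn_einf (fun k => (derive1 A (s0 E t0 + a k) * Num.sqrt (nm k) /
                                Num.sqrt (2 * rate k))%:E))%E in
    (forall k, 0 < a k) ->
    (\forall k \near \oo, sset E t0 (s0 E t0 + a k) /\ derivable A (s0 E t0 + a k) 1) ->
    condI \/ condII ->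
    exists2 delta0 : R, 0 < delta0 &
      forall delta : R, 0 < delta <= delta0 ->
      forall H : nat -> R,
        H @ \oo --> +oo%R ->
        (condI -> exists2 c : R, 0 < c < 1 &
           \forall k \near \oo,
             H k <= c * (derive1 A (s0 E t0 + a k) * Num.sqrt (nm k * p k * q k))) ->
        (fun k => risk E t0 (n k) (m k) (a k)
                    (@psistar R (N k) (M k) (n k) (m k) delta (H k))) @ \oo
          --> (0%:E : \bar R)) /\
  ((fun k => ln (Lp k) / Lq k) @ \oo --> (0 : R) ->
   (fun k => ln (Lq k) / Lp k) @ \oo --> (0 : R) ->
   asymp_equiv (fun k => (n k)%:R * Lp k) (fun k => (m k)%:R * Lq k) ->
   forall a : nat -> R,
    (forall k, 0 < a k) ->
    (fun k => a k ^+ 2 * nm k * p k * q k) @ \oo --> (0 : R) ->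
    (limn_esup (fun k => (a k ^+ 2 * nm k / (2 * rate k))%:E) < 1%:E)%E ->
    (fun k => minimax_risk E t0 (N k) (M k) (n k) (m k) (a k)) @ \oo
      --> (1%:E : \bar R) /\
    forall alpha : R, 0 < alpha < 1 ->
      (fun k => minimax_type2 E t0 (N k) (M k) (n k) (m k) (a k) alpha) @ \oo
        --> ((1 - alpha)%:E : \bar R)).
Proof.
move=> p q Lp Lq nm rate A p0 q0 small; split.
  move=> a condI condII a0 a_sset.
  exact: (upper_bound_cvg Theta_t0 sigma_gt0 BC nN mM noo moo p0 q0 small a0 a_sset).
move=> lnLp lnLq bal a a0 a_pq a_sup.
have lb := type2_lower_bound_near Theta_t0 sigma_gt0 BC nN mM noo moo p0 q0 small
  lnLp lnLq bal a0 a_pq a_sup.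
split=> [|alpha /andP[al0 al1]]; apply: cvge_of_le.
- by apply: nearW => k; exact: minimax_risk_le1.
- by move=> e /lb; apply: filterS => k [_]; exact: minimax_risk_ge.
- by apply: nearW => k; apply: minimax_type2_le; rewrite !ltW.
- by move=> e /lb; apply: filterS => k [_]; exact: minimax_type2_ge.
Qed.
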